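(* Let $n\geq 1$ and $\sigma\in(0,1)$, with additionally $\sigma<1/2$ if $n=1$, and assume $n\geq 4\sigma$. Then $$S_{n,\sigma}(\mathbb{R}^n_+) < S_{n,\sigma}(\mathbb{R}^n).$$
   Context: For an open set $\Omega\subset\mathbb{R}^n$ and a function $u$ on $\Omega$ let $I_{n,\sigma,\Omega}[u]=\iint_{\Omega\times\Omega}\frac{(u(x)-u(y))^2}{|x-y|^{n+2\sigma}}\,dx\,dy$. $\mathring H^\sigma(\mathbb{R}^n)$ denotes the space of real functions $u$ on $\mathbb{R}^n$ with $I_{n,\sigma,\mathbb{R}^n}[u]<\infty$ and $|\{|u|>\tau\}|<\infty$ for all $\tau>0$, and $S_{n,\sigma}(\mathbb{R}^n)=\inf_{0\not\equiv u\in\mathring H^\sigma(\mathbb{R}^n)} I_{n,\sigma,\mathbb{R}^n}[u]\big/\big(\int_{\mathbb{R}^n}|u|^{\frac{2n}{n-2\sigma}}dx\big)^{\frac{n-2\sigma}{n}}$. $\mathbb{R}^n_+=\{(x',x_n)\in\mathbb{R}^{n-1}\times\mathbb{R}: x_n>0\}$; $\mathring H^\sigma(\mathbb{R}^n_+)$ is the completion of $C^1_c(\mathbb{R}^n_+)$ with respect to the quadratic form $I_{n,\sigma,\mathbb{R}^n_+}$ (it embeds into $L^{\frac{2n}{n-2\sigma}}(\mathbb{R}^n_+)$), and $S_{n,\sigma}(\mathbb{R}^n_+)=\inf_{0\not\equiv u\in\mathring H^\sigma(\mathbb{R}^n_+)} I_{n,\sigma,\mathbb{R}^n_+}[u]\big/\big(\int_{\mathbb{R}^n_+}|u|^{\frac{2n}{n-2\sigma}}dx\big)^{\frac{n-2\sigma}{n}}$.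 *)

(* Defs.v *)
From HB Require Import structures.
From mathcomp Require Import all_boot all_order all_algebra.
From mathcomp Require Import all_classical all_reals all_analysis.
Set Implicit Arguments. Unset Strict Implicit. Unset Printing Implicit Defensive.
Import Order.TTheory GRing.Theory Num.Theory.
Import numFieldNormedType.Exports.
Local Open Scope classical_set_scope.
Local Open Scope ring_scope.

(* Points of R^n are represented as n-tuples of reals; n.-tuple R carries the
   library's product (Borel) sigma-algebra. *)

(* Iterated Lebesgue integral over R^n (coordinate by coordinate).  For
   nonnegative measurable integrands this is (by Tonelli) the Lebesgue
   integral over R^n. *)
Fixpoint iint (R : realType) (n : nat) : (n.-tuple R -> \bar R) -> \bar R :=
  match n as m return (m.-tuple R -> \bar R) -> \bar R with
  | 0 => fun f => f [tuple]
  | m.+1 => fun f =>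
      iint (fun t : m.-tuple R =>
              (\int[@lebesgue_measure R]_x f [tuple of x :: t])%E)
  end.

Definition lebn (R : realType) (n : nat) (A : set (n.-tuple R)) : \bar R :=
  iint (fun t => (\1_A t)%:E).

Definition tdist (R : realType) (n : nat) (x y : n.-tuple R) : R :=
  Num.sqrt (\sum_(i < n) (tnth x i - tnth y i) ^+ 2).

Definition Iform (R : realType) (n : nat) (sigma : R) (Om : set (n.-tuple R))
    (u : n.-tuple R -> R) : \bar R :=
  iint (fun y => iint (fun x =>
    ((\1_Om x * \1_Om y) *
     ((u x - u y) ^+ 2 / (tdist x y `^ (n%:R + 2 * sigma))))%:E)).

Definition pexp (R : realType) (n : nat) (sigma : R) : R :=
  2 * n%:R / (n%:R - 2 * sigma).

Definition Lpint (R : realType) (n : nat) (sigma : R) (Om : set (n.-tuple R))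
    (u : n.-tuple R -> R) : \bar R :=
  iint (fun x => (\1_Om x * `|u x| `^ pexp n sigma)%:E).

Definition quot (R : realType) (n : nat) (sigma : R) (Om : set (n.-tuple R))
    (u : n.-tuple R -> R) : \bar R :=
  (Iform sigma Om u / poweR (Lpint sigma Om u) ((n%:R - 2 * sigma) / n%:R))%E.

Definition fullsp (R : realType) (n : nat) : set (n.-tuple R) := setT.
Definition halfsp (R : realType) (n : nat) : set (n.-tuple R) :=
  [set x | 0 < nth 0 (tval x) n.-1].

Definition tuple_of_row (R : realType) (n : nat) (v : 'rV[R]_n) : n.-tuple R :=
  [tuple v ord0 i | i < n].

Definition C1c_half (R : realType) (n : nat) (phi : n.-tuple R -> R) : Prop :=
  let g := fun v : 'rV[R]_n => phi (tuple_of_row v) in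
  (forall v : 'rV[R]_n, differentiable g v) /\
  (forall h : 'rV[R]_n, continuous (fun v => 'd g v h)) /\
  compact (closure [set v | g v != 0]) /\
  closure [set v | g v != 0] `<=` [set v | @halfsp R n (tuple_of_row v)].

Definition Hfull (R : realType) (n : nat) (sigma : R) (u : n.-tuple R -> R)
  : Prop :=
  measurable_fun [set: n.-tuple R] u /\
  (Iform sigma (@fullsp R n) u < +oo)%E /\
  (forall tau : R, 0 < tau -> (lebn [set x | (tau < `|u x|)%R] < +oo)%E).

(* \mathring H^sigma(R^n_+): the completion of C^1_c(R^n_+) w.r.t. I_{R^n_+},
   realised inside L^{2n/(n-2sigma)}(R^n_+) via the embedding *)
Definition Hhalf (R : realType) (n : nat) (sigma : R) (u : n.-tuple R -> R)
  : Prop :=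
  measurable_fun [set: n.-tuple R] u /\
  (Lpint sigma (@halfsp R n) u < +oo)%E /\
  exists phi : nat -> n.-tuple R -> R,
    (forall k, C1c_half (phi k)) /\
    ((fun k => Iform sigma (@halfsp R n) (u \- phi k)) @ \oo --> 0%E) /\
    ((fun k => Lpint sigma (@halfsp R n) (u \- phi k)) @ \oo --> 0%E).

Definition nonzero_on (R : realType) (n : nat) (Om : set (n.-tuple R))
    (u : n.-tuple R -> R) : Prop :=
  lebn (Om `&` [set x | u x != 0]) != 0%E.

Definition S_full (R : realType) (n : nat) (sigma : R) : \bar R :=
  ereal_inf [set quot sigma (@fullsp R n) u |
             u in [set u | Hfull sigma u /\ nonzero_on (@fullsp R n) u]].

Definition S_half (R : realType) (n : nat) (sigma : R) : \bar R :=
  ereal_inf [set quot sigma (@halfsp R n) u |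
             u in [set u | Hhalf sigma u /\ nonzero_on (@halfsp R n) u]].

(* Main.v *)
(* Let S be the constant of R^n and suppose S <= S_half.  A near-minimizer v for S
   with |v|_p = 1 can be rescaled, by a refined Sobolev inequality, so that the
   integral of v^2 over B_1 is bounded below.  Cut v off on the ball B_r(a), a in B_2,
   and apply the Kelvin transform about a: this does not increase the energy,
   preserves the L^p norm, and gives a function supported in a ball of radius 1/r,
   which we place in the half-space at distance 1/r from the boundary.  Restricting the
   energy to the half-space saves at least
   c r^(2 sigma) int u_a^2 |x-a|^(-4 sigma), while S <= S_half says that what is left is
   still at least S |u_a|_p^2.  Averaged over a in B_2, the saving is at least
   c r^(n-2 sigma) log(1/r), because n >= 4 sigma, whereas the cut-off costs only
   O(r^(n-2 sigma)) plus the defect of the near-minimizer.  Small r gives a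
   contradiction. *)
Require Import Defs.
From HB Require Import structures.
From mathcomp Require Import all_boot all_order all_algebra.
From mathcomp Require Import all_classical all_reals all_analysis.
From mathcomp Require Import measurable_realfun measurable_fun_approximation ring lra.
Import Order.TTheory GRing.Theory Num.Theory.
Import numFieldNormedType.Exports.
Local Open Scope classical_set_scope.
Local Open Scope ring_scope.
Set Implicit Arguments. Unset Strict Implicit. Unset Printing Implicit Defensive.

(** * Lebesgue measure on tuples *)

Section product_of_lebesgue.
Variable R : realType.

(** The obstacle is that no minimizer for the whole space is at hand, neither an explicit one nor
    one known to exist. A near-minimizer carries no pointwise or uniform $L^2$ information, so
    nothing can be said at a single centre a. Integrating over a turns each loss on $B_{2r}(a)$ into
    a global quantity times a multiple of $r^n$, and every constant then depends on n, sigma and S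
    only. Hence r can be fixed first and the defect of the near-minimizer afterwards. The cut-off
    near a is the price for compact support after the Kelvin transform. When $n = 4\sigma$ gain and
    price are both of order $r^{2\sigma}$, and only the logarithm from integrating $|x|^{-n}$
    decides. When $n > 4\sigma$ the weight $|x|^{-4\sigma}$ is estimated wastefully by
    $r^{n-4\sigma}|x|^{-n}$, so that one computation serves both cases. The Kelvin transform of a
    near-minimizer is not of class $C^1$, which is why truncation and mollification stand between it
    and the definition of the half-space constant. *)

Definition leb : {sigma_finite_measure set (measurableTypeR R) -> \bar R} :=
  lebesgue_measure.

Definition pcons (n : nat) (p : measurableTypeR R * n.-tuple R) : n.+1.-tuple R :=
  [tuple of p.1 :: p.2].

Definition puncons (n : nat) (t : n.+1.-tuple R) : measurableTypeR R * n.-tuple R :=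
  (thead t, [tuple of behead t]).

Lemma pconsK n : cancel (@pcons n) (@puncons n).
Proof. by move=> [x t]; congr pair; apply/val_inj. Qed.

Lemma punconsK n : cancel (@puncons n) (@pcons n).
Proof. by move=> t; rewrite [RHS]tuple_eta. Qed.

Lemma measurable_pcons n : measurable_fun [set: measurableTypeR R * n.-tuple R] (@pcons n).
Proof. exact: measurable_cons. Qed.

Lemma measurable_puncons n : measurable_fun [set: n.+1.-tuple R] (@puncons n).
Proof.
apply: measurable_fun_pair; first exact: measurable_tnth.
exact: measurable_behead.
Qed.

(** [iint] is an iterated integral and not an integral against a measure. The product measure on
    tuples, transported along [pcons], makes Tonelli, monotone convergence and almost-everywhere
    equality available; [iintE] is the bridge. *)
Definition munS n (m : {sigma_finite_measure set (n.-tuple R) -> \bar R}) :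
  set (n.+1.-tuple R) -> \bar R :=
  fun A => (leb \x m)%E (@pcons n @^-1` A).

Section munS_measure.
Variables (n : nat) (m : {sigma_finite_measure set (n.-tuple R) -> \bar R}).

Let munS0 : munS m set0 = 0%E.
Proof. by rewrite /munS preimage_set0 measure0. Qed.

Let munS_ge0 A : (0 <= munS m A)%E.
Proof. exact: measure_ge0. Qed.

Let munS_sigma_additive : semi_sigma_additive (munS m).
Proof.
move=> F mF tF mUF; rewrite /munS preimage_bigcup.
apply: measure_semi_sigma_additive.
- by move=> k; rewrite -[X in measurable X]setTI; exact: measurable_pcons.
- apply/trivIsetP => /= i j _ _ ij; rewrite -preimage_setI.
  by move/trivIsetP : tF => /(_ _ _ _ _ ij) ->//; rewrite preimage_set0.
- by rewrite -preimage_bigcup -[X in measurable X]setTI; exact: measurable_pcons.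
Qed.

HB.instance Definition _ := isMeasure.Build _ _ _
  (munS m) munS0 munS_ge0 munS_sigma_additive.

Let munS_sigma_finite : sigma_finite setT (munS m).
Proof.
have /sigma_finiteP[F [TF ndF Foo]] := sigma_finiteT leb.
have /sigma_finiteP[G [TG ndG Goo]] := sigma_finiteT m.
have FG : \bigcup_k (F k `*` G k) = setT.
  rewrite -setXTT TF TG predeqE => -[x y]; split.
    by move=> [k _ []/= ? ?]; split; exists k.
  move=> [/= [k _ Fnx] [l _ Gky]]; exists (maxn k l) => //; split.
  - by move: x Fnx; exact/subsetPset/ndF/leq_maxl.
  - by move: y Gky; exact/subsetPset/ndG/leq_maxr.
exists (fun k => @puncons n @^-1` (F k `*` G k)).
  by rewrite -preimage_bigcup FG preimage_setT.
move=> k; have [mF Fk] := Foo k; have [mG Gk] := Goo k; split.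
  rewrite -[X in measurable X]setTI; apply: measurable_puncons => //.
  exact: measurableX.
rewrite /munS -comp_preimage (_ : _ \o _ = id); last first.
  by apply/funext => p /=; rewrite pconsK.
rewrite preimage_id product_measure1E// lte_mul_pinfty// ge0_fin_numE//.
Qed.

HB.instance Definition _ := Measure_isSigmaFinite.Build _ _ _ (munS m)
  munS_sigma_finite.
End munS_measure.

Section mun0_measure.
Let sf0 : sigma_finite setT (@dirac _ (0.-tuple R) [tuple] R).
Proof.
exists (fun=> setT); first by rewrite bigcup_const.
by move=> k; split => //; rewrite diracT ltry.
Qed.
Definition mun0 : set (0.-tuple R) -> \bar R := @dirac _ (0.-tuple R) [tuple] R.
HB.instance Definition _ := Measure.on mun0.
HB.instance Definition _ := Measure_isSigmaFinite.Build _ _ _ mun0 sf0.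
End mun0_measure.

Fixpoint mun (n : nat) : {sigma_finite_measure set (n.-tuple R) -> \bar R} :=
  match n with
  | 0 => mun0
  | m.+1 => munS (mun m)
  end.

Local Open Scope ereal_scope.

Lemma integral_munS n (f : n.+1.-tuple R -> \bar R) :
  measurable_fun [set: n.+1.-tuple R] f -> (forall x, 0 <= f x) ->
  \int[mun n.+1]_x f x = \int[leb \x mun n]_p f (pcons p).
Proof.
move=> mf f0.
rewrite [LHS](_ : _ =
  \int[pushforward (leb \x mun n) (@pcons n)]_x f x)//.
by rewrite ge0_integral_pushforward//; exact: measurable_pcons.
Qed.

Lemma integral_munS_iter n (f : n.+1.-tuple R -> \bar R) :
  measurable_fun [set: n.+1.-tuple R] f -> (forall x, 0 <= f x) ->
  \int[mun n.+1]_x f x =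
  \int[mun n]_t \int[leb]_x f (pcons (x, t)).
Proof.
move=> mf f0; rewrite integral_munS//.
rewrite (@fubini_tonelli2 _ _ _ _ _ _ _ (fun p => f (pcons p)))//.
by apply: measurableT_comp => //; exact: measurable_pcons.
Qed.

Lemma measurable_integral_munS n (f : n.+1.-tuple R -> \bar R) :
  measurable_fun [set: n.+1.-tuple R] f -> (forall x, 0 <= f x) ->
  measurable_fun [set: n.-tuple R] (fun t => \int[leb]_x f (pcons (x, t))).
Proof.
move=> mf f0.
apply: (@measurable_fun_fubini_tonelli_G _ _ _ _ _ _ (fun p => f (pcons p))) => //.
by apply: measurableT_comp => //; exact: measurable_pcons.
Qed.

Lemma iintE n (f : n.-tuple R -> \bar R) :
  measurable_fun [set: n.-tuple R] f -> (forall x, 0 <= f x) ->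
  iint f = \int[mun n]_x f x.
Proof.
elim: n f => [|n ih] f mf f0 /=.
  by rewrite integral_dirac// diracT mul1e.
rewrite (integral_munS_iter mf f0) ih//.
- exact: (measurable_integral_munS mf f0).
- by move=> t; exact: integral_ge0.
Qed.

End product_of_lebesgue.

(** * Tuples as a Euclidean space *)

Section tuple_module.
Variables (V : zmodType) (n : nat).
Implicit Types x y z : n.-tuple V.

Definition tadd x y : n.-tuple V := [tuple tnth x i + tnth y i | i < n].
Definition topp x : n.-tuple V := [tuple - tnth x i | i < n].
Definition tzero : n.-tuple V := [tuple 0 | i < n].

Let taddA : associative tadd.
Proof. by move=> x y z; apply: eq_from_tnth => i; rewrite !tnth_mktuple addrA. Qed.
Let taddC : commutative tadd.
Proof. by move=> x y; apply: eq_from_tnth => i; rewrite !tnth_mktuple addrC. Qed.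
Let tadd0 : left_id tzero tadd.
Proof. by move=> x; apply: eq_from_tnth => i; rewrite !tnth_mktuple add0r. Qed.
Let taddN : left_inverse tzero topp tadd.
Proof. by move=> x; apply: eq_from_tnth => i; rewrite !tnth_mktuple addNr. Qed.

HB.instance Definition _ :=
  GRing.isZmodule.Build (n.-tuple V) taddA taddC tadd0 taddN.

Lemma tnthD x y i : tnth (x + y) i = tnth x i + tnth y i.
Proof. by rewrite tnth_mktuple. Qed.
Lemma tnthN x i : tnth (- x) i = - tnth x i.
Proof. by rewrite tnth_mktuple. Qed.
Lemma tnthB x y i : tnth (x - y) i = tnth x i - tnth y i.
Proof. by rewrite tnthD tnthN. Qed.
Lemma tnth0z i : tnth (0 : n.-tuple V) i = 0.
Proof. by rewrite tnth_mktuple. Qed.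
End tuple_module.

Section tuple_lmodule.
Variables (K : nzRingType) (n : nat).
Implicit Types x y z : n.-tuple K.
Definition tscale (c : K) x : n.-tuple K := [tuple c * tnth x i | i < n].
Let tscaleA a b x : tscale a (tscale b x) = tscale (a * b) x.
Proof. by apply: eq_from_tnth => i; rewrite !tnth_mktuple mulrA. Qed.
Let tscale1 : left_id 1 tscale.
Proof. by move=> x; apply: eq_from_tnth => i; rewrite !tnth_mktuple mul1r. Qed.
Let tscaleDr : right_distributive tscale +%R.
Proof. by move=> a x y; apply: eq_from_tnth => i; rewrite !tnth_mktuple mulrDr. Qed.
Let tscaleDl x : {morph tscale^~ x : a b / a + b}.
Proof. by move=> a b; apply: eq_from_tnth => i; rewrite !tnth_mktuple mulrDl. Qed.
HB.instance Definition _ := GRing.Zmodule_isLmodule.Build K (n.-tuple K)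
  tscaleA tscale1 tscaleDr tscaleDl.
Lemma tnthZ c x i : tnth (c *: x) i = c * tnth x i.
Proof. by rewrite tnth_mktuple. Qed.
End tuple_lmodule.

Section euclidean_norm.
Variables (R : realType) (n : nat).
Implicit Types (x y z : n.-tuple R) (c : R).

Definition vdot x y : R := \sum_(i < n) tnth x i * tnth y i.
Definition vnorm x : R := Num.sqrt (vdot x x).

Lemma vdotC x y : vdot x y = vdot y x.
Proof. by apply: eq_bigr => i _; rewrite mulrC. Qed.
Lemma vdotDl x y z : vdot (x + y) z = vdot x z + vdot y z.
Proof. by rewrite -big_split; apply: eq_bigr => i _; rewrite tnthD mulrDl. Qed.
Lemma vdotZl c x y : vdot (c *: x) y = c * vdot x y.
Proof. by rewrite /vdot big_distrr; apply: eq_bigr => i _; rewrite tnthZ -mulrA. Qed.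
Lemma vdotDr x y z : vdot z (x + y) = vdot z x + vdot z y.
Proof. by rewrite !(vdotC z) vdotDl. Qed.
Lemma vdotZr c x y : vdot y (c *: x) = c * vdot y x.
Proof. by rewrite !(vdotC y) vdotZl. Qed.
Lemma vdotNl x y : vdot (- x) y = - vdot x y.
Proof. by rewrite -scaleN1r vdotZl mulN1r. Qed.
Lemma vdotNr x y : vdot y (- x) = - vdot y x.
Proof. by rewrite !(vdotC y) vdotNl. Qed.
Lemma vdot_ge0 x : 0 <= vdot x x.
Proof. by apply: sumr_ge0 => i _; rewrite -expr2 sqr_ge0. Qed.

Lemma vnorm_ge0 x : 0 <= vnorm x.
Proof. exact: sqrtr_ge0. Qed.
Lemma sqr_vnorm x : vnorm x ^+ 2 = vdot x x.
Proof. by rewrite sqr_sqrtr// vdot_ge0. Qed.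
Lemma vnorm_eq0 x : (vnorm x == 0) = (x == 0).
Proof.
rewrite sqrtr_eq0; apply/idP/eqP => [x0|->]; last first.
  by rewrite /vdot big1// => i _; rewrite tnth0z mul0r.
have /eqP/psumr_eq0P H : vdot x x == 0 by rewrite eq_le x0 vdot_ge0.
apply: eq_from_tnth => i; rewrite tnth0z; apply/eqP.
by rewrite -sqrf_eq0 expr2 H// => j _; rewrite -expr2 sqr_ge0.
Qed.
Lemma vnorm_gt0 x : (0 < vnorm x) = (x != 0).
Proof. by rewrite lt_def vnorm_ge0 vnorm_eq0 andbT. Qed.
Lemma vnorm0 : vnorm 0 = 0.
Proof. by apply/eqP; rewrite vnorm_eq0. Qed.
Lemma vnormN x : vnorm (- x) = vnorm x.
Proof. by rewrite /vnorm vdotNl vdotNr opprK. Qed.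
Lemma vnormB x y : vnorm (x - y) = vnorm (y - x).
Proof. by rewrite -vnormN opprB. Qed.
Lemma vnormZ c x : vnorm (c *: x) = `|c| * vnorm x.
Proof.
by rewrite /vnorm vdotZl vdotZr mulrA -expr2 sqrtrM ?sqr_ge0// sqrtr_sqr.
Qed.
Lemma tdistE x y : tdist x y = vnorm (x - y).
Proof.
by congr Num.sqrt; apply: eq_bigr => i _; rewrite !tnthB expr2.
Qed.

Lemma vdot_le x y : vdot x y <= vnorm x * vnorm y.
Proof.
have [->|y0] := eqVneq y 0.
  by rewrite vnorm0 mulr0 /vdot big1// => i _; rewrite tnth0z mulr0.
rewrite (le_trans (ler_norm _))// -ler_sqr ?nnegrE ?mulr_ge0 ?vnorm_ge0//.
rewrite exprMn !sqr_vnorm real_normK ?num_real//.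
have yy : 0 < vdot y y by rewrite -sqr_vnorm exprn_gt0// vnorm_gt0.
rewrite -(ler_pM2l yy) -subr_ge0.
(* This squared norm expands to $|y|^2 (|x|^2 |y|^2 - \langle x, y\rangle^2)$. *)
have := vdot_ge0 (vdot y y *: x - vdot x y *: y).
rewrite vdotDl !vdotDr !vdotNl !vdotNr !vdotZl !vdotZr (vdotC y x).
by congr (_ <= _); ring.
Qed.

Lemma vnormD x y : vnorm (x + y) <= vnorm x + vnorm y.
Proof.
rewrite -ler_sqr ?nnegrE ?addr_ge0 ?vnorm_ge0// sqr_vnorm sqrrD !sqr_vnorm.
by rewrite vdotDl !vdotDr (vdotC y x); have := vdot_le x y; lra.
Qed.

Lemma vnorm_tri x y z : vnorm (x - z) <= vnorm (x - y) + vnorm (y - z).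
Proof. by rewrite (le_trans _ (vnormD _ _))// addrA subrK. Qed.

Lemma vnorm_ler_sub x y : vnorm x - vnorm y <= vnorm (x - y).
Proof. by rewrite lerBlDr (le_trans _ (vnormD _ _))// subrK. Qed.

Lemma tnth_le_vnorm x i : `|tnth x i| <= vnorm x.
Proof.
rewrite -ler_sqr ?nnegrE ?vnorm_ge0// real_normK ?num_real// sqr_vnorm /vdot (bigD1 i)//=.
by rewrite -expr2 lerDl sumr_ge0// => j _; rewrite -expr2 sqr_ge0.
Qed.

(** Inversion in the sphere of radius $\sqrt{c}$ about the origin. Since division by zero gives
    zero, the origin is sent to itself. *)
Definition vinv c x : n.-tuple R := (c / vnorm x ^+ 2) *: x.

Lemma vnorm_vinv c x : 0 < c -> vnorm (vinv c x) = c / vnorm x.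
Proof.
move=> c0; rewrite /vinv vnormZ ger0_norm ?divr_ge0 ?exprn_ge0 ?vnorm_ge0 ?ltW//.
have [->|x0] := eqVneq x 0; first by rewrite vnorm0 invr0 !mulr0.
by have := vnorm_gt0 x; rewrite x0 => /lt0r_neq0 ?; field.
Qed.

Lemma vnorm_vinvB c x y : 0 < c -> x != 0 -> y != 0 ->
  vnorm (vinv c x - vinv c y) = c * vnorm (x - y) / (vnorm x * vnorm y).
Proof.
move=> c0 x0 y0.
have nx : 0 < vnorm x by rewrite vnorm_gt0.
have ny : 0 < vnorm y by rewrite vnorm_gt0.
apply/eqP; rewrite -(@eqrXn2 _ 2) ?divr_ge0 ?mulr_ge0 ?vnorm_ge0 ?(ltW c0)//.
rewrite sqr_vnorm /vinv expr_div_n !exprMn !sqr_vnorm.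
rewrite !(vdotDl, vdotDr, vdotNl, vdotNr, vdotZl, vdotZr) (vdotC y x).
rewrite -!sqr_vnorm; apply/eqP; field.
by rewrite !gt_eqF.
Qed.
End euclidean_norm.

(** Indicators are written on booleans, so that the inequality inside stays visible to the tactic
    [meas]. *)
Definition chi (R : realType) (b : bool) : R := b%:R.

Lemma chi_ge0 (R : realType) b : 0 <= chi R b.
Proof. exact: ler0n. Qed.

(** * Measurability of real, boolean and tuple-valued functions, and a tactic for it *)

Section measurability.
Context d (T : measurableType d) (R : realType) (n : nat).
Implicit Types (f g : T -> R) (x y : T -> n.-tuple R) (a b : T -> bool).

Lemma rm_cst (c : R) : measurable_fun [set: T] (fun _ => c).
Proof. exact: measurable_cst. Qed.
Lemma rmD f g : measurable_fun [set: T] f -> measurable_fun [set: T] g ->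
  measurable_fun [set: T] (fun t => f t + g t).
Proof. exact: measurable_funD. Qed.
Lemma rmN f : measurable_fun [set: T] f ->
  measurable_fun [set: T] (fun t => - f t).
Proof. exact: measurable_funN. Qed.
Lemma rmM f g : measurable_fun [set: T] f -> measurable_fun [set: T] g ->
  measurable_fun [set: T] (fun t => f t * g t).
Proof. exact: measurable_funM. Qed.
Lemma rmX f k : measurable_fun [set: T] f ->
  measurable_fun [set: T] (fun t => f t ^+ k).
Proof. exact: measurable_funX. Qed.
Lemma rm_powR f (p : R) : measurable_fun [set: T] f ->
  measurable_fun [set: T] (fun t => f t `^ p).
Proof. by move=> mf; exact: (measurableT_comp (measurable_powR p)). Qed.
Lemma rm_normr f : measurable_fun [set: T] f ->
  measurable_fun [set: T] (fun t => `|f t|).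
Proof. by move=> mf; exact: measurableT_comp. Qed.
(** $x^{-1} = x |x|^{-2}$ reduces the claim to powers; at 0 both sides are 0 by convention. *)
Lemma rmV f : measurable_fun [set: T] f ->
  measurable_fun [set: T] (fun t => (f t)^-1).
Proof.
move=> mf; rewrite (_ : (fun _ => _) = fun t => f t * `|f t| `^ (- 2)).
  by apply: rmM => //; apply: rm_powR; exact: rm_normr.
apply/funext => t; have [->|ft] := eqVneq (f t) 0; first by rewrite invr0 mul0r.
rewrite powRN powR_mulrn// real_normK ?num_real// expr2 invfM mulrA.
by rewrite divff// mul1r.
Qed.
Lemma rm_min f g : measurable_fun [set: T] f -> measurable_fun [set: T] g ->
  measurable_fun [set: T] (fun t => Num.min (f t) (g t)).
Proof. exact: measurable_minr. Qed.
Lemma rm_max f g : measurable_fun [set: T] f -> measurable_fun [set: T] g ->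
  measurable_fun [set: T] (fun t => Num.max (f t) (g t)).
Proof. exact: measurable_maxr. Qed.
Lemma rm_expR f : measurable_fun [set: T] f ->
  measurable_fun [set: T] (fun t => expR (f t)).
Proof. by move=> mf; exact: measurableT_comp. Qed.
Lemma rm_bool a : measurable_fun [set: T] a ->
  measurable_fun [set: T] (fun t => chi R (a t)).
Proof.
move=> ma; rewrite (_ : (fun _ => _) = fun t => if a t then 1 else 0).
  exact: measurable_fun_ifT.
by apply/funext => t; rewrite /chi; case: (a t).
Qed.
Lemma bm_le f g : measurable_fun [set: T] f -> measurable_fun [set: T] g ->
  measurable_fun [set: T] (fun t => f t <= g t).
Proof. exact: measurable_fun_ler. Qed.
Lemma bm_lt f g : measurable_fun [set: T] f -> measurable_fun [set: T] g ->
  measurable_fun [set: T] (fun t => f t < g t).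
Proof. exact: measurable_fun_ltr. Qed.
Lemma bm_and a b : measurable_fun [set: T] a -> measurable_fun [set: T] b ->
  measurable_fun [set: T] (fun t => a t && b t).
Proof. exact: measurable_and. Qed.
Lemma bm_neg a : measurable_fun [set: T] a ->
  measurable_fun [set: T] (fun t => ~~ a t).
Proof. exact: measurable_neg. Qed.
Lemma rm_if a f g : measurable_fun [set: T] a ->
  measurable_fun [set: T] f -> measurable_fun [set: T] g ->
  measurable_fun [set: T] (fun t => if a t then f t else g t).
Proof. exact: measurable_fun_ifT. Qed.

Lemma rm_tnth x i : measurable_fun [set: T] x ->
  measurable_fun [set: T] (fun t => tnth (x t) i).
Proof. by move=> /measurable_fun_tnthP; exact. Qed.
Lemma vmD x y : measurable_fun [set: T] x -> measurable_fun [set: T] y ->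
  measurable_fun [set: T] (fun t => x t + y t).
Proof.
move=> mx my; apply/measurable_fun_tnthP => i.
rewrite (_ : _ \o _ = fun t => tnth (x t) i + tnth (y t) i).
  by apply: rmD; exact: rm_tnth.
by apply/funext => t /=; rewrite tnthD.
Qed.
Lemma vmN x : measurable_fun [set: T] x ->
  measurable_fun [set: T] (fun t => - x t).
Proof.
move=> mx; apply/measurable_fun_tnthP => i.
rewrite (_ : _ \o _ = fun t => - tnth (x t) i).
  by apply: rmN; exact: rm_tnth.
by apply/funext => t /=; rewrite tnthN.
Qed.
Lemma vmZ f x : measurable_fun [set: T] f -> measurable_fun [set: T] x ->
  measurable_fun [set: T] (fun t => f t *: x t).
Proof.
move=> mf mx; apply/measurable_fun_tnthP => i.
rewrite (_ : _ \o _ = fun t => f t * tnth (x t) i).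
  by apply: rmM => //; exact: rm_tnth.
by apply/funext => t /=; rewrite tnthZ.
Qed.
Lemma rm_vdot x y : measurable_fun [set: T] x -> measurable_fun [set: T] y ->
  measurable_fun [set: T] (fun t => vdot (x t) (y t)).
Proof.
by move=> mx my; apply: measurable_sum => i; apply: rmM; exact: rm_tnth.
Qed.
Lemma rm_vnorm x : measurable_fun [set: T] x ->
  measurable_fun [set: T] (fun t => vnorm (x t)).
Proof.
move=> mx; rewrite (_ : (fun _ => _) = fun t => vdot (x t) (x t) `^ 2^-1).
  by apply: rm_powR; exact: rm_vdot.
by apply/funext => t; rewrite powR12_sqrt// vdot_ge0.
Qed.
Lemma vm_vinv (c : R) x : measurable_fun [set: T] x ->
  measurable_fun [set: T] (fun t => vinv c (x t)).
Proof.
move=> mx; apply: vmZ => //; apply: rmM; first exact: rm_cst.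
by apply: rmV; apply: rmX; exact: rm_vnorm.
Qed.
Lemma em_EFin f : measurable_fun [set: T] f ->
  measurable_fun [set: T] (fun t => (f t)%:E).
Proof. by move=> mf; apply/measurable_EFinP. Qed.
End measurability.

Lemma mcomp d1 d2 d3 (T1 : measurableType d1) (T2 : measurableType d2)
  (T3 : measurableType d3) (u : T2 -> T3) (f : T1 -> T2) :
  measurable_fun [set: T2] u -> measurable_fun [set: T1] f ->
  measurable_fun [set: T1] (fun t => u (f t)).
Proof. by move=> mu mf; exact: (measurableT_comp mu mf). Qed.

Lemma mfst d1 d2 d3 (T1 : measurableType d1) (T2 : measurableType d2)
  (T3 : measurableType d3) (f : T1 -> T2 * T3) :
  measurable_fun [set: T1] f -> measurable_fun [set: T1] (fun t => (f t).1).
Proof. by move=> mf; exact: (measurableT_comp measurable_fst mf). Qed.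
Lemma msnd d1 d2 d3 (T1 : measurableType d1) (T2 : measurableType d2)
  (T3 : measurableType d3) (f : T1 -> T2 * T3) :
  measurable_fun [set: T1] f -> measurable_fun [set: T1] (fun t => (f t).2).
Proof. by move=> mf; exact: (measurableT_comp measurable_snd mf). Qed.

(* Selecting the instance by the codomain keeps unification from trying to
   identify the additions of [R] and of tuples. *)
Ltac meas_alt r v := lazymatch goal with
  | |- @measurable_fun _ _ _
        (Real_sort__canonical__measurable_structure_SigmaRing _) _ _ => r
  | |- @measurable_fun _ _ _
        (tuple_tuple_of__canonical__measurable_structure_SigmaRing _ _) _ _ => v
  | |- _ => first [r | v]
  end.

Ltac meas := cbv beta; first [
  match goal with H : ?P |- ?P' => constr_eq P P'; exact H end |
  lazymatch goal with
  | |- measurable_fun _ (fun t => _) => idtac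
  | |- measurable_fun ?D ?f => change (measurable_fun D (fun t => f t))
  end; lazymatch goal with
  | |- measurable_fun _ (fun t => t) => exact: measurable_id
  | |- measurable_fun _ (fun t => EFin _) => apply: em_EFin; meas
  | |- measurable_fun _ (fun t => (@?f t, @?g t)) =>
      apply: measurable_fun_pair; meas
  | |- measurable_fun _ (fun t => GRing.mul _ _) => apply: rmM; meas
  | |- measurable_fun _ (fun t => GRing.scale _ _) => apply: vmZ; meas
  | |- measurable_fun _ (fun t => GRing.exp _ _) => apply: rmX; meas
  | |- measurable_fun _ (fun t => GRing.inv _) => apply: rmV; meas
  | |- measurable_fun _ (fun t => powR _ _) => apply: rm_powR; meas
  | |- measurable_fun _ (fun t => expR _) => apply: rm_expR; meas
  | |- measurable_fun _ (fun t => Num.norm _) => apply: rm_normr; meas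
  | |- measurable_fun _ (fun t => Order.min _ _) => apply: rm_min; meas
  | |- measurable_fun _ (fun t => Order.max _ _) => apply: rm_max; meas
  | |- measurable_fun _ (fun t => vnorm _) => apply: rm_vnorm; meas
  | |- measurable_fun _ (fun t => vdot _ _) => apply: rm_vdot; meas
  | |- measurable_fun _ (fun t => vinv _ _) => apply: vm_vinv; meas
  | |- measurable_fun _ (fun t => tnth _ _) => apply: rm_tnth; meas
  | |- measurable_fun _ (fun t => andb _ _) => apply: bm_and; meas
  | |- measurable_fun _ (fun t => negb _) => apply: bm_neg; meas
  | |- measurable_fun _ (fun t => Order.le _ _) => apply: bm_le; meas
  | |- measurable_fun _ (fun t => Order.lt _ _) => apply: bm_lt; meas
  | |- measurable_fun _ (fun t => if _ then _ else _) => apply: rm_if; meas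
  | |- measurable_fun _ (fun t => fst _) => apply: mfst; meas
  | |- measurable_fun _ (fun t => snd _) => apply: msnd; meas
  | |- measurable_fun _ (fun t => chi _ _) => apply: rm_bool; meas
  | |- measurable_fun _ (fun t => GRing.opp _) =>
      meas_alt ltac:(apply: rmN; meas) ltac:(apply: vmN; meas)
  | |- measurable_fun _ (fun t => Algebra.opp _) =>
      meas_alt ltac:(apply: rmN; meas) ltac:(apply: vmN; meas)
  | |- measurable_fun _ (fun t => Algebra.add _ _) =>
      meas_alt ltac:(apply: rmD; meas) ltac:(apply: vmD; meas)
  | |- measurable_fun _ (fun t => ?v (@?f t)) =>
      match goal with
      | H : measurable_fun _ ?u |- _ =>
          constr_eq u v; refine (@mcomp _ _ _ _ _ _ u f H _); meas
      | |- _ => exact: measurable_cst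
      end
  | |- _ => exact: measurable_cst
  end ].

(** * Change of variables *)

Section change_of_variables.
Variable R : realType.
Local Open Scope ereal_scope.

(** The pushforward of Lebesgue measure under $x \mapsto cx + d$, multiplied by c, agrees with
    Lebesgue measure on half-open intervals, hence everywhere by uniqueness. *)
Lemma leb_affine (c d : R) (f : R -> \bar R) : (0 < c)%R ->
  measurable_fun [set: R] f -> (forall x, 0 <= f x) ->
  \int[leb R]_x f (c * x + d)%R = c^-1%:E * \int[@leb R]_x f x.
Proof.
move=> c0 mf f0.
pose phi : measurableTypeR R -> measurableTypeR R := fun x => (c * x + d)%R.
have mphi : measurable_fun [set: measurableTypeR R] phi.
  by apply: measurable_funD => //; apply: measurable_funM.
pose P : {measure set (measurableTypeR R) -> \bar R} :=
  measure_function_pushforward__canonical__measure_function_Measure (leb R) mphi.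
pose c' := NngNum (ltW c0).
pose m : {measure set (measurableTypeR R) -> \bar R} := mscale c' P.
have E : forall A, measurable A -> lebesgue_measure A = m A.
  apply: lebesgue_measure_unique => X [[a b] /= _ <-].
  rewrite lebesgue_measure_itv/= /m /mscale /= /P /pushforward /=.
  rewrite (_ : phi @^-1` _ = `](a - d) / c, (b - d) / c]%classic)%R; last first.
    apply/seteqP; split=> x /=; rewrite /phi !in_itv /=.
      by rewrite ltr_pdivrMr// ler_pdivlMr// ltrBlDr lerBrDr mulrC.
    by rewrite ltr_pdivrMr// ler_pdivlMr// ltrBlDr lerBrDr mulrC.
  rewrite /leb lebesgue_measure_itv/= !lte_fin ltr_pM2r ?invr_gt0// ltrD2r.
  case: ifPn => _; last by rewrite mule0.
  rewrite -EFinB -EFinM; congr EFin => /=.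
  by rewrite -mulrBl opprB addrA subrK mulrCA divff ?mulr1// gt_eqF.
rewrite [X in _ = _ * X](@eq_measure_integral _ _ _ setT m); last first.
  by move=> A mA _; exact: E.
rewrite ge0_integral_mscale//= ge0_integral_pushforward//.
by rewrite muleA -EFinM mulVf ?gt_eqF// mul1e.
Qed.

Lemma leb_shift (d : R) (f : R -> \bar R) :
  measurable_fun [set: R] f -> (forall x, 0 <= f x) ->
  \int[leb R]_x f (x + d)%R = \int[@leb R]_x f x.
Proof.
move=> mf f0; have := @leb_affine 1 d f ltr01 mf f0; rewrite invr1 mul1e => <-.
by apply: eq_integral => x _; rewrite mul1r.
Qed.

Lemma leb_opp (f : R -> \bar R) :
  measurable_fun [set: R] f -> (forall x, 0 <= f x) ->
  \int[leb R]_x f (- x)%R = \int[@leb R]_x f x.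
Proof.
move=> mf f0.
rewrite [RHS](@eq_measure_integral _ _ _ setT
  (measure_function_pushforward__canonical__measure_function_Measure (leb R)
    (@oppr_measurable R setT : measurable_fun [set: measurableTypeR R]
       (-%R : measurableTypeR R -> measurableTypeR R)))); last first.
  by move=> A mA _ /=; rewrite lebesgue_measureN.
by rewrite /= ge0_integral_pushforward.
Qed.

Lemma pconsD n (x a : R) (t b : n.-tuple R) :
  (pcons (x, t) + pcons (a, b))%R = pcons ((x + a)%R, (t + b)%R).
Proof.
apply: eq_from_tnth => i; rewrite tnthD; have [->//|i0] := eqVneq i ord0.
have [j ->] : exists j, i = lift ord0 j.
  by case: (unliftP ord0 i) i0 => [j ->|->]; [exists j|rewrite eqxx].
by rewrite !tnthS tnthD.
Qed.

Lemma pconsZ n (x c : R) (t : n.-tuple R) :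
  (c *: pcons (x, t) = pcons (c * x, c *: t))%R.
Proof.
apply: eq_from_tnth => i; rewrite tnthZ; have [->//|i0] := eqVneq i ord0.
have [j ->] : exists j, i = lift ord0 j.
  by case: (unliftP ord0 i) i0 => [j ->|->]; [exists j|rewrite eqxx].
by rewrite !tnthS tnthZ.
Qed.

Lemma tuple0_eq (x y : 0.-tuple R) : x = y.
Proof. by rewrite (tuple0 x) (tuple0 y). Qed.

Lemma measurable_pcons1 n (f : n.+1.-tuple R -> \bar R) (t : n.-tuple R) :
  measurable_fun [set: n.+1.-tuple R] f ->
  measurable_fun [set: R] (fun x => f (pcons (x, t))).
Proof.
move=> mf; apply: (mcomp mf); apply: (mcomp (@measurable_pcons R n)).
exact: measurable_fun_pair.
Qed.

Lemma mun_shift n (a : n.-tuple R) (f : n.-tuple R -> \bar R) :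
  measurable_fun [set: n.-tuple R] f -> (forall x, 0 <= f x) ->
  \int[mun R n]_x f (x + a)%R = \int[mun R n]_x f x.
Proof.
elim: n a f => [|n ih] a f mf f0.
  by apply: eq_integral => x _; congr f; exact: tuple0_eq.
have mfa : measurable_fun [set: n.+1.-tuple R] (fun x => f (x + a)%R).
  by apply: (mcomp mf); meas.
rewrite (integral_munS_iter mfa (fun x => f0 _)) (integral_munS_iter mf f0).
rewrite -(punconsK a) /puncons.
set a1 := thead a; set a2 := [tuple of behead a].
rewrite -(ih a2 (fun t => \int[leb R]_x f (pcons (x, t)))); last 2 first.
- exact: measurable_integral_munS.
- by move=> t; exact: integral_ge0.
apply: eq_integral => t _.
rewrite -(@leb_shift a1 (fun x => f (pcons (x, (t + a2)%R))))//; last first.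
  exact: measurable_pcons1.
by apply: eq_integral => x _; rewrite pconsD.
Qed.

Lemma mun_opp n (f : n.-tuple R -> \bar R) :
  measurable_fun [set: n.-tuple R] f -> (forall x, 0 <= f x) ->
  \int[mun R n]_x f (- x)%R = \int[mun R n]_x f x.
Proof.
elim: n f => [|n ih] f mf f0.
  by apply: eq_integral => x _; congr f; exact: tuple0_eq.
have mfa : measurable_fun [set: n.+1.-tuple R] (fun x => f (- x)%R).
  by apply: (mcomp mf (f := fun x : n.+1.-tuple R => (- x)%R)); meas.
rewrite (integral_munS_iter mfa (fun x => f0 _)) (integral_munS_iter mf f0).
rewrite -(ih (fun t => \int[leb R]_x f (pcons (x, t)))); last 2 first.
- exact: measurable_integral_munS.
- by move=> t; exact: integral_ge0.
apply: eq_integral => t _.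
rewrite -(@leb_opp (fun x => f (pcons (x, (- t)%R))))//; last first.
  exact: measurable_pcons1.
by apply: eq_integral => x _; rewrite -scaleN1r pconsZ mulN1r scaleN1r.
Qed.

Lemma mun_scale n (c : R) (f : n.-tuple R -> \bar R) : (0 < c)%R ->
  measurable_fun [set: n.-tuple R] f -> (forall x, 0 <= f x) ->
  \int[mun R n]_x f (c *: x)%R = (c ^- n)%:E * \int[mun R n]_x f x.
Proof.
move=> c0; elim: n f => [|n ih] f mf f0.
  rewrite expr0 invr1 mul1e.
  by apply: eq_integral => x _; congr f; exact: tuple0_eq.
have mfa : measurable_fun [set: n.+1.-tuple R] (fun x => f (c *: x)%R).
  by apply: (mcomp mf (f := fun x : n.+1.-tuple R => (c *: x)%R)); meas.
rewrite (integral_munS_iter mfa)// [X in _ = _ * X](integral_munS_iter mf)//.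
have mF := measurable_integral_munS mf f0.
have F0 t : 0 <= \int[leb R]_x f (pcons (x, t)) by exact: integral_ge0.
have mFc : measurable_fun [set: n.-tuple R]
    (fun t => \int[leb R]_x f (pcons (x, c *: t)%R)).
  by apply: (mcomp mF (f := fun x : n.-tuple R => (c *: x)%R)); meas.
rewrite exprS invfM EFinM -muleA.
rewrite -(ih (fun t => \int[leb R]_x f (pcons (x, t)))) //.
rewrite -ge0_integralZl//; last by rewrite lee_fin invr_ge0 ltW.
apply: eq_integral => t _.
rewrite -(@leb_affine c 0 (fun x => f (pcons (x, (c *: t)%R))))//; last first.
  exact: measurable_pcons1.
by apply: eq_integral => x _; rewrite pconsZ addr0.
Qed.

End change_of_variables.

(** * Integrals of nonnegative real functions *)

Section real_integrals.
Context d (T : measurableType d) (R : realType).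
Variable m : {measure set T -> \bar R}.
Local Open Scope ereal_scope.

Lemma igZ (c : R) (f : T -> R) : (0 <= c)%R -> measurable_fun [set: T] f ->
  (forall x, 0 <= f x)%R ->
  \int[m]_x (c * f x)%:E = c%:E * \int[m]_x (f x)%:E.
Proof.
move=> c0 mf f0; rewrite -ge0_integralZl_EFin//; last exact: em_EFin.
by move=> x _; rewrite lee_fin.
Qed.

Lemma igD (f g : T -> R) : measurable_fun [set: T] f ->
  measurable_fun [set: T] g ->
  (forall x, 0 <= f x)%R -> (forall x, 0 <= g x)%R ->
  \int[m]_x (f x + g x)%:E = \int[m]_x (f x)%:E + \int[m]_x (g x)%:E.
Proof.
move=> mf mg f0 g0; rewrite -ge0_integralD//.
- by move=> x _; rewrite lee_fin.
- exact: em_EFin.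
- by move=> x _; rewrite lee_fin.
- exact: em_EFin.
Qed.

Lemma ig_le (f g : T -> R) : measurable_fun [set: T] f ->
  measurable_fun [set: T] g -> (forall x, 0 <= f x <= g x)%R ->
  \int[m]_x (f x)%:E <= \int[m]_x (g x)%:E.
Proof.
move=> mf mg fg; apply: ge0_le_integral => //.
- by move=> x _; rewrite lee_fin; case/andP: (fg x).
- exact: em_EFin.
- exact: em_EFin.
- by move=> x _; rewrite lee_fin; case/andP: (fg x).
Qed.

Lemma ig_ge0 (f : T -> R) : (forall x, 0 <= f x)%R ->
  0 <= \int[m]_x (f x)%:E.
Proof. by move=> f0; apply: integral_ge0 => x _; rewrite lee_fin. Qed.

Lemma eg_le (f g : T -> \bar R) : measurable_fun [set: T] f ->
  measurable_fun [set: T] g -> (forall x, 0 <= f x) ->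
  (forall x, f x <= g x) ->
  \int[m]_x f x <= \int[m]_x g x.
Proof. by move=> mf mg f0 fg; apply: ge0_le_integral. Qed.
End real_integrals.

Section tonelli.
Context d1 d2 (T1 : measurableType d1) (T2 : measurableType d2) (R : realType).
Variable m1 : {sigma_finite_measure set T1 -> \bar R}.
Variable m2 : {sigma_finite_measure set T2 -> \bar R}.
Local Open Scope ereal_scope.

Lemma tonelli (F : T1 -> T2 -> R) :
  measurable_fun [set: T1 * T2] (fun p => F p.1 p.2) ->
  (forall x y, 0 <= F x y)%R ->
  \int[m1]_x \int[m2]_y (F x y)%:E = \int[m2]_y \int[m1]_x (F x y)%:E.
Proof.
move=> mF F0; rewrite (fubini_tonelli (fun p => (F p.1 p.2)%:E))//.
- exact: em_EFin.
- by move=> p; rewrite lee_fin.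
Qed.

Lemma measurable_inner (F : T1 -> T2 -> R) :
  measurable_fun [set: T1 * T2] (fun p => F p.1 p.2) ->
  (forall x y, 0 <= F x y)%R ->
  measurable_fun [set: T1] (fun x => \int[m2]_y (F x y)%:E).
Proof.
move=> mF F0.
apply: (measurable_fun_fubini_tonelli_F (fun p => (F p.1 p.2)%:E)).
- exact: em_EFin.
- by move=> p; rewrite lee_fin.
Qed.

End tonelli.

Section real_change_of_variables.
Variables (R : realType) (n : nat) (f : n.-tuple R -> R).
Hypothesis mf : measurable_fun [set: n.-tuple R] f.
Hypothesis f0 : forall x, 0 <= f x.

Lemma mfun_scale (c : R) : measurable_fun [set: n.-tuple R] (fun x => f (c *: x)).
Proof. by meas. Qed.

Lemma mfun_shift a : measurable_fun [set: n.-tuple R] (fun x => f (x + a)).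
Proof. by meas. Qed.

Let mE : measurable_fun [set: n.-tuple R] (fun x => (f x)%:E).
Proof. exact: em_EFin. Qed.

Let E0 x : (0 <= (f x)%:E)%E.
Proof. by rewrite lee_fin. Qed.

Lemma mun_scaleR (c : R) : 0 < c ->
  (\int[mun R n]_x (f (c *: x))%:E = (c ^- n)%:E * \int[mun R n]_x (f x)%:E)%E.
Proof. by move=> c0; exact: (mun_scale c0 mE E0). Qed.

Lemma mun_shiftR a :
  (\int[mun R n]_x (f (x + a))%:E = \int[mun R n]_x (f x)%:E)%E.
Proof. exact: (mun_shift a mE E0). Qed.

Lemma mun_oppR :
  (\int[mun R n]_x (f (- x))%:E = \int[mun R n]_x (f x)%:E)%E.
Proof. exact: (mun_opp mE E0). Qed.
End real_change_of_variables.

(** * Polar decomposition by dilations *)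

Section radial.
Variables (R : realType) (n : nat).
Hypothesis n0 : (0 < n)%N.
Local Notation E := (n.-tuple R).
Local Notation mu := (mun R n).

Definition shell (y : E) : R := chi R ((1 <= vnorm y) && (vnorm y < expR 1)).

(** In the variable s the window is an interval of length $\ln e - \ln 1 = 1$, whatever x is. *)
Lemma leb_window (x : E) : x != 0 ->
  (\int[leb R]_s (shell (expR s *: x))%:E = 1)%E.
Proof.
move=> x0; have nx : 0 < vnorm x by rewrite vnorm_gt0.
rewrite (eq_integral (fun s : measurableTypeR R => (\1_(`[- ln (vnorm x), 1 - ln (vnorm x)[%classic) s)%:E)).
  rewrite integral_indic//= setIT lebesgue_measure_itv/=.
  rewrite ifT; last by rewrite lte_fin; lra.
  by rewrite -EFinB; congr EFin; ring.
move=> s _; congr EFin; rewrite /shell indicE mem_setE in_itv/= /chi; congr (_%:R).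
rewrite vnormZ ger0_norm ?expR_ge0// -{1 2}(lnK nx) -expRD -expR0 ler_expR ltr_expR.
by congr (nat_of_bool (_ && _)); apply/idP/idP; lra.
Qed.

Lemma measurable_shell : measurable_fun [set: E] shell.
Proof. by rewrite /shell; meas. Qed.

Lemma shell_ge0 y : 0 <= shell y.
Proof. exact: chi_ge0. Qed.

Variable f : E -> R.
Hypothesis mf : measurable_fun [set: E] f.
Hypothesis f0 : forall x, 0 <= f x.

(* Insert 1 = int 1_{[1,e)}(e^s |x|) ds and dilate by e^s: this polar decomposition
   needs no surface measure, and it turns inversion into the reflection s |-> -s. *)
Lemma radial_slices :
  (\int[mu]_x (f x / vnorm x ^+ n)%:E =
   \int[mu]_y \int[leb R]_s (shell y / vnorm y ^+ n * f (expR (- s) *: y))%:E)%E.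
Proof.
have msh := measurable_shell.
transitivity (\int[mu]_x \int[leb R]_s
    (f x / vnorm x ^+ n * shell (expR s *: x))%:E)%E.
  apply: eq_integral => x _.
  rewrite igZ; last 3 first.
  - by rewrite divr_ge0 ?exprn_ge0 ?vnorm_ge0.
  - by meas.
  - by move=> s; exact: shell_ge0.
  have [->|x0] := eqVneq x 0.
    by rewrite vnorm0 expr0n gtn_eqF// invr0 mulr0 mul0e.
  by rewrite leb_window// mule1.
rewrite tonelli; last 2 first.
- by meas.
- by move=> x s; rewrite mulr_ge0 ?shell_ge0// divr_ge0 ?exprn_ge0 ?vnorm_ge0.
rewrite [RHS]tonelli; last 2 first.
- by meas.
- move=> x s; apply: mulr_ge0; last exact: f0.
  by rewrite divr_ge0 ?shell_ge0 ?exprn_ge0 ?vnorm_ge0.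
apply: eq_integral => s _.
pose G (y : E) := f (expR (- s) *: y) / vnorm (expR (- s) *: y) ^+ n * shell y.
have mG : measurable_fun [set: E] G by rewrite /G; meas.
have G0 y : 0 <= G y.
  by rewrite mulr_ge0 ?shell_ge0// divr_ge0 ?exprn_ge0 ?vnorm_ge0.
transitivity (\int[mu]_x (G (expR s *: x))%:E)%E.
  apply: eq_integral => x _; rewrite /G scalerA -expRD addNr expR0 scale1r.
  by [].
(* For fixed s the dilation has Jacobian $e^{-sn}$, which cancels the change of $|x|^{-n}$: the
   measure $dx/|x|^n$ is invariant under dilations. *)
rewrite (mun_scale (f := EFin \o G) (expR_gt0 s)); last 2 first.
- exact: em_EFin.
- by move=> x; rewrite lee_fin.
rewrite -igZ ?invr_ge0 ?exprn_ge0 ?expR_ge0//.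
apply: eq_integral => y _; congr EFin; rewrite /G.
rewrite vnormZ ger0_norm ?expR_ge0// expRN exprMn invfM exprVn invrK.
have := lt0r_neq0 (expR_gt0 s) => e0.
have [->|y0] := eqVneq (vnorm y) 0.
  by rewrite expr0n gtn_eqF// invr0 !(mulr0, mul0r).
by field; rewrite ?y0 ?expf_neq0 ?e0.
Qed.

End radial.

(** * Inversion in a sphere *)

Section inversion.
Variables (R : realType) (n : nat).
Hypothesis n0 : (0 < n)%N.
Local Notation E := (n.-tuple R).
Local Notation mu := (mun R n).

(** The surface area of the unit sphere: the shell has logarithmic thickness one. *)
Definition omega' : \bar R := \int[mu]_y (shell y / vnorm y ^+ n)%:E.

Lemma mu_leb_ge0 (y : E) : 0 <= shell y / vnorm y ^+ n.
Proof. by rewrite divr_ge0 ?shell_ge0 ?exprn_ge0 ?vnorm_ge0. Qed.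

(** On the ray through y the inversion sends $e^{-s} y$ to $e^{s + \ln c - 2 \ln |y|} y$, which is a
    reflection and a translation of s. *)
Lemma radial_inv c (f : E -> R) : 0 < c -> measurable_fun [set: E] f ->
  (forall x, 0 <= f x) ->
  (\int[mu]_x (f (vinv c x) / vnorm x ^+ n)%:E =
   \int[mu]_x (f x / vnorm x ^+ n)%:E)%E.
Proof.
move=> c0 mf f0.
rewrite (radial_slices n0 (f := fun x => f (vinv c x)))//; last by meas.
rewrite (radial_slices n0 mf f0); apply: eq_integral => y _.
rewrite igZ; [|exact: mu_leb_ge0|by meas|by []].
rewrite igZ; [|exact: mu_leb_ge0|by meas|by []].
have [->|y0] := eqVneq y 0.
  by rewrite vnorm0 expr0n gtn_eqF// invr0 mulr0 !mul0e.
congr (_ * _)%E.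
have ny : 0 < vnorm y by rewrite vnorm_gt0.
pose g (s : R) := (f (expR (- s) *: y))%:E.
have mg : measurable_fun [set: R] g by rewrite /g; meas.
have g0 s : (0 <= g s)%E by rewrite lee_fin.
rewrite -[RHS](leb_opp mg)// -[RHS](@leb_shift _ (ln c - 2 * ln (vnorm y))
  (fun s => g (- s)))//; last by apply: (mcomp mg); meas.
apply: eq_integral => s _; congr EFin; congr f.
rewrite /vinv vnormZ ger0_norm ?expR_ge0// scalerA !opprK; congr (_ *: _).
rewrite !expRD !expRN expRM_natl !lnK//; field.
by rewrite !lt0r_neq0 ?expR_gt0.
Qed.

Lemma radial_int (F : R -> R) : measurable_fun [set: R] F ->
  (forall x, 0 <= F x) ->
  (\int[mu]_x (F (vnorm x) / vnorm x ^+ n)%:E =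
   omega' * \int[leb R]_s (F (expR s))%:E)%E.
Proof.
move=> mF F0.
rewrite (radial_slices n0 (f := fun x => F (vnorm x)))//; last by meas.
have msh := @measurable_shell R n.
rewrite muleC -ge0_integralZl//; last 3 first.
- by apply: em_EFin; meas.
- by move=> y _; rewrite lee_fin mu_leb_ge0.
- exact: ig_ge0.
apply: eq_integral => y _.
rewrite igZ; [|exact: mu_leb_ge0|by meas|by []].
have [->|y0] := eqVneq y 0.
  by rewrite vnorm0 expr0n gtn_eqF// invr0 mulr0 mul0e mule0.
rewrite muleC; congr (_ * _)%E.
have ny : 0 < vnorm y by rewrite vnorm_gt0.
pose g (s : R) := (F (expR s))%:E.
have mg : measurable_fun [set: R] g by rewrite /g; meas.
have g0 s : (0 <= g s)%E by rewrite lee_fin.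
rewrite -[RHS](@leb_shift _ (ln (vnorm y)) g)//.
rewrite -[RHS](@leb_opp _ (fun s => g (s + ln (vnorm y))))//; last first.
  by apply: (mcomp mg); meas.
apply: eq_integral => s _; congr EFin; congr F.
by rewrite vnormZ ger0_norm ?expR_ge0// expRD lnK.
Qed.

(** This is [radial_inv] for $g(x)|x|^n$; the factor $(c/|x|^2)^n$ is the Jacobian of the inversion.
    The condition at 0 is there because $|0|^n/|0|^n$ evaluates to 0; [mun_invR] removes it, the
    origin being a null set. *)
Lemma mun_inv c (g : E -> R) : 0 < c -> measurable_fun [set: E] g ->
  (forall x, 0 <= g x) -> g 0 = 0 ->
  (\int[mu]_x (g (vinv c x) * (c / vnorm x ^+ 2) ^+ n)%:E =
   \int[mu]_x (g x)%:E)%E.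
Proof.
move=> c0 mg g0 g00.
have := @radial_inv c (fun x => g x * vnorm x ^+ n) c0.
have m1 : measurable_fun [set: E] (fun x => g x * vnorm x ^+ n) by meas.
have m2 x : 0 <= g x * vnorm x ^+ n by rewrite mulr_ge0 ?exprn_ge0 ?vnorm_ge0.
move=> /(_ m1 m2) H.
transitivity (\int[mu]_x (g (vinv c x) * vnorm (vinv c x) ^+ n / vnorm x ^+ n)%:E)%E.
  apply: eq_integral => x _; congr EFin.
  rewrite vnorm_vinv// -mulrA; congr (_ * _).
  by rewrite -expr_div_n; congr (_ ^+ _); rewrite expr2 invfM mulrA.
rewrite H; apply: eq_integral => x _; congr EFin.
have [->|x0] := eqVneq x 0; first by rewrite g00 !mul0r.
by rewrite mulfK// expf_neq0// vnorm_eq0.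
Qed.

End inversion.

Section box.
Variable R : realType.

Lemma mun_prod n (g : R -> R) : measurable_fun [set: R] g ->
  (forall x, 0 <= g x) -> forall v, (\int[leb R]_x (g x)%:E = v%:E)%E ->
  (\int[mun R n]_x (\prod_(i < n) g (tnth x i))%:E = (v ^+ n)%:E)%E.
Proof.
move=> mg g0 v gv.
have v0 : 0 <= v by rewrite -lee_fin -gv; exact: ig_ge0.
have mp k : measurable_fun [set: k.-tuple R]
    (fun x => \prod_(i < k) g (tnth x i)).
  apply: measurable_prod => i _; apply: (mcomp mg).
  exact: measurable_tnth.
have p0 k (x : k.-tuple R) : 0 <= \prod_(i < k) g (tnth x i).
  by apply: prodr_ge0 => i _.
elim: n => [|n ih].
  under eq_integral do rewrite big_ord0.
  by rewrite integral_cst// mul1e expr0; exact: diracT.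
rewrite (integral_munS_iter (f := fun x => (\prod_(i < n.+1) g (tnth x i))%:E)).
- transitivity (\int[mun R n]_t (v * \prod_(i < n) g (tnth t i))%:E)%E.
    apply: eq_integral => t _.
    transitivity (\int[leb R]_x ((\prod_(i < n) g (tnth t i)) * g x)%:E)%E.
      apply: eq_integral => x _; congr EFin.
      rewrite big_ord_recl mulrC; congr (_ * _).
      by apply: eq_bigr => i _; rewrite tnthS.
    by rewrite igZ// gv -EFinM mulrC.
  rewrite (igZ _ v0 (mp n) (p0 n)) exprS EFinM; congr (_ * _)%E; exact: ih.
- by apply: em_EFin; exact: mp.
- by move=> x; rewrite lee_fin.
Qed.

Lemma leb_chi (a b : R) : a <= b ->
  (\int[leb R]_x (chi R ((a < x) && (x < b)))%:E = (b - a)%:E)%E.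
Proof.
move=> ab.
rewrite (eq_integral (fun s : measurableTypeR R => (\1_(`]a, b[%classic) s)%:E)).
  rewrite integral_indic//= setIT lebesgue_measure_itv/= lte_fin.
  case: ltP => // ba; have -> : a = b by apply/eqP; rewrite eq_le ab.
  by rewrite subrr.
by move=> x _; rewrite indicE mem_setE in_itv.
Qed.

Lemma prod_chi (I : finType) (b : I -> bool) :
  \prod_(i : I) chi R (b i) = chi R [forall i, b i].
Proof.
case: (boolP [forall i, b i]) => [/forallP H|/forallPn[i bi]].
  by rewrite big1// => i _; rewrite H.
by rewrite (bigD1 i)//= (negbTE bi) mul0r.
Qed.

(** Cubes are measured directly from the product structure. Comparison with them shows that balls
    have finite and positive volume. *)
Lemma mun_box n (a b : R) : a <= b ->
  (\int[mun R n]_x (chi R [forall i, (a < tnth x i) && (tnth x i < b)])%:E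
   = ((b - a) ^+ n)%:E)%E.
Proof.
move=> ab; rewrite -(@mun_prod n (fun x => chi R ((a < x) && (x < b))) _ _ (b - a) (leb_chi ab)).
- by apply: eq_integral => x _; rewrite prod_chi.
- by meas.
- by move=> x; exact: chi_ge0.
Qed.

Lemma measurable_box n (a b : R) : measurable_fun [set: n.-tuple R]
  (fun x => chi R [forall i, (a < tnth x i) && (tnth x i < b)]).
Proof.
rewrite (_ : (fun _ => _) =
  fun x => \prod_(i < n) chi R ((a < tnth x i) && (tnth x i < b))).
  apply: measurable_prod => i _; meas.
by apply/funext => x; rewrite prod_chi.
Qed.
End box.

(** * Balls and the kernel *)

Section balls.
Variables (R : realType) (n : nat).
Hypothesis n0 : (0 < n)%N.
Local Notation E := (n.-tuple R).
Local Notation mu := (mun R n).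

Lemma chi_le (a b : bool) : (a -> b) -> chi R a <= chi R b.
Proof. by rewrite /chi ler_nat; case: a; case: b => // /(_ isT). Qed.

(** Side $1/(n+1)$ makes the sum of the n squares at most $n/(n+1) < 1$. The cube also avoids the
    origin, which [om_gt0] needs in order to divide by $|x|^n$. *)
Lemma box_ball (x : E) :
  [forall i, (0 < tnth x i) && (tnth x i < n.+1%:R^-1)] ->
  (x != 0) && (vnorm x < 1).
Proof.
move=> /forallP H; apply/andP; split.
  apply/eqP => x0; have /andP[+ _] := H (Ordinal n0).
  by rewrite x0 tnth0z ltxx.
rewrite -ltr_sqr ?nnegrE ?vnorm_ge0// expr1n sqr_vnorm.
apply: (@le_lt_trans _ _ (\sum_(i < n) (n.+1%:R^-1 : R))).
  apply: ler_sum => i _; have /andP[h1 h2] := H i.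
  have h3 : n.+1%:R^-1 <= 1 :> R by rewrite invf_le1 ?ltr0n// ler1n.
  rewrite -[leRHS]mulr1; apply: ler_pM; [exact: ltW|exact: ltW|exact: ltW|].
  exact: ltW (lt_le_trans h2 h3).
rewrite sumr_const card_ord -[_ *+ n]mulr_natr ltr_pdivrMl ?ltr0n// mulr1 ltr_nat.
exact: ltnSn.
Qed.

Lemma ball_box (x : E) (r : R) : vnorm x < r ->
  [forall i, (- r < tnth x i) && (tnth x i < r)].
Proof.
move=> xr; apply/forallP => i; rewrite -ltr_norml.
exact: le_lt_trans (tnth_le_vnorm _ _) xr.
Qed.

Lemma measurable_ball (a : E) (r : R) :
  measurable_fun [set: E] (fun x => chi R (vnorm (x - a) < r)).
Proof. by meas. Qed.

Lemma mu_ball_fin (r : R) : (\int[mu]_x (chi R (vnorm x < r))%:E < +oo)%E.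
Proof.
have r0 : - `|r| <= `|r| by rewrite ge0_cp.
apply: (@le_lt_trans _ _ (\int[mu]_x
   (chi R [forall i, (- `|r| < tnth x i) && (tnth x i < `|r|)])%:E)%E); last first.
  by rewrite mun_box// ltry.
apply: ig_le; [by meas|exact: measurable_box|] => x.
rewrite chi_ge0/= chi_le// => /lt_le_trans => /(_ _ (ler_norm r)).
exact: ball_box.
Qed.

Definition bvol : R := fine (\int[mu]_x (chi R (vnorm x < 1))%:E)%E.

Lemma mu_box_gt0 : 0 < (n.+1%:R^-1 - 0) ^+ n :> R.
Proof. by rewrite subr0 exprn_gt0// invr_gt0 ltr0n. Qed.

Lemma bvolE : (\int[mu]_x (chi R (vnorm x < 1))%:E = bvol%:E)%E.
Proof.
rewrite fineK// ge0_fin_numE ?mu_ball_fin//.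
by apply: ig_ge0 => x; exact: chi_ge0.
Qed.

Lemma bvol_gt0 : 0 < bvol.
Proof.
rewrite -lte_fin -bvolE; apply: (@lt_le_trans _ _ ((n.+1%:R^-1 - 0) ^+ n)%:E).
  by rewrite lte_fin mu_box_gt0.
rewrite -mun_box ?invr_ge0 ?ler0n//.
apply: ig_le; [exact: measurable_box|by meas|] => x.
by rewrite chi_ge0/= chi_le// => /box_ball/andP[].
Qed.

Lemma mu_ball0 (r : R) : 0 < r ->
  (\int[mu]_x (chi R (vnorm x < r))%:E = (r ^+ n * bvol)%:E)%E.
Proof.
move=> r0; pose f (x : E) := chi R (vnorm x < 1).
have mf : measurable_fun [set: E] f by rewrite /f; meas.
transitivity (\int[mu]_x (f (r^-1 *: x))%:E)%E.
  apply: eq_integral => x _; congr (chi R _)%:E.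
  by rewrite vnormZ ger0_norm ?invr_ge0 ?ltW// mulrC ltr_pdivrMr// mul1r.
rewrite (mun_scale (f := EFin \o f)) ?invr_gt0//; last 2 first.
- by apply: em_EFin; meas.
- by move=> x; rewrite lee_fin; exact: chi_ge0.
by rewrite exprVn invrK EFinM -bvolE.
Qed.

Lemma mu_ball (a : E) (r : R) : 0 < r ->
  (\int[mu]_x (chi R (vnorm (x - a) < r))%:E = (r ^+ n * bvol)%:E)%E.
Proof.
move=> r0; rewrite -mu_ball0//.
rewrite (mun_shift (- a) (f := fun x => (chi R (vnorm x < r))%:E))//.
  by meas.
by move=> x; rewrite lee_fin; exact: chi_ge0.
Qed.

Definition om : R := fine (omega' R n).

Lemma omE : (omega' R n = om%:E)%E.
Proof.
rewrite fineK// ge0_fin_numE; last by apply: ig_ge0 => x; exact: mu_leb_ge0.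
apply: le_lt_trans (mu_ball_fin (expR 1)).
apply: ig_le; [by rewrite /shell; meas|by meas|] => x.
rewrite mu_leb_ge0/= /shell; case: (boolP (_ && _)) => [/andP[x1 xe]|_].
  by rewrite xe /chi mulr1n div1r invf_le1 ?exprn_ege1// exprn_gt0// (lt_le_trans ltr01).
by rewrite mul0r chi_ge0.
Qed.

(** If the constant were zero, [radial_int] would give measure zero to the punctured unit ball,
    which contains a cube. *)
Lemma om_gt0 : 0 < om.
Proof.
rewrite lt_neqAle -lee_fin -omE andbC ig_ge0/=; last by move=> x; exact: mu_leb_ge0.
apply/eqP => om0.
have := @radial_int R n n0 (fun t => t ^+ n * chi R ((0 <= t) && (t < 1))).
have mF : measurable_fun [set: R] (fun t => t ^+ n * chi R ((0 <= t) && (t < 1))).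
  by meas.
have F0 t : 0 <= t ^+ n * chi R ((0 <= t) && (t < 1)).
  case: (boolP (_ && _)) => [/andP[t0 _]|_]; last by rewrite mulr0.
  by rewrite mulr_ge0 ?exprn_ge0.
move=> /(_ mF F0); rewrite omE -om0 mul0e => H.
suff : ((((n.+1%:R)^-1 - 0 : R) ^+ n)%:E <= 0)%E by rewrite lee_fin leNgt mu_box_gt0.
rewrite -H -(@mun_box R n) ?invr_ge0 ?ler0n//.
apply: ig_le; [exact: measurable_box|by meas|] => x.
rewrite chi_ge0/=; case: (boolP [forall i, _]) => [/box_ball/andP[x0 x1]|_].
  rewrite vnorm_ge0 x1 /chi mulr1 divff//.
  by rewrite expf_neq0// vnorm_eq0.
by rewrite divr_ge0 ?F0 ?exprn_ge0 ?vnorm_ge0.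
Qed.

(** The origin of the logarithm in the gain: against $|x|^{-n}$ only the logarithmic width of an
    annulus counts. *)
Lemma log_shell (a b : R) : 0 < a -> a <= b ->
  (\int[mu]_x (chi R ((a < vnorm x) && (vnorm x < b)) / vnorm x ^+ n)%:E =
   (om * (ln b - ln a))%:E)%E.
Proof.
move=> a0 ab; have b0 : 0 < b by exact: lt_le_trans ab.
rewrite (radial_int n0 (F := fun t => chi R ((a < t) && (t < b)))); last 2 first.
- by meas.
- by move=> t; exact: chi_ge0.
rewrite omE EFinM; congr (_ * _)%E.
rewrite -leb_chi ?ler_ln//; apply: eq_integral => s _; congr (chi R _)%:E.
by rewrite -{1}(lnK a0) -{1}(lnK b0) !ltr_expR.
Qed.

Variable sg : R.
Hypotheses (sg0 : 0 < sg) (sg1 : sg < 1).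

(** The kernel $|z|^{-n-2\sigma}$. By the convention for division by zero it vanishes at 0, so the
    diagonal contributes nothing and needs no excision in the energies. *)
Definition rker (z : E) : R := (vnorm z `^ (n%:R + 2 * sg))^-1.

Lemma Ker_ge0 z : 0 <= rker z.
Proof. by rewrite invr_ge0 powR_ge0. Qed.

Lemma measurable_Ker : measurable_fun [set: E] rker.
Proof. by rewrite /rker; meas. Qed.

Lemma KerN z : rker (- z) = rker z.
Proof. by rewrite /rker vnormN. Qed.

Lemma KerB x y : rker (x - y) = rker (y - x).
Proof. by rewrite -KerN opprB. Qed.

Lemma Ker0 : rker 0 = 0.
Proof.
rewrite /rker vnorm0 powR0 ?invr0// gt_eqF// addr_gt0 ?ltr0n//.
by rewrite mulr_gt0.
Qed.

Lemma Ker_split z : rker z = (vnorm z `^ (2 * sg))^-1 / vnorm z ^+ n.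
Proof.
have [->|z0] := eqVneq z 0.
  by rewrite Ker0 vnorm0 expr0n gtn_eqF// invr0 mulr0.
rewrite /rker powRD; last by rewrite vnorm_eq0 z0 implybT.
by rewrite powR_mulrn ?vnorm_ge0// invfM mulrC.
Qed.

Lemma KerZ (c : R) z : 0 < c ->
  rker (c *: z) = (c `^ (n%:R + 2 * sg))^-1 * rker z.
Proof.
move=> c0; rewrite /rker vnormZ ger0_norm ?ltW// powRM ?(ltW c0) ?vnorm_ge0//.
by rewrite invfM.
Qed.

(** Dominates the squared increment of a cut-off at scale r ([hat_lip]). It is quadratic at the
    origin and bounded at infinity, which makes its product with the kernel integrable at both
    ends. *)
Definition cut (r : R) (z : E) : R := Num.min 1 (vnorm z ^+ 2 / r ^+ 2).

Lemma cut_ge0 r z : 0 <= cut r z.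
Proof. by rewrite le_min ler01 divr_ge0 ?sqr_ge0. Qed.

Lemma cut_ge r z : 0 < r -> r <= vnorm z -> cut r z = 1.
Proof.
move=> r0 rz; apply/min_idPl; rewrite ler_pdivlMr ?exprn_gt0// mul1r.
by rewrite ler_sqr ?nnegrE ?vnorm_ge0// ltW.
Qed.

Definition Cm : R := fine (\int[mu]_z (cut 1 z * rker z)%:E)%E.

Lemma cut_Ker_fin : (\int[mu]_z (cut 1 z * rker z)%:E < +oo)%E.
Proof.
pose F (t : R) := Num.min 1 (t ^+ 2) * (t `^ (2 * sg))^-1.
have mF : measurable_fun [set: R] F by rewrite /F; meas.
have F0 t : 0 <= F t.
  by rewrite mulr_ge0 ?invr_ge0 ?powR_ge0// le_min ler01 sqr_ge0.
rewrite (_ : \int[_]_z _ = \int[mu]_z (F (vnorm z) / vnorm z ^+ n)%:E)%E; last first.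
  apply: eq_integral => z _; congr EFin.
  by rewrite Ker_split /cut /F expr1n divr1 mulrA.
rewrite (radial_int n0 mF F0) omE lte_mul_pinfty// ?lee_fin ?(ltW om_gt0)//.
(* In logarithmic radius the integrand is $\min(1, e^{2s}) e^{-2\sigma s}$: it decays at rate a for
   positive s and at rate b for negative s, and b is positive because $\sigma < 1$. Two exponential
   densities dominate it. *)
pose a := 2 * sg; pose b := 2 - 2 * sg.
have a0 : 0 < a by rewrite mulr_gt0.
have b0 : 0 < b by rewrite subr_gt0 -[ltRHS]mulr1 ltr_pM2l.
pose G (s : R) := a^-1 * exponential_pdf a s + b^-1 * exponential_pdf b (- s).
have me (c : R) : measurable_fun [set: R] (exponential_pdf c).
  exact: measurable_exponential_pdf.
have mea := me a; have meb := me b.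
have e0 (c : R) : 0 < c -> forall s, 0 <= exponential_pdf c s.
  by move=> c0 s; apply: exponential_pdf_ge0; exact: ltW.
apply: (@le_lt_trans _ _ (\int[leb R]_s (G s)%:E)%E).
  apply: ig_le.
  - by meas.
  - by rewrite /G; meas.
  - move=> s; rewrite F0/= /F /G.
    have -> : (expR s `^ (2 * sg))^-1 = expR (- (a * s)).
      by rewrite /powR gt_eqF ?expR_gt0// expRK expRN.
    have [s0|s0] := leP 0 s.
      apply: (@le_trans _ _ (a^-1 * exponential_pdf a s)); last first.
        by rewrite lerDl mulr_ge0 ?invr_ge0 ?(ltW b0) ?e0.
      rewrite exponential_pdfE// mulrA mulVf ?gt_eqF// mul1r mulNr.
      by rewrite ler_piMl ?expR_ge0// ge_min lexx.
    apply: (@le_trans _ _ (b^-1 * exponential_pdf b (- s))); last first.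
      by rewrite lerDr mulr_ge0 ?invr_ge0 ?(ltW a0) ?e0.
    rewrite exponential_pdfE ?oppr_ge0 ?(ltW s0)// mulrA mulVf ?gt_eqF// mul1r.
    have -> : expR (- b * - s) = expR s ^+ 2 * expR (- (a * s)).
      by rewrite -expRM_natl -expRD; congr expR; rewrite /a /b; ring.
    by rewrite ler_wpM2r ?expR_ge0// ge_min lexx orbT.
rewrite /G igD; last 4 first.
- by meas.
- by meas.
- by move=> s; rewrite mulr_ge0 ?invr_ge0 ?(ltW a0) ?e0.
- by move=> s; rewrite mulr_ge0 ?invr_ge0 ?(ltW b0) ?e0.
rewrite igZ ?invr_ge0 ?(ltW a0)//; last by move=> s; apply: e0.
rewrite igZ ?invr_ge0 ?(ltW b0)//; last 2 first.
- by meas.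
- by move=> s; apply: e0.
rewrite (leb_opp (f := fun s => (exponential_pdf b s)%:E)); last 2 first.
- by apply: em_EFin; meas.
- by move=> s; rewrite lee_fin e0.
by rewrite !integral_exponential_pdf// !mule1 -EFinD ltry.
Qed.

Lemma CmE : (\int[mu]_z (cut 1 z * rker z)%:E = Cm%:E)%E.
Proof.
rewrite fineK// ge0_fin_numE ?cut_Ker_fin//.
by apply: ig_ge0 => z; rewrite mulr_ge0 ?cut_ge0 ?Ker_ge0.
Qed.

Lemma Cm_ge0 : 0 <= Cm.
Proof.
rewrite -lee_fin -CmE; apply: ig_ge0 => z.
by rewrite mulr_ge0 ?cut_ge0 ?Ker_ge0.
Qed.

Lemma measurable_cut r : measurable_fun [set: E] (cut r).
Proof. by rewrite /cut; meas. Qed.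

Lemma cut_Ker r : 0 < r ->
  (\int[mu]_z (cut r z * rker z)%:E = (Cm * (r `^ (2 * sg))^-1)%:E)%E.
Proof.
move=> r0; pose f (z : E) := cut 1 z * rker z.
have mf : measurable_fun [set: E] f.
  by have := measurable_cut 1; have := measurable_Ker; rewrite /f => ? ?; meas.
have f0 z : 0 <= f z by rewrite mulr_ge0 ?cut_ge0 ?Ker_ge0.
have rn : 0 <= (r `^ (n%:R + 2 * sg))^-1 by rewrite invr_ge0 powR_ge0.
transitivity (\int[mu]_z ((r `^ (n%:R + 2 * sg))^-1 * f (r^-1 *: z))%:E)%E.
  apply: eq_integral => z _; congr EFin; rewrite /f KerZ ?invr_gt0//.
  rewrite mulrCA (mulrA _^-1) -invfM -powRM ?invr_ge0 ?ltW//.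
  rewrite mulfV ?gt_eqF// powR1 invr1 mul1r; congr (_ * _).
  rewrite /cut expr1n divr1 vnormZ ger0_norm ?invr_ge0 ?ltW// exprMn exprVn.
  by rewrite [X in Num.min 1 X]mulrC.
rewrite (igZ mu rn (mfun_scale mf _) (fun z => f0 _)).
rewrite (mun_scaleR mf f0) ?invr_gt0//.
have -> : (\int[mu]_x (f x)%:E = Cm%:E)%E by exact: CmE.
rewrite -!EFinM exprVn invrK; congr EFin.
rewrite powRD; last by rewrite (gt_eqF r0) implybT.
rewrite powR_mulrn ?ltW// invfM (mulrC Cm) -!mulrA mulrCA; congr (_ * _).
by rewrite mulrA mulVf ?mul1r// expf_neq0// gt_eqF.
Qed.

End balls.

(** * Energy and the refined Sobolev inequality *)

Section double_integrals.
Context d (T : measurableType d) (R : realType).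
Variable m : {sigma_finite_measure set T -> \bar R}.
Local Open Scope ereal_scope.
Implicit Types F G : T -> T -> R.

Definition mfun2 F := measurable_fun [set: T * T] (fun p => F p.1 p.2).

Definition dint F : \bar R := \int[m]_x \int[m]_y (F x y)%:E.

Lemma mfun2_r F x : mfun2 F -> measurable_fun [set: T] (F x).
Proof.
move=> mF; apply: (mcomp mF (f := fun y => (x, y))).
by apply: measurable_fun_pair; [exact: measurable_cst|exact: measurable_id].
Qed.

Lemma mfun2D F G : mfun2 F -> mfun2 G -> mfun2 (fun x y => F x y + G x y)%R.
Proof. exact: rmD. Qed.

Lemma mfun2M F G : mfun2 F -> mfun2 G -> mfun2 (fun x y => F x y * G x y)%R.
Proof. exact: rmM. Qed.

Lemma mfun2_swap F : mfun2 F -> mfun2 (fun x y => F y x).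
Proof.
move=> mF; apply: (mcomp mF (f := fun p => (p.2, p.1))).
exact: measurable_fun_pair.
Qed.

Lemma mfun2_1 (f : T -> R) : measurable_fun [set: T] f -> mfun2 (fun x _ => f x).
Proof. by move=> mf; apply: (mcomp mf). Qed.

Lemma dint_ge0 F : (forall x y, 0 <= F x y)%R -> 0 <= dint F.
Proof. by move=> F0; apply: integral_ge0 => x _; exact: ig_ge0. Qed.

Lemma dint_le F G : mfun2 F -> mfun2 G -> (forall x y, 0 <= F x y <= G x y)%R ->
  dint F <= dint G.
Proof.
move=> mF mG FG.
have F0 x y : (0 <= F x y)%R by case/andP: (FG x y).
have G0 x y : (0 <= G x y)%R by case/andP: (FG x y) => /le_trans; exact.
apply: eg_le.
- exact: measurable_inner.
- exact: measurable_inner.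
- by move=> x; exact: ig_ge0.
- by move=> x; apply: ig_le => //; exact: mfun2_r.
Qed.

Lemma dintD F G : mfun2 F -> mfun2 G ->
  (forall x y, 0 <= F x y)%R -> (forall x y, 0 <= G x y)%R ->
  dint (fun x y => F x y + G x y)%R = dint F + dint G.
Proof.
move=> mF mG F0 G0; rewrite -ge0_integralD//.
- by apply: eq_integral => x _; rewrite igD//; exact: mfun2_r.
- by move=> x _; exact: ig_ge0.
- exact: measurable_inner.
- by move=> x _; exact: ig_ge0.
- exact: measurable_inner.
Qed.

Lemma dintZ (c : R) F : (0 <= c)%R -> mfun2 F -> (forall x y, 0 <= F x y)%R ->
  dint (fun x y => c * F x y)%R = c%:E * dint F.
Proof.
move=> c0 mF F0; rewrite -ge0_integralZl//.
- by apply: eq_integral => x _; rewrite igZ//; exact: mfun2_r.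
- exact: measurable_inner.
- by move=> x _; exact: ig_ge0.
Qed.

Lemma dint_sym F : mfun2 F -> (forall x y, 0 <= F x y)%R ->
  dint F = dint (fun x y => F y x).
Proof. by move=> mF F0; rewrite /dint tonelli. Qed.

Lemma eq_dint F G : (forall x y, F x y = G x y) -> dint F = dint G.
Proof.
by move=> FG; apply: eq_integral => x _; apply: eq_integral => y _; rewrite FG.
Qed.
End double_integrals.

Section energy.
Variables (R : realType) (n : nat).
Hypothesis n0 : (0 < n)%N.
Variable sg : R.
Hypotheses (sg0 : 0 < sg) (sg1 : sg < 1) (sgn : 2 * sg < n%:R).
Local Notation E := (n.-tuple R).
Local Notation mu := (mun R n).
Local Notation Ker := (@rker R n sg).
Local Notation mfunE u := (measurable_fun [set: E] u).

Let mK : mfunE Ker. Proof. exact: measurable_Ker. Qed.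
Let mcut r : mfunE (@cut R n r). Proof. exact: measurable_cut. Qed.

Definition quad (u : E -> R) x y := (u x - u y) ^+ 2 * Ker (x - y).

Lemma Q_ge0 u x y : 0 <= quad u x y.
Proof. by rewrite mulr_ge0 ?sqr_ge0 ?Ker_ge0. Qed.

Lemma Q_sym u x y : quad u x y = quad u y x.
Proof. by rewrite /quad KerB -sqrrN opprB. Qed.

Lemma mQ u : mfunE u -> mfun2 (quad u).
Proof. by move=> mu_; rewrite /mfun2 /quad; meas. Qed.

Definition energy u : \bar R := dint mu (quad u).

Lemma En_ge0 u : (0 <= energy u)%E.
Proof. by apply: dint_ge0 => x y; exact: Q_ge0. Qed.

(** This is $p/2 - 1$ ([pexpE]), the power with which the constant N enters the refined Sobolev
    inequality. *)
Definition sobq : R := 2 * sg / (n%:R - 2 * sg).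

Lemma sobq_gt0 : 0 < sobq.
Proof. by rewrite divr_gt0 ?mulr_gt0// subr_gt0. Qed.

Lemma pexpE : pexp n sg = 2 * (1 + sobq).
Proof.
rewrite /pexp /sobq; field.
by rewrite subr_eq0 gt_eqF.
Qed.

Lemma pexp_gt2 : 2 < pexp n sg.
Proof. by rewrite pexpE -[ltLHS]mulr1 ltr_pM2l// ltrDl sobq_gt0. Qed.

Lemma pexp_gt0 : 0 < pexp n sg.
Proof. exact: lt_trans pexp_gt2. Qed.

Lemma powR_pexp (a : R) : `|a| `^ pexp n sg = (a ^+ 2) `^ (1 + sobq).
Proof.
rewrite pexpE powRrM; congr (_ `^ _).
by rewrite (powR_mulrn 2) ?normr_ge0// real_normK ?num_real.
Qed.

(* Average u(x)^2 <= 2(u(x)-u(y))^2 + 2u(y)^2 over the ball around x whose radius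
   makes the mean of u(y)^2 at most u(x)^2 / 4. *)
Lemma pointwise_sobolev (u : E -> R) (N : R) (x : E) : mfunE u -> 0 < N ->
  (forall t : R, (0 < t)%R ->
    \int[mu]_y (chi R (vnorm (y - x) < t)%R * u y ^+ 2)%:E <= (N * t `^ (2 * sg))%:E)%E ->
  (((`|u x| `^ pexp n sg))%:E <=
   ((4 / bvol R n) `^ (1 + sobq) * N `^ sobq)%:E * \int[mu]_y (quad u x y)%:E)%E.
Proof.
move=> mu_ N0 HN; have b0 := bvol_gt0 R n0; set b := bvol R n in b0 *.
have CN0 : 0 < (4 / b) `^ (1 + sobq) * N `^ sobq.
  by rewrite mulr_gt0// powR_gt0// divr_gt0.
have A0 : (0 <= \int[mu]_y (quad u x y)%:E)%E by apply: ig_ge0 => y; exact: Q_ge0.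
have [->|ux] := eqVneq (u x) 0.
  by rewrite normr0 powR0 ?gt_eqF ?pexp_gt0// mule_ge0// lee_fin ltW.
set U := u x ^+ 2.
have U0 : 0 < U by rewrite /U exprn_even_gt0.
have nsg : 0 < n%:R - 2 * sg by rewrite subr_gt0.
(* The solution of $N t^{2\sigma} = U b\, t^n / 4$, as [tE] checks; it exists because $2\sigma <
   n$. *)
pose t := (4 * N / (U * b)) `^ (n%:R - 2 * sg)^-1.
have t0 : 0 < t by apply: powR_gt0; apply: divr_gt0; apply: mulr_gt0.
have tn0 : 0 < t ^+ n by rewrite exprn_gt0.
have ts0 : 0 < t `^ (2 * sg) by rewrite powR_gt0.
have tE : N * t `^ (2 * sg) = U * b * t ^+ n / 4.
  have -> : t ^+ n = t `^ (2 * sg) * t `^ (n%:R - 2 * sg).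
    by rewrite -powRD ?(gt_eqF t0) ?implybT// addrC subrK powR_mulrn ?ltW.
  rewrite -(powRrM _ _ (n%:R - 2 * sg)) mulVf ?gt_eqF// powRr1; last first.
    by apply: divr_ge0; apply: mulr_ge0 => //; exact: ltW.
  by field; rewrite !gt_eqF.
have tt : t `^ (n%:R + 2 * sg) = t ^+ n * t `^ (2 * sg).
  by rewrite powRD ?(gt_eqF t0) ?implybT// powR_mulrn ?ltW.
have mQx : mfunE (quad u x) by apply: mfun2_r; exact: mQ.
have key : ((U * (t ^+ n * b))%:E <=
    (2 * t `^ (n%:R + 2 * sg))%:E * \int[mu]_y (quad u x y)%:E +
    (2 * (N * t `^ (2 * sg)))%:E)%E.
  rewrite EFinM -(mu_ball x t0) -(igZ mu (ltW U0) (measurable_ball x t) (fun y => chi_ge0 _ _)).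
  rewrite [X in (_ <= _ + X)%E]EFinM.
  apply: le_trans (leeD2l _ (lee_wpmul2l _ (HN t t0))); last by rewrite lee_fin.
  rewrite -igZ//; [|by rewrite mulr_ge0 ?powR_ge0|by move=> y; exact: Q_ge0].
  rewrite -igZ//; [|by meas|by move=> y; rewrite mulr_ge0 ?chi_ge0 ?sqr_ge0].
  rewrite -igD; last 4 first.
  - by meas.
  - by meas.
  - by move=> y; rewrite mulr_ge0 ?Q_ge0// mulr_ge0 ?powR_ge0.
  - by move=> y; rewrite mulr_ge0// mulr_ge0 ?chi_ge0 ?sqr_ge0.
  apply: ig_le; [by meas|by meas|] => y.
  rewrite mulr_ge0 ?chi_ge0 ?(ltW U0)//=.
  have [yx|_] := boolP (_ < t); last first.
    rewrite /chi mulr0 mul0r mulr0 addr0 mulr_ge0 ?Q_ge0// mulr_ge0//.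
    exact: powR_ge0.
  rewrite /chi mulr1 mul1r.
  suff : (u x - u y) ^+ 2 <= t `^ (n%:R + 2 * sg) * quad u x y.
    rewrite -subr_ge0 => H; rewrite -subr_ge0 /U.
    have := sqr_ge0 (u x - 2 * u y); have := sqr_ge0 (u x - u y).
    nra.
  have [->|xy] := eqVneq x y; first by rewrite /quad subrr expr0n/= mul0r mulr0.
  rewrite /quad mulrCA ler_peMr ?sqr_ge0//.
  have xy0 : 0 < vnorm (x - y) by rewrite vnorm_gt0 subr_eq0.
  rewrite ler_pdivlMr ?powR_gt0// mul1r; apply: ge0_ler_powR.
  - by apply: addr_ge0 => //; apply: mulr_ge0 => //; exact: ltW.
  - by rewrite nnegrE ltW.
  - by rewrite nnegrE ltW.
  - by rewrite vnormB ltW.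
(* By the choice of t the last term of [key] is half of its left side and is absorbed there. *)
have key2 : ((U * b / 4 / t `^ (2 * sg))%:E <= \int[mu]_y (quad u x y)%:E)%E.
  move: key A0; case: (\int[mu]_y _)%E => [A|_ _|_ //]; last by rewrite leey.
  rewrite -EFinM -EFinD !lee_fin tE tt => key A0.
  rewrite ler_pdivrMr// -(ler_pM2l tn0).
  nra.
apply: le_trans (lee_wpmul2l _ key2); last by rewrite lee_fin ltW.
rewrite -EFinM lee_fin powR_pexp -/U /t -powRrM.
rewrite (_ : _^-1 * (2 * sg) = sobq); last by rewrite /sobq mulrC.
set X := 4 * N / (U * b); set D := 4 / b.
have X0 : 0 < X by apply: divr_gt0; apply: mulr_gt0.
have D0 : 0 < D by apply: divr_gt0.
have e1 : U `^ sobq * X `^ sobq = D `^ sobq * N `^ sobq.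
  rewrite -!powRM ?ltW//; congr (_ `^ _); rewrite /X /D; field.
  by rewrite !gt_eqF.
have e2 (a : R) : 0 < a -> a `^ (1 + sobq) = a * a `^ sobq.
  by move=> a0; rewrite powRD ?powRr1 ?ltW// (gt_eqF a0) implybT.
rewrite mulrA ler_pdivlMr ?powR_gt0// !e2//. rewrite -[leLHS]mulrA e1.
rewrite le_eqVlt; apply/orP; left; apply/eqP; rewrite /D; field.
by rewrite gt_eqF.
Qed.

End energy.

(** * Integrated Sobolev inequality, and the cost of cutting off a ball *)

Section cutoff.
Variables (R : realType) (n : nat).
Hypothesis n0 : (0 < n)%N.
Variable sg : R.
Hypotheses (sg0 : 0 < sg) (sg1 : sg < 1) (sgn : 2 * sg < n%:R).
Local Notation E := (n.-tuple R).
Local Notation mu := (mun R n).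
Local Notation Ker := (@rker R n sg).
Local Notation Q := (@quad R n sg).
Local Notation En := (@energy R n sg).
Local Notation mfunE u := (measurable_fun [set: E] u).

Let mK : mfunE Ker. Proof. exact: measurable_Ker. Qed.
Let mcut r : mfunE (@cut R n r). Proof. exact: measurable_cut. Qed.

Definition Csob : R := (4 / bvol R n) `^ (1 + sobq n sg).

(** N is a Morrey constant of u at the scaling of the energy. Since it enters with a positive power,
    a function of bounded energy and unit $L^p$ norm cannot have N small; [concentrate] extracts
    from this a ball carrying enough of $u^2$. *)
Lemma refined_sobolev (u : E -> R) (N : R) : mfunE u -> 0 < N ->
  (forall x (t : R), (0 < t)%R ->
    \int[mu]_y (chi R (vnorm (y - x) < t)%R * u y ^+ 2)%:E
      <= (N * t `^ (2 * sg))%:E)%E ->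
  (\int[mu]_x (`|u x| `^ pexp n sg)%:E <=
   (Csob * N `^ sobq n sg)%:E * En u)%E.
Proof.
move=> mu_ N0 HN.
have mQu := mQ sg mu_.
have c0 : 0 <= Csob * N `^ sobq n sg by apply: mulr_ge0; exact: powR_ge0.
have mI : measurable_fun [set: E] (fun x => \int[mu]_y (Q u x y)%:E)%E.
  by apply: measurable_inner => // x y; exact: Q_ge0.
have I0 x : (0 <= \int[mu]_y (Q u x y)%:E)%E.
  by apply: ig_ge0 => y; exact: Q_ge0.
rewrite -ge0_integralZl//.
apply: eg_le.
- by apply: em_EFin; meas.
- by apply: emeasurable_funM.
- by move=> x; rewrite lee_fin powR_ge0.
- by move=> x; apply: pointwise_sobolev => // t; exact: HN.
Qed.

Lemma mfun_sub (f : E -> R) x : mfunE f -> mfunE (fun y => f (x - y)).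
Proof. by move=> mf; meas. Qed.

Lemma mun_sub (f : E -> R) x : mfunE f -> (forall z, 0 <= f z) ->
  (\int[mu]_y (f (x - y))%:E = \int[mu]_y (f y)%:E)%E.
Proof.
move=> mf f0; rewrite -(mun_shiftR mf f0 x) -(mun_oppR (mfun_shift mf x)).
  by apply: eq_integral => y _; rewrite addrC.
by move=> y; exact: f0.
Qed.

(** A cut-off removing a ball: it is 0 on $B_r(a)$, 1 off $B_{2r}(a)$, and Lipschitz with constant
    $1/r$. *)
Definition hat (a : E) (r : R) (x : E) : R :=
  Num.min 1 (Num.max 0 (vnorm (x - a) / r - 1)).

Lemma hat_ge0 a r x : 0 <= hat a r x.
Proof. by rewrite le_min ler01 le_max lexx. Qed.

Lemma hat_le1 a r x : hat a r x <= 1.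
Proof. by rewrite ge_min lexx. Qed.

Lemma hat0 a r x : 0 < r -> vnorm (x - a) <= r -> hat a r x = 0.
Proof.
move=> r0 xr; rewrite /hat; have /max_idPl -> : vnorm (x - a) / r - 1 <= 0.
  by rewrite subr_le0 ler_pdivrMr// mul1r.
by apply/min_idPr.
Qed.

Lemma hat1 a r x : 0 < r -> 2 * r <= vnorm (x - a) -> hat a r x = 1.
Proof.
move=> r0 xr; apply/min_idPl; rewrite le_max; apply/orP; right.
by rewrite lerBrDr ler_pdivlMr// (le_trans _ xr).
Qed.

Lemma measurable_hat a r : mfunE (hat a r).
Proof. by rewrite /hat; meas. Qed.

Lemma hat_lip a r x y : 0 < r -> (hat a r x - hat a r y) ^+ 2 <= cut r (x - y).
Proof.
move=> r0; rewrite le_min; apply/andP; split.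
  have := hat_ge0 a r x; have := hat_ge0 a r y.
  have := hat_le1 a r x; have := hat_le1 a r y; nra.
have lip : `|hat a r x - hat a r y| <= vnorm (x - y) / r.
  have h : `|vnorm (x - a) / r - 1 - (vnorm (y - a) / r - 1)| <= vnorm (x - y) / r.
    have r1 : 0 < r^-1 by rewrite invr_gt0.
    have -> : vnorm (x - a) / r - 1 - (vnorm (y - a) / r - 1) =
      (vnorm (x - a) - vnorm (y - a)) / r by ring.
    rewrite normrM (gtr0_norm r1) ler_pM2r// ler_norml.
    have := vnorm_tri x y a; have := vnorm_tri y x a; rewrite (vnormB y x).
    by move=> h1 h2; apply/andP; split; lra.
  move: h; rewrite /hat.
  set s := vnorm (x - a) / r - 1; set t := vnorm (y - a) / r - 1.
  set c := vnorm (x - y) / r; clearbody s t c.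
  (* The clamp to [0, 1] is split into its three affine branches, so that each of the nine
     combinations is linear arithmetic. *)
  have F (z : R) : [\/ Num.min 1 (Num.max 0 z) = 0 /\ z <= 0,
      Num.min 1 (Num.max 0 z) = z /\ 0 <= z <= 1 |
      Num.min 1 (Num.max 0 z) = 1 /\ 1 <= z].
    case/orP: (le_total z 0) => z0.
      by apply: Or31; rewrite (max_idPl z0); split=> //; apply/min_idPr.
    rewrite (max_idPr z0); case/orP: (le_total z 1) => z1.
      by apply: Or32; rewrite (min_idPr z1) z0 z1.
    by apply: Or33; rewrite (min_idPl z1).
  rewrite !ler_norml => /andP[? ?]; have := F s; have := F t.
  by case=> [[-> ?]|[-> /andP[? ?]]|[-> ?]];
    case=> [[-> ?]|[-> /andP[? ?]]|[-> ?]]; apply/andP; split; lra.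
rewrite -expr_div_n -[leLHS]real_normK ?num_real// ler_sqr ?nnegrE//.
by rewrite divr_ge0 ?vnorm_ge0 ?ltW.
Qed.

(** The original difference keeps coefficient one and every excess term is supported on pairs
    meeting $B_{2r}(a)$; a larger factor in front of the energy would swamp the gain. *)
Lemma cutoff_pointwise (v : E -> R) a r x y : 0 < r ->
  (v x * hat a r x - v y * hat a r y) ^+ 2 <=
  (v x - v y) ^+ 2 +
  chi R (vnorm (x - a) < 2 * r) *
     ((v x - v y) ^+ 2 + 2 * v x ^+ 2 * cut r (x - y)) +
  chi R (vnorm (y - a) < 2 * r) *
     ((v x - v y) ^+ 2 + 2 * v y ^+ 2 * cut r (x - y)).
Proof.
move=> r0; have L := hat_lip a x y r0.
have c0 := cut_ge0 r (x - y).
have hx0 := hat_ge0 a r x; have hx1 := hat_le1 a r x.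
have hy0 := hat_ge0 a r y; have hy1 := hat_le1 a r y.
have key s t (h k c : R) : 0 <= k <= 1 -> (h - k) ^+ 2 <= c ->
    (s * h - t * k) ^+ 2 <= 2 * (s - t) ^+ 2 + 2 * s ^+ 2 * c.
  move=> /andP[k0 k1] hc.
  (* The increment of the cut-off is multiplied by s, the value at the point that lies in the ball,
     so that the error term is localized there. *)
  have -> : s * h - t * k = k * (s - t) + s * (h - k) by ring.
  apply: (@le_trans _ _ (2 * (k * (s - t)) ^+ 2 + 2 * (s * (h - k)) ^+ 2)).
    by have := sqr_ge0 (k * (s - t) - s * (h - k)); nra.
  apply: lerD.
    rewrite ler_pM2l// exprMn ler_piMl ?sqr_ge0//.
    by rewrite expr_le1.
  by rewrite exprMn mulrA ler_wpM2l// mulr_ge0// sqr_ge0.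
have d0 := sqr_ge0 (v x - v y).
have p1 : 0 <= 2 * v x ^+ 2 * cut r (x - y).
  by rewrite mulr_ge0// mulr_ge0// sqr_ge0.
have p2 : 0 <= 2 * v y ^+ 2 * cut r (x - y).
  by rewrite mulr_ge0// mulr_ge0// sqr_ge0.
rewrite /chi.
have [xa|xa] := ltP (vnorm (x - a)) (2 * r).
  have := key (v x) (v y) _ _ _ (introT andP (conj hy0 hy1)) L.
  by case: (_ < _); rewrite ?mulr1n ?mulr0n; lra.
have [ya|ya] := ltP (vnorm (y - a)) (2 * r).
  have L' : (hat a r y - hat a r x) ^+ 2 <= cut r (x - y).
    by rewrite -sqrrN opprB.
  have := key (v y) (v x) _ _ _ (introT andP (conj hx0 hx1)) L'.
  rewrite -sqrrN opprB -(sqrrN (v y - v x)) opprB; rewrite mulr0n mulr1n; lra.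
by rewrite (hat1 r0 xa) (hat1 r0 ya) !mulr1 mulr0n !mul0r !addr0.
Qed.

(** The two excess terms of the pointwise bound are exchanged by swapping x and y, which doubles
    both constants; integrating [cut r] times the kernel in the free variable gives $C
    r^{-2\sigma}$. *)
Lemma cutoff_energy (v : E -> R) a r : mfunE v -> 0 < r ->
  (En (fun x => v x * hat a r x)%R <= En v +
   2%:E * dint mu (fun x y => chi R (vnorm (x - a) < 2 * r) * Q v x y)%R +
   (4 * Cm n sg / r `^ (2 * sg))%:E *
     \int[mu]_x (chi R (vnorm (x - a) < 2 * r) * v x ^+ 2)%:E)%E.
Proof.
move=> mv r0.
have mh := measurable_hat a r; have mcr := mcut r.
pose B x := chi R (vnorm (x - a) < 2 * r).
have mB : mfunE B by rewrite /B; meas.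
have B0 x : 0 <= B x by exact: chi_ge0.
pose F2 x y := B x * Q v x y.
pose F3 x y := 2 * (B x * v x ^+ 2) * (cut r (x - y) * Ker (x - y)).
have mQv : mfun2 (Q v) := mQ sg mv.
have mF2 : mfun2 F2 by rewrite /mfun2 /F2 /quad; meas.
have mF3 : mfun2 F3 by rewrite /mfun2 /F3; meas.
have F20 x y : 0 <= F2 x y by rewrite mulr_ge0 ?Q_ge0.
have F30 x y : 0 <= F3 x y.
  apply: mulr_ge0; last by rewrite mulr_ge0 ?cut_ge0 ?Ker_ge0.
  by apply: mulr_ge0 => //; apply: mulr_ge0 => //; exact: sqr_ge0.
set D2 := dint mu (fun x y => chi R _ * Q v x y).
have F2E : dint mu F2 = D2 by [].
have D20 : (0 <= D2)%E by exact: dint_ge0.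
clearbody D2.
have mF23 : mfun2 (fun x y => F2 x y + F3 x y) by exact: mfun2D.
have F230 x y : 0 <= F2 x y + F3 x y by exact: addr_ge0.
have F3E : (dint mu F3 = (2 * Cm n sg / r `^ (2 * sg))%:E *
    \int[mu]_x (B x * v x ^+ 2)%:E)%E.
  have mcK : mfunE (fun z => cut r z * Ker z) by meas.
  have cK0 z : 0 <= cut r z * Ker z by rewrite mulr_ge0 ?cut_ge0 ?Ker_ge0.
  have cc : 0 <= 2 * Cm n sg / r `^ (2 * sg).
    by rewrite divr_ge0 ?powR_ge0// mulr_ge0// Cm_ge0.
  rewrite -igZ//; [|by meas|by move=> x; rewrite mulr_ge0 ?sqr_ge0].
  apply: eq_integral => x _; rewrite /F3 igZ.
  - rewrite (mun_sub x mcK cK0) cut_Ker// -EFinM; congr EFin; ring.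
  - by apply: mulr_ge0 => //; apply: mulr_ge0 => //; exact: sqr_ge0.
  - exact: (mfun_sub x mcK).
  - by move=> y; exact: cK0.
apply: (@le_trans _ _ (dint mu (fun x y => Q v x y +
   ((F2 x y + F3 x y) + (F2 y x + F3 y x))))).
  apply: dint_le.
  - by apply: mQ; meas.
  - exact: (mfun2D mQv (mfun2D mF23 (mfun2_swap mF23))).
  - move=> x y; rewrite Q_ge0/= /F2 /F3 (Q_sym sg v y x) (KerB sg y x).
    have -> : cut r (y - x) = cut r (x - y) by rewrite /cut vnormB.
    have := ler_wpM2r (Ker_ge0 sg (x - y)) (cutoff_pointwise v a x y r0).
    by rewrite /quad /B; lra.
clearbody F2 F3.
rewrite (dintD _ mQv (mfun2D mF23 (mfun2_swap mF23))); last 2 first.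
- by move=> x y; exact: Q_ge0.
- by move=> x y; apply: addr_ge0.
rewrite -[leRHS]addeA; apply: leeD2l; rewrite (dintD _ mF23 (mfun2_swap mF23) F230 (fun x y => F230 y x)).
rewrite -(dint_sym mu mF23 F230) (dintD mu mF2 mF3 F20 F30) F2E F3E.
set a2 := (\int[_]_x _)%E.
have a20 : (0 <= a2)%E.
  by apply: ig_ge0 => x; rewrite mulr_ge0 ?sqr_ge0.
have cc : 0 <= 2 * Cm n sg / r `^ (2 * sg).
  by rewrite divr_ge0 ?powR_ge0// mulr_ge0// Cm_ge0.
rewrite addeACA -ge0_muleDl ?lee_fin// -EFinD.
have -> : (2%:E * D2 = D2 + D2)%E by rewrite (mule_natl D2 2) mule2n.
rewrite (_ : 2 * Cm n sg / r `^ (2 * sg) + _ = 4 * Cm n sg / r `^ (2 * sg))//.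
by ring.
Qed.
End cutoff.

(** * The Kelvin transform *)

Section null_point.
Variables (R : realType) (n : nat).
Hypothesis n0 : (0 < n)%N.
Local Notation E := (n.-tuple R).
Local Notation mu := (mun R n).
Local Notation mfunE u := (measurable_fun [set: E] u).

Local Notation pt0 := [set (0%R : E)].

Lemma measurable_pt0 : measurable pt0.
Proof.
rewrite (_ : pt0 = [set: E] `&` (@vnorm R n) @^-1` [set 0]).
  apply: rm_vnorm => //; exact: measurable_id.
rewrite setTI; apply/seteqP; split=> [x /= ->|x /= /eqP]; first exact: vnorm0.
by rewrite vnorm_eq0 => /eqP.
Qed.

Lemma mun_pt0 : mu pt0 = 0%E.
Proof.
have b0 := bvol_gt0 R n0.
have bound r : 0 < r -> (mu pt0 <= (r ^+ n * bvol R n)%:E)%E.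
  move=> r0; have mi : (\int[mu]_x (\1_pt0 x)%:E = mu pt0)%E.
    by rewrite integral_indic ?setIT//; exact: measurable_pt0.
  rewrite -(mu_ball0 _ r0) -mi; apply: ig_le.
  - by apply: measurable_indic; exact: measurable_pt0.
  - by meas.
  move=> x; rewrite indicE ler0n/= /chi ler_nat.
  by case: (boolP (x \in _)) => [|_]//; rewrite inE/= => ->; rewrite vnorm0 r0.
have := bound 1 ltr01; have : (0 <= mu pt0)%E by [].
case E1 : (mu _) bound => [e| |]// bound; rewrite lee_fin => e0 _.
congr EFin; apply/eqP; rewrite eq_le e0 andbT leNgt; apply/negP => e1.
pose r := Num.min 1 (e / (2 * bvol R n)).
have r0 : 0 < r by rewrite lt_min ltr01 divr_gt0// mulr_gt0.
have r1 : r <= 1 by rewrite ge_min lexx.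
have rn : r ^+ n <= r by rewrite -[leRHS]expr1 ler_wiXn2l// ltW.
have re : r * bvol R n <= e / 2.
  have : r <= e / (2 * bvol R n) by rewrite ge_min lexx orbT.
  rewrite -(ler_pM2r b0) => /le_trans; apply; rewrite le_eqVlt; apply/orP; left.
  by apply/eqP; field; rewrite gt_eqF.
have := bound r r0; rewrite lee_fin; have := ler_wpM2r (ltW b0) rn.
move: re; lra.
Qed.

(** Identities for inversions are spoiled at the origin by division by zero; the origin being a null
    set, they still hold under the integral. *)
Lemma ig_off0 (f g : E -> R) : mfunE f -> mfunE g ->
  (forall x, 0 <= f x) -> (forall x, 0 <= g x) ->
  (forall x, x != 0 -> f x = g x) ->
  (\int[mu]_x (f x)%:E = \int[mu]_x (g x)%:E)%E.
Proof.
move=> mf mg f0 g0 fg; apply: ge0_ae_eq_integral => //.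
- exact: em_EFin.
- exact: em_EFin.
- by move=> x _; rewrite lee_fin.
- by move=> x _; rewrite lee_fin.
- exists [set 0]; split; [exact: measurable_pt0|exact: mun_pt0|].
  move=> x /= H; apply: contrapT => /eqP x0; apply: H => _.
  by rewrite fg.
Qed.

Lemma mun_invR c (g : E -> R) : 0 < c -> mfunE g -> (forall x, 0 <= g x) ->
  (\int[mu]_x (g (vinv c x) * (c / vnorm x ^+ 2) ^+ n)%:E =
   \int[mu]_x (g x)%:E)%E.
Proof.
move=> c0 mg g0.
pose h x := g x * chi R (0 < vnorm x).
have mh : mfunE h by rewrite /h; meas.
have h0 x : 0 <= h x by rewrite mulr_ge0 ?chi_ge0.
have h00 : h 0 = 0 by rewrite /h vnorm0 ltxx mulr0.
rewrite -(@ig_off0 h g)//; last by move=> x; rewrite -vnorm_gt0 /h => ->; rewrite mulr1.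
rewrite -(mun_inv n0 c0 mh h0 h00); apply: eq_integral => x _; congr EFin.
rewrite /h vnorm_vinv//; have [->|x0] := eqVneq x 0.
  by rewrite vnorm0 expr0n/= invr0 mulr0 expr0n gtn_eqF// !mulr0.
have nx : 0 < vnorm x by rewrite vnorm_gt0.
by rewrite divr_gt0// mulr1.
Qed.

End null_point.

Section kelvin.
Variables (R : realType) (n : nat).
Hypothesis n0 : (0 < n)%N.
Variable sg : R.
Hypotheses (sg0 : 0 < sg) (sg1 : sg < 1) (sgn : 2 * sg < n%:R).
Local Notation E := (n.-tuple R).
Local Notation Ker := (@rker R n sg).
Local Notation mfunE u := (measurable_fun [set: E] u).

Let mK : mfunE Ker. Proof. exact: measurable_Ker. Qed.

(** The Riesz potential $|x|^{-(n-2\sigma)}$, up to a constant the fundamental solution of the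
    fractional Laplacian, and the weight of the Kelvin transform. At 0 it takes the value 0. *)
Definition riesz (x : E) : R := (vnorm x `^ (n%:R - 2 * sg))^-1.
Local Notation phi := riesz.

Lemma riesz_ge0 x : 0 <= phi x.
Proof. by rewrite invr_ge0 powR_ge0. Qed.

Lemma riesz0 : phi 0 = 0.
Proof. by rewrite /riesz vnorm0 powR0 ?invr0// gt_eqF// subr_gt0. Qed.

Lemma measurable_riesz : mfunE phi.
Proof. by rewrite /riesz; meas. Qed.

Lemma powR_nB (t : R) : 0 < t -> t `^ (n%:R - 2 * sg) = t ^+ n / t `^ (2 * sg).
Proof.
move=> t0; rewrite powRD ?(gt_eqF t0) ?implybT// powR_mulrn ?ltW//.
by rewrite powRN.
Qed.

Lemma powR_nD (t : R) : 0 < t -> t `^ (n%:R + 2 * sg) = t ^+ n * t `^ (2 * sg).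
Proof.
by move=> t0; rewrite powRD ?(gt_eqF t0) ?implybT// powR_mulrn ?ltW.
Qed.

Lemma powR_div (a b s : R) : 0 < a -> 0 < b -> (a / b) `^ s = a `^ s / b `^ s.
Proof.
move=> a0 b0; apply: (mulIf (x := b `^ s)); first by rewrite gt_eqF// powR_gt0.
rewrite -powRM ?divr_ge0 ?(ltW a0) ?(ltW b0)//.
by rewrite !divfK// gt_eqF// powR_gt0.
Qed.

Lemma Ker_dil (k : R) (z w : E) : 0 < k -> vnorm z = k * vnorm w ->
  Ker z = (k ^+ n * k `^ (2 * sg))^-1 * Ker w.
Proof.
move=> k0 zw; rewrite /rker zw powRM ?(ltW k0) ?vnorm_ge0//.
by rewrite invfM powR_nD.
Qed.

(** Conformal covariance of the kernel: after the Jacobians of the inversion in both variables, only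
    the two Kelvin weights remain. *)
Lemma kelvin_kernel x y : x != 0 -> y != 0 ->
  Ker (vinv 1 x - vinv 1 y) * (1 / vnorm x ^+ 2) ^+ n * (1 / vnorm y ^+ 2) ^+ n =
  phi x * phi y * Ker (x - y).
Proof.
rewrite -!vnorm_gt0 => x0 y0.
have [x1 y1] : x != 0 /\ y != 0 by rewrite -!vnorm_gt0.
rewrite (@Ker_dil (1 / (vnorm x * vnorm y)) _ (x - y)); last 2 first.
- by rewrite divr_gt0// mulr_gt0.
- by rewrite vnorm_vinvB// mul1r div1r mulrC.
rewrite /riesz !powR_nB// powR_div ?mulr_gt0// powR1 powRM ?(ltW x0) ?(ltW y0)//.
rewrite !expr_div_n !expr1n exprMn -!exprM !(mulnC 2) !exprM.
have a1 : vnorm x ^+ n != 0 by rewrite expf_neq0// gt_eqF.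
have a2 : vnorm y ^+ n != 0 by rewrite expf_neq0// gt_eqF.
have a3 : vnorm x `^ (2 * sg) != 0 by rewrite gt_eqF// powR_gt0.
have a4 : vnorm y `^ (2 * sg) != 0 by rewrite gt_eqF// powR_gt0.
move: (vnorm x ^+ n) (vnorm y ^+ n) (vnorm x `^ _) (vnorm y `^ _) (Ker _)
  a1 a2 a3 a4 => a b c d k a1 a2 a3 a4.
by field; rewrite a1 a2 a3 a4.
Qed.

Lemma vinv_fix (x : E) : x != 0 -> vinv (vnorm x ^+ 2) x = x.
Proof.
move=> x0; rewrite /vinv divff ?scale1r//.
by rewrite expf_neq0// vnorm_eq0.
Qed.

Lemma vnorm_reflect (x y : E) : x != 0 -> y != 0 ->
  vnorm (x - vinv (vnorm x ^+ 2) y) = (vnorm x / vnorm y) * vnorm (x - y).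
Proof.
move=> x0 y0; rewrite -{1}[x](vinv_fix x0) vnorm_vinvB ?exprn_gt0 ?vnorm_gt0//.
by field; rewrite !vnorm_eq0 x0 y0.
Qed.

(** The inversion used here is in the sphere through x, so x is fixed; the last factor on the left
    is its Jacobian. This is the pointwise form of the substitution in [reflect_int]. *)
Lemma reflect_kernel x y : x != 0 -> y != 0 ->
  phi (vinv (vnorm x ^+ 2) y) * Ker (x - vinv (vnorm x ^+ 2) y)
    * (vnorm x ^+ 2 / vnorm y ^+ 2) ^+ n = phi x * Ker (x - y).
Proof.
rewrite -!vnorm_gt0 => x0 y0.
have [x1 y1] : x != 0 /\ y != 0 by rewrite -!vnorm_gt0.
rewrite (@Ker_dil (vnorm x / vnorm y) _ (x - y)); last 2 first.
- by rewrite divr_gt0.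
- exact: vnorm_reflect.
rewrite /riesz vnorm_vinv ?exprn_gt0// powR_nB ?divr_gt0 ?exprn_gt0//.
rewrite !powR_div ?exprn_gt0// (powR_nB x0) expr2 powRM ?(ltW x0)// -expr2.
rewrite !expr_div_n -!exprM !(mulnC 2) !exprM.
have a1 : vnorm x ^+ n != 0 by rewrite expf_neq0// gt_eqF.
have a2 : vnorm y ^+ n != 0 by rewrite expf_neq0// gt_eqF.
have a3 : vnorm x `^ (2 * sg) != 0 by rewrite gt_eqF// powR_gt0.
have a4 : vnorm y `^ (2 * sg) != 0 by rewrite gt_eqF// powR_gt0.
move: (vnorm x ^+ n) (vnorm y ^+ n) (vnorm x `^ _) (vnorm y `^ _) (Ker _)
  a1 a2 a3 a4 => a b c d k a1 a2 a3 a4.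
by field; rewrite a1 a2 a3 a4.
Qed.

(* This excision of the diagonal is invariant under the inversion of y in the
   sphere of radius |x|, which makes the potential of [riesz] vanish exactly. *)
Definition offdiag (th : R) (x y : E) : R :=
  chi R (2 * th ^+ 2 * vnorm x * vnorm y <= vnorm (x - y) ^+ 2).

Lemma offdiag_reflect th x y : x != 0 -> y != 0 ->
  offdiag th x (vinv (vnorm x ^+ 2) y) = offdiag th x y.
Proof.
move=> x0 y0; rewrite /offdiag vnorm_reflect// vnorm_vinv ?exprn_gt0 ?vnorm_gt0//.
have nx : 0 < vnorm x by rewrite vnorm_gt0.
have ny : 0 < vnorm y by rewrite vnorm_gt0.
congr (chi R _); rewrite -subr_ge0 -[in RHS]subr_ge0.
have -> : (vnorm x / vnorm y * vnorm (x - y)) ^+ 2 -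
    2 * th ^+ 2 * vnorm x * (vnorm x ^+ 2 / vnorm y) =
  (vnorm x / vnorm y) ^+ 2 *
    (vnorm (x - y) ^+ 2 - 2 * th ^+ 2 * vnorm x * vnorm y).
  by field; rewrite gt_eqF.
by rewrite pmulr_rge0// exprn_gt0// divr_gt0.
Qed.

(** If $|y| \le |x|/2$ then $|x-y| \ge |x|/2$; otherwise the condition defining [offdiag] yields
    $|x-y|^2 \ge \theta^2 |x|^2$. This distance from the diagonal makes the integrals converge
    absolutely. *)
Lemma offdiag_far th x y : 0 < th -> th <= 1 / 2 -> x != 0 ->
  offdiag th x y <= cut (th * vnorm x) (x - y).
Proof.
rewrite -vnorm_gt0 => t0 t1 x0.
rewrite /offdiag /chi; have [H|_] := boolP (_ <= vnorm (x - y) ^+ 2); last by rewrite mulr0n cut_ge0.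
rewrite mulr1n cut_ge ?mulr_gt0//.
have th1 : th * vnorm x <= vnorm x / 2 by nra.
have [xy|xy] := leP (vnorm y) (vnorm x / 2).
  by apply: (le_trans th1); have := vnorm_ler_sub x y; lra.
rewrite -ler_sqr ?nnegrE ?vnorm_ge0 ?mulr_ge0 ?vnorm_ge0 ?(ltW t0)//.
apply: le_trans H; rewrite exprMn.
have -> : 2 * th ^+ 2 * vnorm x * vnorm y = th ^+ 2 * (vnorm x * (2 * vnorm y)).
  by ring.
by rewrite ler_pM2l ?exprn_gt0// expr2 ler_pM2l//; lra.
Qed.

End kelvin.

(** * Monotone limits *)

Section monotone_limit.
Context d (T : measurableType d) (R : realType).
Variable m : {sigma_finite_measure set T -> \bar R}.

(** Monotone convergence for approximations that at each point are eventually equal to their limit.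
    Approximations are chosen below so as to have this form, and then an Archimedean index replaces
    every pointwise limit. *)
Lemma ig_limit (m' : {measure set T -> \bar R}) (F : T -> R) (G : nat -> T -> R)
    (M : \bar R) :
  (forall k, measurable_fun [set: T] (G k)) -> (forall k x, 0 <= G k x) ->
  (forall x, {homo G^~ x : k l / (k <= l)%N >-> k <= l}) ->
  (forall x, exists k, forall l, (k <= l)%N -> G l x = F x) ->
  (forall k, (\int[m']_x (G k x)%:E <= M)%E) ->
  (\int[m']_x (F x)%:E <= M)%E.
Proof.
move=> mG G0 Gnd GF GM.
have E : (fun x => (F x)%:E) = (fun x => limn (fun k => (G k x)%:E)).
  apply/funext => x; apply/esym/cvg_lim => //.
  have [k Hk] := GF x; apply: cvg_near_cst; exists k => // l /= kl.
  by rewrite Hk.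
rewrite E (@monotone_convergence _ _ _ m' setT measurableT (fun k x => (G k x)%:E)).
- apply: lime_le; last by near=> k; exact: GM.
  apply: ereal_nondecreasing_is_cvgn => k l kl.
  apply: ig_le => // x; rewrite G0/=; exact: Gnd.
- by move=> k; exact: em_EFin.
- by move=> k x _; rewrite lee_fin.
- by move=> x _ k l kl; rewrite lee_fin; exact: Gnd.
Unshelve. all: by end_near. Qed.

End monotone_limit.

Lemma dint_limit d (T : measurableType d) (R : realType)
    (m : {sigma_finite_measure set T -> \bar R})
    (F : T -> T -> R) (G : nat -> T -> T -> R) (M : \bar R) :
  mfun2 F -> (forall x y, 0 <= F x y) ->
  (forall k, mfun2 (G k)) -> (forall k x y, 0 <= G k x y) ->
  (forall x y, {homo (fun k => G k x y) : k l / (k <= l)%N >-> k <= l}) ->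
  (forall x y, exists k, forall l, (k <= l)%N -> G l x y = F x y) ->
  (forall k, (dint m (G k) <= M)%E) ->
  (dint m F <= M)%E.
Proof.
move=> mF F0 mG G0 Gnd GF GM.
have dE (H : T -> T -> R) : mfun2 H -> (forall x y, 0 <= H x y) ->
    (dint m H = \int[(m \x m)%E]_p (H p.1 p.2)%:E)%E.
  move=> mH H0.
  rewrite (fubini_tonelli1 (m1 := m) (m2 := m) (fun p => (H p.1 p.2)%:E))//.
  - by apply: em_EFin; exact: mH.
  - by move=> p; rewrite lee_fin.
rewrite dE//.
apply: (@ig_limit _ _ _ _ _ (fun k p => G k p.1 p.2)) => //.
by move=> k; have := GM k; rewrite (dE _ (mG k) (G0 k)).
Qed.

Section kelvin_energy.
Variables (R : realType) (n : nat).
Hypothesis n0 : (0 < n)%N.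
Variable sg : R.
Hypotheses (sg0 : 0 < sg) (sg1 : sg < 1) (sgn : 2 * sg < n%:R).
Local Notation E := (n.-tuple R).
Local Notation mu := (mun R n).
Local Notation Ker := (@rker R n sg).
Local Notation Q := (@quad R n sg).
Local Notation En := (@energy R n sg).
Local Notation phi := (@riesz R n sg).
Local Notation mfunE u := (measurable_fun [set: E] u).

Let mK : mfunE Ker. Proof. exact: measurable_Ker. Qed.
Let mphi : mfunE phi. Proof. exact: measurable_riesz. Qed.

Lemma measurable_offdiag th : mfun2 (@offdiag R n th).
Proof. by rewrite /mfun2 /offdiag; meas. Qed.

Lemma offdiag_sym th (x y : E) : offdiag th x y = offdiag th y x.
Proof. by rewrite /offdiag vnormB mulrAC. Qed.

Lemma offdiag_ge0 th (x y : E) : 0 <= offdiag th x y.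
Proof. exact: chi_ge0. Qed.

Lemma offdiag_le1 th (x y : E) : offdiag th x y <= 1.
Proof. by rewrite /offdiag /chi; case: (_ <= _ ^+ 2); rewrite ?lexx ?ler01. Qed.

Lemma orK_ge0 th (x y : E) : 0 <= offdiag th x y * phi y * Ker (x - y).
Proof.
apply: mulr_ge0; last exact: Ker_ge0.
by apply: mulr_ge0; [exact: offdiag_ge0|exact: riesz_ge0].
Qed.

Lemma roK_ge0 th (x y : E) : 0 <= phi x * (offdiag th x y * Ker (x - y)).
Proof.
apply: mulr_ge0; first exact: riesz_ge0.
by apply: mulr_ge0; [exact: offdiag_ge0|exact: Ker_ge0].
Qed.

Variable u : E -> R.
Hypothesis mu_ : mfunE u.

Definition kelvin (x : E) : R := phi x * u (vinv 1 x).
Local Notation w x := (u (vinv 1 x)).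

Lemma measurable_kelvin : mfunE kelvin.
Proof. by rewrite /kelvin; meas. Qed.

(** The left side is the main term of the ground state representation of the energy of [kelvin]. The
    inversion is carried out in one variable at a time, and [kelvin_kernel] turns the Jacobians into
    weights. *)
Lemma kelvin_dint :
  dint mu (fun x y => phi x * phi y * (w x - w y) ^+ 2 * Ker (x - y)) = En u.
Proof.
have mQu := mQ sg mu_.
pose J (x : E) : R := (1 / vnorm x ^+ 2) ^+ n.
have mJ : mfunE J by rewrite /J; meas.
have J0 x : 0 <= J x by rewrite exprn_ge0// divr_ge0// exprn_ge0// vnorm_ge0.
have J00 : J 0 = 0 by rewrite /J vnorm0 expr0n/= invr0 mulr0 expr0n gtn_eqF.
pose F1 x y := Q u x (vinv 1 y) * J y.
have mF1 : mfun2 F1.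
  apply: mfun2M; last by apply: (mcomp mJ).
  apply: (mcomp mQu (f := fun p => (p.1, vinv 1 p.2))).
  by apply: measurable_fun_pair; meas.
have F10 x y : 0 <= F1 x y by rewrite mulr_ge0 ?Q_ge0.
transitivity (dint mu F1); last first.
  apply: eq_integral => x _; rewrite /F1 /J mun_invR//.
    by apply: mfun2_r.
  by move=> y; exact: Q_ge0.
rewrite (dint_sym mu mF1 F10).
have mF1s := mfun2_swap mF1.
pose F2 y x := F1 (vinv 1 x) y * J x.
have mF2 : mfun2 F2.
  apply: mfun2M; last by apply: (mcomp mJ).
  apply: (mcomp mF1s (f := fun p => (p.1, vinv 1 p.2))).
  by apply: measurable_fun_pair; meas.
have F20 x y : 0 <= F2 x y by rewrite mulr_ge0.
transitivity (dint mu F2); last first.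
  apply: eq_integral => y _; rewrite /F2 /J (mun_invR n0 (g := fun x => F1 x y))//.
  exact: (mfun2_r y mF1s).
rewrite (dint_sym mu mF2 F20); apply: eq_dint => x y.
rewrite /F2 /F1.
have [->|x0] := eqVneq x 0; first by rewrite J00 (riesz0 sgn) !mul0r mulr0.
have [->|y0] := eqVneq y 0; first by rewrite J00 (riesz0 sgn) !(mul0r, mulr0).
have := kelvin_kernel sg x0 y0; rewrite /quad /J.
set k2 := Ker (x - y); set k1 := Ker (vinv 1 x - _).
set j1 := (1 / vnorm x ^+ 2) ^+ n; set j2 := (1 / vnorm y ^+ 2) ^+ n.
set p1 := phi x; set p2 := phi y; set d := (u _ - _) ^+ 2 => H.
have -> : p1 * p2 * d * k2 = d * (p1 * p2 * k2) by ring.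
by rewrite -H; ring.
Qed.

(** Substitute for y its inversion in the sphere through x, which preserves [offdiag]. Formally, the
    principal value of the integral of $(\phi(x) - \phi(y))$ against the kernel is zero: [riesz] is
    harmonic for the fractional Laplacian off the origin. *)
Lemma reflect_int th x : x != 0 ->
  (\int[mu]_y (offdiag th x y * phi y * Ker (x - y))%:E =
   \int[mu]_y (phi x * (offdiag th x y * Ker (x - y)))%:E)%E.
Proof.
move=> x0.
have mo : mfunE (offdiag th x) by apply: mfun2_r; exact: measurable_offdiag.
have mKx : mfunE (fun y => Ker (x - y)) by exact: mfun_sub.
pose g y := offdiag th x y * phi y * Ker (x - y).
have mg : mfunE g by rewrite /g; meas.
have g0 y : 0 <= g y by exact: orK_ge0.
have c0 : 0 < vnorm x ^+ 2 by rewrite exprn_gt0// vnorm_gt0.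
rewrite -(mun_invR n0 c0 mg g0); apply: (ig_off0 n0).
- apply: rmM; last by meas.
  by apply: (mcomp mg); meas.
- by meas.
- by move=> y; rewrite mulr_ge0// exprn_ge0// divr_ge0 ?exprn_ge0 ?vnorm_ge0.
- by move=> y; exact: roK_ge0.
move=> y y0; rewrite /g offdiag_reflect// [RHS]mulrCA.
by rewrite -(reflect_kernel sg x0 y0) !mulrA.
Qed.

Lemma riesz_pt x : x != 0 -> phi x = vnorm x `^ (2 * sg) / vnorm x ^+ n.
Proof. by rewrite -vnorm_gt0 => x0; rewrite /riesz powR_nB// invf_div. Qed.

Lemma inv_pt (x : E) : (1 / vnorm x ^+ 2) ^+ n = (vnorm x ^+ n)^-1 ^+ 2.
Proof. by rewrite div1r exprVn -exprM mulnC exprM exprVn. Qed.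

Lemma kelvin_int1 :
  (\int[mu]_x (kelvin x ^+ 2 / vnorm x `^ (2 * sg))%:E =
   \int[mu]_x (u x ^+ 2 / vnorm x `^ (2 * sg))%:E)%E.
Proof.
rewrite -(mun_invR n0 (g := fun x => u x ^+ 2 / vnorm x `^ (2 * sg)) ltr01); last 2 first.
- by meas.
- by move=> x; rewrite divr_ge0 ?sqr_ge0 ?powR_ge0.
apply: eq_integral => x _; congr EFin; rewrite inv_pt /kelvin.
have [->|x0] := eqVneq x 0.
  by rewrite vnorm0 (riesz0 sgn) (expr0n _ n) gtn_eqF// invr0 !(expr0n, mul0r, mulr0).
have nx : 0 < vnorm x by rewrite vnorm_gt0.
rewrite riesz_pt// vnorm_vinv// powR_div// powR1 div1r invrK.
have a1 : vnorm x ^+ n != 0 by rewrite expf_neq0// gt_eqF.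
have a3 : vnorm x `^ (2 * sg) != 0 by rewrite gt_eqF// powR_gt0.
move: (vnorm x ^+ n) (vnorm x `^ _) (u _) a1 a3 => a b c a1 a3.
by field; rewrite a1 a3.
Qed.

(** The gain in the half-space multiplies the $L^2$ norm of the transform; this is where the weight
    $|x|^{-4\sigma}$ comes from. *)
Lemma kelvin_int2 :
  (\int[mu]_x (kelvin x ^+ 2)%:E =
   \int[mu]_x (u x ^+ 2 / (vnorm x `^ (2 * sg)) ^+ 2)%:E)%E.
Proof.
rewrite -(mun_invR n0 (g := fun x => u x ^+ 2 / (vnorm x `^ (2 * sg)) ^+ 2) ltr01); last 2 first.
- by meas.
- by move=> x; rewrite divr_ge0 ?sqr_ge0.
apply: eq_integral => x _; congr EFin; rewrite inv_pt /kelvin.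
have [->|x0] := eqVneq x 0.
  by rewrite vnorm0 (riesz0 sgn) (expr0n _ n) gtn_eqF// invr0 !(expr0n, mul0r, mulr0).
have nx : 0 < vnorm x by rewrite vnorm_gt0.
rewrite riesz_pt// vnorm_vinv// powR_div// powR1 div1r.
have a1 : vnorm x ^+ n != 0 by rewrite expf_neq0// gt_eqF.
have a3 : vnorm x `^ (2 * sg) != 0 by rewrite gt_eqF// powR_gt0.
move: (vnorm x ^+ n) (vnorm x `^ _) (u _) a1 a3 => a b c a1 a3.
by field; rewrite ?a1 ?a3.
Qed.

(** Since $p(n - 2\sigma) = 2n$, the p-th power of the weight is the Jacobian of the inversion. *)
Lemma kelvin_intp :
  (\int[mu]_x (`|kelvin x| `^ pexp n sg)%:E =
   \int[mu]_x (`|u x| `^ pexp n sg)%:E)%E.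
Proof.
have p0 := pexp_gt0 sg0 sgn.
rewrite -(mun_invR n0 (g := fun x => `|u x| `^ pexp n sg) ltr01); last 2 first.
- by meas.
- by move=> x; exact: powR_ge0.
apply: eq_integral => x _; congr EFin; rewrite inv_pt /kelvin.
have [->|x0] := eqVneq x 0.
  rewrite vnorm0 (riesz0 sgn) (expr0n _ n) gtn_eqF// invr0 mul0r normr0.
  by rewrite powR0 ?gt_eqF// expr0n mulr0.
have nx : 0 < vnorm x by rewrite vnorm_gt0.
rewrite normrM (ger0_norm (riesz_ge0 _ _)) powRM ?riesz_ge0// mulrC.
congr (_ * _); rewrite /riesz -powRN -powRrM.
rewrite (_ : _ * _ = - (n%:R + n%:R)); last first.
  by rewrite /pexp; field; rewrite subr_eq0 gt_eqF.
rewrite powRN powRD ?(gt_eqF nx) ?implybT// powR_mulrn ?ltW//.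
by rewrite -expr2 exprVn.
Qed.

Variable r : R.
Hypothesis r0 : 0 < r.
Hypothesis ur : forall x, vnorm x < r -> u x = 0.
Hypothesis u2 : (\int[mu]_x (u x ^+ 2)%:E < +oo)%E.

Lemma kelvin_supp x : kelvin x != 0 -> vnorm x <= 1 / r.
Proof.
move=> kx; have x0 : x != 0.
  by apply: contraNneq kx => ->; rewrite /kelvin (riesz0 sgn) mul0r.
have nx : 0 < vnorm x by rewrite vnorm_gt0.
rewrite leNgt; apply/negP => H; case/negP: kx.
rewrite /kelvin ur ?mulr0// vnorm_vinv// ltr_pdivrMr// mulrC.
by move: H; rewrite ltr_pdivrMr.
Qed.

(** By [kelvin_int1] the integral equals that of u, which vanishes near the singularity of the
    weight and is square integrable. *)
Lemma kelvin_hardy : (\int[mu]_x (kelvin x ^+ 2 / vnorm x `^ (2 * sg))%:E < +oo)%E.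
Proof.
rewrite kelvin_int1.
apply: (@le_lt_trans _ _ (\int[mu]_x ((r `^ (2 * sg))^-1 * u x ^+ 2)%:E)%E).
  apply: ig_le; [by meas|by meas|] => x.
  rewrite divr_ge0 ?sqr_ge0 ?powR_ge0//= mulrC.
  have [xr|xr] := ltP (vnorm x) r; first by rewrite ur// expr0n !mulr0.
  have x0 : 0 < vnorm x by exact: lt_le_trans xr.
  rewrite ler_wpM2r ?sqr_ge0// lef_pV2 ?posrE ?powR_gt0//.
  apply: ge0_ler_powR => //; rewrite ?nnegrE ?(ltW r0) ?(ltW x0)//.
  by rewrite mulr_ge0 ?(ltW sg0).
rewrite igZ ?invr_ge0 ?powR_ge0//; last 2 first.
- by meas.
- by move=> x; exact: sqr_ge0.
by rewrite lte_mul_pinfty// lee_fin invr_ge0 powR_ge0.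
Qed.

(** Ground state representation: $(\phi w(x) - \phi w(y))^2 = \phi(x)\phi(y)(w(x)-w(y))^2 +
    \phi(x)w(x)^2(\phi(x)-\phi(y)) + \phi(y)w(y)^2(\phi(y)-\phi(x))$. Against the excised kernel the
    last two terms integrate to zero by [reflect_int], and the first gives at most the energy of u
    by [kelvin_dint]. *)
Lemma kelvin_trunc th : 0 < th -> th <= 1 / 2 ->
  (dint mu (fun x y => offdiag th x y * Q kelvin x y)%R <= En u)%E.
Proof.
move=> t0 t1.
have mo := measurable_offdiag th.
have mk := measurable_kelvin.
have mQk := mQ sg mk.
have mKd : mfun2 (fun x y : E => Ker (x - y)) by rewrite /mfun2; meas.
have mw : mfunE (fun x => w x) by meas.
pose F1 (x y : E) := offdiag th x y * Q kelvin x y.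
pose F2 (x y : E) := phi x * w x ^+ 2 * (offdiag th x y * phi y * Ker (x - y)).
pose F3 (x y : E) := offdiag th x y * (phi x * phi y * (w x - w y) ^+ 2 * Ker (x - y)).
pose F4 (x y : E) := phi x * w x ^+ 2 * (phi x * (offdiag th x y * Ker (x - y))).
pose G3 (x y : E) := phi x * phi y * (w x - w y) ^+ 2 * Ker (x - y).
have mG3 : mfun2 G3 by rewrite /mfun2 /G3; meas.
have G30 x y : 0 <= G3 x y.
  apply: mulr_ge0; last exact: Ker_ge0.
  apply: mulr_ge0; last exact: sqr_ge0.
  by apply: mulr_ge0; exact: riesz_ge0.
have mF1 : mfun2 F1 by exact: mfun2M.
have mF2 : mfun2 F2.
  apply: mfun2M; first by apply: mfun2_1; meas.
  apply: mfun2M; last exact: mKd.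
  exact: mfun2M mo (mfun2_swap (mfun2_1 mphi)).
have mF3 : mfun2 F3 by exact: mfun2M.
have mF4 : mfun2 F4.
  apply: mfun2M; first by apply: mfun2_1; meas.
  apply: mfun2M; first exact: mfun2_1.
  exact: mfun2M.
have F10 x y : 0 <= F1 x y.
  by apply: mulr_ge0; [exact: offdiag_ge0|exact: Q_ge0].
have F20 x y : 0 <= F2 x y.
  apply: mulr_ge0; first by apply: mulr_ge0; [exact: riesz_ge0|exact: sqr_ge0].
  exact: orK_ge0.
have F30 x y : 0 <= F3 x y.
  by apply: mulr_ge0; [exact: offdiag_ge0|exact: G30].
have F40 x y : 0 <= F4 x y.
  apply: mulr_ge0; first by apply: mulr_ge0; [exact: riesz_ge0|exact: sqr_ge0].
  exact: roK_ge0.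
(* The negative terms are moved to the other side, so that only nonnegative integrands occur. *)
have ident x y : F1 x y + (F2 x y + F2 y x) = F3 x y + (F4 x y + F4 y x).
  rewrite /F1 /F2 /F3 /F4 /quad /kelvin (offdiag_sym th y x) (KerB sg y x).
  by move: (offdiag _ _ _) (phi x) (phi y) (w x) (w y) (Ker _) => a b c d e f; ring.
have F24 : dint mu F2 = dint mu F4.
  apply: eq_integral => x _.
  have [->|x0] := eqVneq x 0.
    by apply: eq_integral => y _; rewrite /F2 /F4 (riesz0 sgn) !mul0r.
  have mox : mfunE (offdiag th x) by exact: mfun2_r.
  have mKx : mfunE (fun y => Ker (x - y)) by exact: mfun_sub.
  rewrite /F2 /F4 igZ; last 3 first.
  - by rewrite mulr_ge0 ?riesz_ge0 ?sqr_ge0.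
  - by meas.
  - by move=> y; exact: orK_ge0.
  rewrite (reflect_int th x0) -igZ.
  - by [].
  - by rewrite mulr_ge0 ?riesz_ge0 ?sqr_ge0.
  - by meas.
  - by move=> y; exact: roK_ge0.
(* Equal terms can be cancelled only if they are finite. By [offdiag_far] the inner integral is at
   most a constant times $(\theta |x|)^{-2\sigma}$, which leaves the integral of [kelvin_hardy]. *)
have F4fin : (dint mu F4 < +oo)%E.
  pose c := Cm n sg / th `^ (2 * sg).
  have c0 : 0 <= c by rewrite divr_ge0 ?powR_ge0// Cm_ge0.
  apply: (@le_lt_trans _ _
    (\int[mu]_x (c * (kelvin x ^+ 2 / vnorm x `^ (2 * sg)))%:E)%E).
    apply: eg_le.
    - exact: measurable_inner.
    - by apply: em_EFin; meas.
    - by move=> x; apply: ig_ge0.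
    move=> x; have [->|x0] := eqVneq x 0.
      rewrite (eq_integral (fun=> 0%E)) ?integral0; last first.
        by move=> y _; rewrite /F4 (riesz0 sgn) !mul0r.
      by rewrite lee_fin mulr_ge0// divr_ge0 ?sqr_ge0 ?powR_ge0.
    have nx : 0 < vnorm x by rewrite vnorm_gt0.
    have mox : mfunE (offdiag th x) by exact: mfun2_r.
    have mKx : mfunE (fun y => Ker (x - y)) by exact: mfun_sub.
    have mcx : mfunE (@cut R n (th * vnorm x)) by exact: measurable_cut.
    have tx : 0 < th * vnorm x by exact: mulr_gt0.
    apply: (@le_trans _ _ (\int[mu]_y
       (kelvin x ^+ 2 * (cut (th * vnorm x) (x - y) * Ker (x - y)))%:E)%E).
      apply: ig_le.
      - exact: (mfun2_r x mF4).
      - by meas.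
      move=> y; rewrite F40/= /F4 /kelvin.
      have -> : phi x * w x ^+ 2 * (phi x * (offdiag th x y * Ker (x - y))) =
        (phi x * w x) ^+ 2 * (offdiag th x y * Ker (x - y)) by ring.
      rewrite ler_wpM2l ?sqr_ge0// ler_wpM2r ?Ker_ge0//.
      exact: offdiag_far.
    have mcK : mfunE (fun z => cut (th * vnorm x) z * Ker z).
      by meas.
    have cK0 (z : E) : 0 <= cut (th * vnorm x) z * Ker z.
      by rewrite mulr_ge0 ?cut_ge0 ?Ker_ge0.
    rewrite (igZ mu (sqr_ge0 (kelvin x)) (mfun_sub x mcK) (fun y => cK0 _)).
    rewrite (mun_sub x mcK cK0) cut_Ker// -EFinM lee_fin /c powRM ?(ltW t0) ?(ltW nx)//.
    rewrite le_eqVlt; apply/orP; left; apply/eqP.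
    have a1 : th `^ (2 * sg) != 0 by rewrite gt_eqF// powR_gt0.
    have a2 : vnorm x `^ (2 * sg) != 0 by rewrite gt_eqF// powR_gt0.
    by field; rewrite a1 a2.
  have mH : mfunE (fun x => kelvin x ^+ 2 / vnorm x `^ (2 * sg)) by meas.
  have H0 x : 0 <= kelvin x ^+ 2 / vnorm x `^ (2 * sg).
    by rewrite divr_ge0 ?sqr_ge0 ?powR_ge0.
  rewrite (igZ mu c0 mH H0).
  by rewrite lte_mul_pinfty// kelvin_hardy.
have F3le : (dint mu F3 <= En u)%E.
  rewrite -kelvin_dint; apply: dint_le => // x y; rewrite F30/= /F3.
  by rewrite ler_piMl ?offdiag_le1 ?G30.
apply: le_trans F3le; rewrite -/F1; move: ident F24 F4fin; clearbody F1 F2 F3 F4.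
move=> ident F24 F4fin.
have D1 : (dint mu F1 + (dint mu F2 + dint mu F2) =
    dint mu (fun x y => F1 x y + (F2 x y + F2 y x))%R)%E.
  have mS := mfun2D mF2 (mfun2_swap mF2).
  rewrite (dintD mu mF1 mS F10 (fun x y => addr_ge0 (F20 x y) (F20 y x))).
  rewrite (dintD mu mF2 (mfun2_swap mF2) F20 (fun x y => F20 y x)).
  by rewrite [in RHS](dint_sym mu (mfun2_swap mF2) (fun x y => F20 y x)).
have D2 : (dint mu F3 + (dint mu F4 + dint mu F4) =
    dint mu (fun x y => F3 x y + (F4 x y + F4 y x))%R)%E.
  have mS := mfun2D mF4 (mfun2_swap mF4).
  rewrite (dintD mu mF3 mS F30 (fun x y => addr_ge0 (F40 x y) (F40 y x))).
  rewrite (dintD mu mF4 (mfun2_swap mF4) F40 (fun x y => F40 y x)).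
  by rewrite [in RHS](dint_sym mu (mfun2_swap mF4) (fun x y => F40 y x)).
move: D1; rewrite (eq_dint mu ident) -D2 F24.
have [d dE] : exists d, (dint mu F4 = d%:E)%E.
  exists (fine (dint mu F4)); rewrite fineK// ge0_fin_numE//.
  exact: dint_ge0.
rewrite dE -EFinD => H.
by rewrite -(@leeD2rE _ (d + d)%:E)// H.
Qed.

Lemma kelvin_energy : (En kelvin <= En u)%E.
Proof.
have mk := measurable_kelvin.
have mQk := mQ sg mk.
(* Starting at 1/2, the largest value that [offdiag_far] admits. *)
pose th (k : nat) : R := k.+2%:R^-1.
have th0 k : 0 < th k by rewrite invr_gt0 ltr0n.
apply: (@dint_limit _ _ _ mu _ (fun k x y => offdiag (th k) x y * Q kelvin x y)) => //.
- by move=> x y; exact: Q_ge0.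
- by move=> k; apply: mfun2M => //; exact: measurable_offdiag.
- by move=> k x y; rewrite mulr_ge0 ?offdiag_ge0 ?Q_ge0.
- move=> x y k l kl; apply: ler_wpM2r; first exact: Q_ge0.
  apply: chi_le => H; apply: le_trans H.
  apply: ler_wpM2r; first exact: vnorm_ge0.
  apply: ler_wpM2r; first exact: vnorm_ge0.
  rewrite ler_pM2l// ler_sqr ?nnegrE ?(ltW (th0 _))// lef_pV2 ?posrE ?ltr0n//.
  by rewrite ler_nat.
- move=> x y; have [->|xy] := eqVneq x y.
    by exists 0%N => l _; rewrite /quad subrr expr0n/= mul0r mulr0.
  have d0 : 0 < vnorm (x - y) by rewrite vnorm_gt0 subr_eq0.
  (* The pair (x, y) is kept by [offdiag] as soon as $q \le (l+2)^2$, and $q \le l + 2$ is enough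
     for that. *)
  pose q := (2 * vnorm x * vnorm y) / vnorm (x - y) ^+ 2.
  exists (Num.bound q) => l kl; rewrite /offdiag.
  suff -> : 2 * th l ^+ 2 * vnorm x * vnorm y <= vnorm (x - y) ^+ 2.
    by rewrite /chi mul1r.
  have q0 : 0 <= q by rewrite divr_ge0 ?sqr_ge0// !mulr_ge0 ?vnorm_ge0.
  have ql : q <= l.+2%:R ^+ 2.
    apply: (@le_trans _ _ l.+2%:R).
      apply: ltW; apply: (lt_le_trans (archi_boundP q0)).
      by rewrite ler_nat (leq_trans kl)// -addn2 leq_addr.
    by rewrite expr2 ler_peMr ?ler0n// ler1n.
  have -> : 2 * th l ^+ 2 * vnorm x * vnorm y =
      (q * vnorm (x - y) ^+ 2) / l.+2%:R ^+ 2.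
    have N0 : (l.+2%:R : R) != 0 by rewrite pnatr_eq0.
    rewrite /q /th; move: (l.+2%:R : R) N0 => N N0.
    by field; rewrite N0 gt_eqF.
  rewrite ler_pdivrMr ?exprn_gt0 ?ltr0n// mulrC.
  by apply: ler_wpM2l => //; exact: sqr_ge0.
- move=> k; apply: kelvin_trunc => //.
  by rewrite div1r /th lef_pV2 ?posrE ?ltr0n// ler_nat.
Qed.

End kelvin_energy.

(** * Half-spaces *)

Section half_space.
Variables (R : realType) (n : nat).
Hypothesis n0 : (0 < n)%N.
Variable sg : R.
Hypotheses (sg0 : 0 < sg) (sg1 : sg < 1) (sgn : 2 * sg < n%:R).
Local Notation E := (n.-tuple R).
Local Notation mu := (mun R n).
Local Notation Ker := (@rker R n sg).
Local Notation Q := (@quad R n sg).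
Local Notation En := (@energy R n sg).
Local Notation mfunE u := (measurable_fun [set: E] u).

Let mK : mfunE Ker. Proof. exact: measurable_Ker. Qed.

Fact last_lt : (n.-1 < n)%N. Proof. by rewrite prednK. Qed.
Definition olast : 'I_n := Ordinal last_lt.
Definition lastc (x : E) : R := tnth x olast.

Lemma lastcE (x : E) : nth 0 (tval x) n.-1 = lastc x.
Proof. by rewrite /lastc (tnth_nth 0). Qed.

Lemma lastcD x y : lastc (x + y) = lastc x + lastc y.
Proof. exact: tnthD. Qed.

Lemma lastcB x y : lastc (x - y) = lastc x - lastc y.
Proof. exact: tnthB. Qed.

Lemma lastc_norm x : `|lastc x| <= vnorm x.
Proof. exact: tnth_le_vnorm. Qed.

Lemma measurable_lastc : mfunE lastc.
Proof. by rewrite /lastc; meas. Qed.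

Definition evec : E := [tuple (i == olast)%:R | i < n].

Lemma lastc_evec c : lastc (c *: evec) = c.
Proof. by rewrite /lastc tnthZ tnth_mktuple eqxx mulr1. Qed.

Lemma vnorm_evec : vnorm evec = 1.
Proof.
rewrite /vnorm /vdot (bigD1 olast)//= big1 ?addr0 ?tnth_mktuple ?eqxx ?mulr1 ?sqrtr1//.
by move=> i /negbTE il; rewrite tnth_mktuple il mul0r.
Qed.

Definition half (t : R) (x : E) : R := chi R (t < lastc x).

Lemma half_ge0 t x : 0 <= half t x. Proof. exact: chi_ge0. Qed.

Lemma measurable_half t : mfunE (half t).
Proof. by have := measurable_lastc; rewrite /half => ?; meas. Qed.

Definition energyH (t : R) (u : E -> R) : \bar R :=
  dint mu (fun x y => half t x * half t y * Q u x y).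

Lemma mfun2_half t : mfun2 (fun x y => half t x * half t y).
Proof.
apply: mfun2M; first exact: mfun2_1 (measurable_half t).
exact: mfun2_swap (mfun2_1 (measurable_half t)).
Qed.

Lemma half2_ge0 t x y : 0 <= half t x * half t y.
Proof. by apply: mulr_ge0; exact: half_ge0. Qed.

Lemma mHQ t u : mfunE u -> mfun2 (fun x y => half t x * half t y * Q u x y).
Proof. by move=> mu_; apply: mfun2M; [exact: mfun2_half|exact: mQ]. Qed.

Lemma HQ_ge0 t u x y : 0 <= half t x * half t y * Q u x y.
Proof. by apply: mulr_ge0; [exact: half2_ge0|exact: Q_ge0]. Qed.

(** The 6 bounds distances between the balls of radius $\rho$ about $2\rho e_n$ and $-2\rho e_n$:
    $\rho + 4\rho + \rho$. *)
Definition cpot : R := bvol R n / 6 `^ (n%:R + 2 * sg).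

Lemma cpot_gt0 : 0 < cpot.
Proof. by rewrite divr_gt0 ?powR_gt0// bvol_gt0. Qed.

(* The gain comes from the pairs (x, y) with y in the ball of radius rho around
   the reflected centre -(2 rho) e_n, which misses the half-space. *)
Lemma potential_gain (w : E -> R) (rho : R) : 0 < rho -> mfunE w ->
  (forall x, w x != 0 -> vnorm (x - (2 * rho) *: evec) <= rho) ->
  (energyH (- rho) w + (cpot / rho `^ (2 * sg))%:E * \int[mu]_x (w x ^+ 2)%:E
     <= En w)%E.
Proof.
move=> r0 mw ws.
pose b' : E := (- (2 * rho)) *: evec.
have mh := measurable_half (- rho).
pose G (x y : E) := w x ^+ 2 * (chi R (vnorm (y - b') < rho) * Ker (x - y)).
have mG : mfun2 G.
  apply: mfun2M; first by apply: mfun2_1; meas.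
  by apply: mfun2M; rewrite /mfun2; meas.
have G0 x y : 0 <= G x y.
  apply: mulr_ge0; first exact: sqr_ge0.
  by apply: mulr_ge0; [exact: chi_ge0|exact: Ker_ge0].
have supp_half x : w x != 0 -> - rho < lastc x.
  move=> /ws H; have := le_trans (lastc_norm _) H.
  rewrite lastcB lastc_evec ler_norml => /andP[H1 _]; lra.
have out_half y : vnorm (y - b') < rho -> lastc y < - rho.
  move=> /(le_lt_trans (lastc_norm _)).
  rewrite lastcB lastc_evec ltr_norml => /andP[_ H1]; lra.
have Gle : ((cpot / rho `^ (2 * sg))%:E * \int[mu]_x (w x ^+ 2)%:E
    <= dint mu G)%E.
  have c0 : 0 <= cpot / rho `^ (2 * sg).
    by rewrite divr_ge0 ?powR_ge0// ltW// cpot_gt0.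
  rewrite -igZ//; [|by meas|by move=> x; exact: sqr_ge0].
  apply: eg_le.
  - by apply: em_EFin; meas.
  - exact: measurable_inner.
  - by move=> x; rewrite lee_fin mulr_ge0// sqr_ge0.
  move=> x; have [wx|wx] := eqVneq (w x) 0.
    by rewrite wx expr0n mulr0; apply: ig_ge0 => y.
  pose k : R := w x ^+ 2 / (6 * rho) `^ (n%:R + 2 * sg).
  have k0 : 0 <= k by rewrite divr_ge0 ?sqr_ge0 ?powR_ge0.
  apply: (@le_trans _ _ (\int[mu]_y (k * chi R (vnorm (y - b') < rho))%:E)%E).
    rewrite (igZ mu k0 (measurable_ball b' rho) (fun y => chi_ge0 _ _)).
    rewrite mu_ball// -EFinM lee_fin /k /cpot powRM ?(ltW r0)// (powR_nD n sg r0).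
    rewrite le_eqVlt; apply/orP; left; apply/eqP.
    have a1 : rho ^+ n != 0 by rewrite expf_neq0// gt_eqF.
    have a2 : rho `^ (2 * sg) != 0 by rewrite gt_eqF// powR_gt0.
    have a3 : 6 `^ (n%:R + 2 * sg) != 0 :> R by rewrite gt_eqF// powR_gt0.
    move: (rho ^+ n) (rho `^ _) (6 `^ _ : R) (bvol _ _) (w x) a1 a2 a3.
    by move=> A B C D F a1 a2 a3; field; rewrite a1 a2 a3.
  apply: ig_le.
  - by meas.
  - exact: (mfun2_r x mG).
  move=> y; rewrite mulr_ge0 ?chi_ge0//= /G.
  have [yb|_] := boolP (vnorm (y - b') < rho); last by rewrite /chi mul0r !mulr0.
  rewrite /chi mulr1 mul1r; apply: ler_wpM2l; first exact: sqr_ge0.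
  have xy : x != y.
    apply/eqP => xy; have := supp_half x wx; have := out_half y yb.
    rewrite xy; lra.
  have xy0 : 0 < vnorm (x - y) by rewrite vnorm_gt0 subr_eq0.
  rewrite /rker lef_pV2 ?posrE ?powR_gt0 ?mulr_gt0//.
  apply: ge0_ler_powR; rewrite ?nnegrE ?vnorm_ge0//.
  - by apply: addr_ge0 => //; apply: mulr_ge0 => //; exact: ltW.
  - by rewrite mulr_ge0// ltW.
  have h1 := vnorm_tri x ((2 * rho) *: evec) y.
  have h2 := vnorm_tri ((2 * rho) *: evec) b' y.
  have h3 : vnorm ((2 * rho) *: evec - b') = 4 * rho.
    rewrite /b' scaleNr opprK -scalerDl vnormZ vnorm_evec mulr1 ger0_norm; lra.
  have := ws x wx; move: yb h1 h2; rewrite (vnormB y) h3; lra.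
apply: (le_trans (leeD2l _ Gle)).
rewrite -(dintD mu (mHQ (- rho) mw) mG (HQ_ge0 (- rho) w) G0).
apply: dint_le.
- by apply: mfun2D; [exact: mHQ|].
- exact: mQ.
move=> x y; rewrite addr_ge0 ?HQ_ge0//=.
have h1 t z : half t z <= 1 by rewrite /half /chi; case: (_ < _); rewrite ?lexx ?ler01.
have [wx|wx] := eqVneq (w x) 0.
  rewrite /G wx expr0n mul0r addr0; apply: ler_piMl; first exact: Q_ge0.
  by apply: mulr_ile1; rewrite ?half_ge0 ?h1.
rewrite /G; have [yb|_] := boolP (vnorm (y - b') < rho); last first.
  rewrite /chi mul0r mulr0 addr0; apply: ler_piMl; first exact: Q_ge0.
  by apply: mulr_ile1; rewrite ?half_ge0 ?h1.
have ly := out_half y yb.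
have wy : w y = 0.
  apply/eqP/contraT => /supp_half; lra.
have -> : half (- rho) y = 0.
  by rewrite /half /chi ltNge ltW.
by rewrite mulr0 mul0r add0r /chi mul1r /quad wy subr0.
Qed.

Lemma dint_shift (F : E -> E -> R) a : mfun2 F -> (forall x y, 0 <= F x y) ->
  dint mu (fun x y => F (x + a) (y + a)) = dint mu F.
Proof.
move=> mF F0; rewrite /dint.
rewrite -(mun_shift a (f := fun x => (\int[mu]_y (F x y)%:E)%E)); last 2 first.
- exact: measurable_inner.
- by move=> x; exact: ig_ge0.
apply: eq_integral => x _.
by apply: mun_shiftR; [exact: mfun2_r|exact: F0].
Qed.

Lemma energy_shift (u : E -> R) a : mfunE u -> En (fun x => u (x + a)) = En u.
Proof.
move=> mu_; rewrite /energy -(dint_shift a (mQ sg mu_)); last first.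
  by move=> x y; exact: Q_ge0.
by apply: eq_dint => x y; rewrite /quad opprD addrACA subrr addr0.
Qed.

Lemma dint_dil (F : E -> E -> R) c : 0 < c -> mfun2 F -> (forall x y, 0 <= F x y) ->
  dint mu (fun x y => F (c *: x) (c *: y)) = (((c ^- n) ^+ 2)%:E * dint mu F)%E.
Proof.
move=> c0 mF F0; rewrite /dint.
have cn : 0 <= c ^- n by rewrite invr_ge0 exprn_ge0// ltW.
rewrite expr2 EFinM -muleA.
rewrite -(mun_scale (c := c) c0 (f := fun x => (\int[mu]_y (F x y)%:E)%E)); last 2 first.
- exact: measurable_inner.
- by move=> x; exact: ig_ge0.
have mI : mfunE (fun x => \int[mu]_y (F (c *: x)%R y)%:E)%E.
  apply: (mcomp (f := fun x : E => c *: x) (measurable_inner mu mF F0)).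
  by meas.
rewrite -ge0_integralZl//; last by move=> x _; exact: ig_ge0.
apply: eq_integral => x _.
by apply: mun_scaleR => //; exact: mfun2_r.
Qed.

Lemma energy_dil (u : E -> R) (c : R) : 0 < c -> mfunE u ->
  En (fun x => u (c *: x)) = (((c ^+ n)^-1 * c `^ (2 * sg))%:E * En u)%E.
Proof.
move=> c0 mu_.
have cs : 0 < c `^ (2 * sg) by exact: powR_gt0.
have cn : 0 < c ^+ n by exact: exprn_gt0.
transitivity (dint mu (fun x y : E => (c ^+ n * c `^ (2 * sg)) * Q u (c *: x) (c *: y))).
  apply: eq_dint => x y; rewrite /quad -scalerBr (KerZ _ _ c0) (powR_nD n sg c0).
  rewrite mulrCA; congr (_ * _); rewrite mulrA mulfV ?mul1r// gt_eqF//.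
  exact: mulr_gt0.
have mQu := mQ sg mu_.
have mQc : mfun2 (fun x y : E => Q u (c *: x) (c *: y)).
  apply: (mcomp mQu (f := fun p : E * E => (c *: p.1, c *: p.2))).
  by apply: measurable_fun_pair; meas.
rewrite (dintZ mu _ mQc (fun x y => Q_ge0 _ _ _ _)); last first.
  by apply: mulr_ge0; exact: ltW.
rewrite (dint_dil c0 mQu (fun x y => Q_ge0 _ _ _ _)) muleA -EFinM.
congr (_%:E * _)%E; rewrite expr2; field.
by rewrite gt_eqF.
Qed.

Lemma energyZ (u : E -> R) (c : R) : mfunE u ->
  En (fun x => c * u x) = ((c ^+ 2)%:E * En u)%E.
Proof.
move=> mu_; rewrite /energy -(dintZ mu (sqr_ge0 c) (mQ sg mu_) (fun x y => Q_ge0 _ _ _ _)).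
by apply: eq_dint => x y; rewrite /quad -mulrBr exprMn mulrA.
Qed.

Lemma Iform_fullE u : mfunE u -> Iform sg (@fullsp R n) u = En u.
Proof.
move=> mu_; have mQu := mQ sg mu_.
rewrite /Iform.
have -> : (fun y => iint (fun x => ((\1_(@fullsp R n) x * \1_(@fullsp R n) y) *
    ((u x - u y) ^+ 2 / (tdist x y `^ (n%:R + 2 * sg))))%:E)) =
    (fun y => \int[mu]_x (Q u y x)%:E)%E.
  apply/funext => y; rewrite -iintE.
  - congr iint; apply/funext => x; congr EFin.
    by rewrite !indicE !in_setT !mul1r Q_sym tdistE.
  - by apply: em_EFin; exact: mfun2_r.
  - by move=> x; rewrite lee_fin Q_ge0.
rewrite iintE//.
- by apply: measurable_inner => // x y; exact: Q_ge0.
- by move=> x; apply: ig_ge0 => y; exact: Q_ge0.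
Qed.

Lemma indic_half (x : E) : \1_(@halfsp R n) x = half 0 x.
Proof.
rewrite indicE /half /chi; congr ((nat_of_bool _)%:R); rewrite -lastcE.
by apply/idP/idP; rewrite inE.
Qed.

Lemma Iform_halfE u : mfunE u -> Iform sg (@halfsp R n) u = energyH 0 u.
Proof.
move=> mu_; have mQu := mHQ 0 mu_.
rewrite /Iform.
have -> : (fun y => iint (fun x => ((\1_(@halfsp R n) x * \1_(@halfsp R n) y) *
    ((u x - u y) ^+ 2 / (tdist x y `^ (n%:R + 2 * sg))))%:E)) =
    (fun y => \int[mu]_x (half 0 y * half 0 x * Q u y x)%:E)%E.
  apply/funext => y; rewrite -iintE.
  - congr iint; apply/funext => x; congr EFin.
    by rewrite !indic_half Q_sym tdistE [half 0 y * _]mulrC.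
  - by apply: em_EFin; exact: (mfun2_r y mQu).
  - by move=> x; rewrite lee_fin HQ_ge0.
rewrite iintE//.
- by apply: (measurable_inner mu mQu) => x y; exact: HQ_ge0.
- by move=> x; apply: ig_ge0 => y; exact: HQ_ge0.
Qed.

Lemma Lpint_fullE u : mfunE u ->
  Lpint sg (@fullsp R n) u = (\int[mu]_x (`|u x| `^ pexp n sg)%:E)%E.
Proof.
move=> mu_; rewrite -iintE.
- by congr iint; apply/funext => x; rewrite indicE in_setT mul1r.
- by apply: em_EFin; meas.
- by move=> x; rewrite lee_fin powR_ge0.
Qed.

Lemma Lpint_halfE u : mfunE u ->
  Lpint sg (@halfsp R n) u =
  (\int[mu]_x (half 0 x * `|u x| `^ pexp n sg)%:E)%E.
Proof.
move=> mu_; have mh := measurable_half 0; rewrite -iintE.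
- by congr iint; apply/funext => x; rewrite indic_half.
- by apply: em_EFin; meas.
- by move=> x; rewrite lee_fin mulr_ge0 ?half_ge0// powR_ge0.
Qed.

Lemma lebnE (b : E -> bool) : measurable_fun [set: E] b ->
  lebn [set x | b x] = (\int[mu]_x (chi R (b x))%:E)%E.
Proof.
move=> mb; rewrite /lebn -iintE.
- congr iint; apply/funext => x; rewrite indicE /chi; congr ((nat_of_bool _)%:R%:E).
  by apply/idP/idP; rewrite inE.
- by apply: em_EFin; exact: rm_bool.
- by move=> x; rewrite lee_fin chi_ge0.
Qed.

End half_space.

(** * Mollification *)

Section quadratic_differentiability.
Variables (R : realType) (V : normedModType R).

(** Allows differentiation under the integral sign without limit theorems: a pointwise second-order
    Taylor bound is integrated, and the result is already a derivative. *)
Lemma diff_quadratic (g : V -> R^o) (v : V) (L : {linear V -> R^o}) (C : R) :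
  0 <= C -> (forall h, `|L h| <= C * `|h|) ->
  (forall h, `|h| <= 1 -> `|g (v + h) - g v - L h| <= C * `|h| ^+ 2) ->
  differentiable g v /\ 'd g v = L :> (V -> R^o).
Proof.
move=> C0 LC gC.
have cL : continuous L.
  apply: bounded_linear_continuous; apply/linear_boundedP.
  exists C; split; [exact: num_real|move=> r Cr x].
  by apply: le_trans (LC x) _; apply: ler_wpM2r => //; exact: ltW.
have H : g \o shift v = cst (g v) + L +o_ 0 id.
  apply/eqaddoP => _/posnumP[e]; near=> h.
  have -> : (g \o shift v - (cst (g v) + L)) h = g (v + h) - g v - L h.
    by rewrite /= opprD addrA (addrC v).
  have h1 : `|h| <= 1 by near: h; apply: nbhs0_le.
  apply: (le_trans (gC h h1)); rewrite expr2 mulrA; apply: ler_wpM2r => //.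
  have he : `|h| <= e%:num / (C + 1).
    by near: h; apply: nbhs0_le; rewrite divr_gt0// ltr_wpDl.
  apply: (le_trans (ler_wpM2l C0 he)).
  rewrite mulrCA ler_piMr// ler_pdivrMr ?ltr_wpDl// mul1r lerDl//.
have D := diff_unique cL H.
split=> //; apply/diff_locallyP; rewrite D; split=> //.
Unshelve. all: by end_near. Qed.
End quadratic_differentiability.

Lemma continuous_local_lipschitz (R : realType) (V : normedModType R) (f : V -> R^o) :
  (forall v, exists2 C, 0 <= C &
     forall k, `|k| <= 1 -> `|f (v + k) - f v| <= C * `|k|) ->
  continuous f.
Proof.
move=> H v; have [C C0 HC] := H v.
apply/cvgrPdist_le => e e0; near=> w.
have w1 : `|v - w| <= 1 by near: w; exact: cvgr_dist_le cvg_id _ _.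
have w2 : `|v - w| <= e / (C + 1).
  by near: w; apply: cvgr_dist_le cvg_id _ _; rewrite divr_gt0// ltr_wpDl.
rewrite distrC in w1; rewrite distrC in w2.
have := HC (w - v) w1; rewrite [v + _]addrC subrK distrC => /le_trans; apply.
apply: (le_trans (ler_wpM2l C0 w2)).
by rewrite mulrCA ler_piMr// ?(ltW e0)// ler_pdivrMr ?ltr_wpDl// mul1r lerDl.
Unshelve. all: by end_near. Qed.

Section compactly_supported_weight.
Variables (R : realType) (n : nat).
Local Notation E := (n.-tuple R).
Local Notation mu := (mun R n).
Local Notation mfunE u := (measurable_fun [set: E] u).
Variables (W : E -> R) (M : R) (b : E) (rho : R).
Hypothesis mW : mfunE W.
Hypothesis W0 : forall x, 0 <= W x.
Hypothesis WM : forall x, W x <= M.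
Hypothesis Ws : forall x, W x != 0 -> vnorm (x - b) <= rho.

Lemma weight_int : mu.-integrable setT (EFin \o W).
Proof.
apply/integrableP; split; first exact: em_EFin.
have M0 : 0 <= M by exact: le_trans (W0 0) (WM 0).
apply: (@le_lt_trans _ _ (\int[mu]_x (M * chi R (vnorm (x - b) < `|rho| + 1))%:E)%E).
  rewrite (eq_integral (fun x => (W x)%:E)); last first.
    by move=> x _ /=; rewrite ger0_norm.
  apply: ig_le => //; first by meas.
  move=> x; rewrite W0/=; have [->|wx] := eqVneq (W x) 0.
    by rewrite mulr_ge0 ?chi_ge0.
  rewrite (_ : _ < _) /chi ?mulr1//.
  have := Ws wx; have := ler_norm rho; lra.
have mb := measurable_ball b (`|rho| + 1).
rewrite (igZ mu M0 mb (fun x => chi_ge0 _ _)) mu_ball; last by rewrite ltr_wpDl.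
by rewrite -EFinM ltry.
Qed.

Lemma cv_int (f : E -> R) (C : R) : mfunE f ->
  (forall y, W y != 0 -> `|f y| <= C) ->
  mu.-integrable setT (EFin \o (fun y => W y * f y)).
Proof.
move=> mf fC.
have iCW : mu.-integrable setT (EFin \o (fun y => `|C| * W y)).
  rewrite (_ : EFin \o _ = fun y => (`|C|%:E * (EFin \o W) y)%E)//.
  by apply: integrableZl => //; exact: weight_int.
apply: (le_integrable _ _ _ iCW) => //.
  by apply: em_EFin; meas.
move=> y _ /=; rewrite lee_fin !normrM normr_id (ger0_norm (W0 y)).
have [->|wy] := eqVneq (W y) 0; first by rewrite mul0r mulr0.
by rewrite mulrC ler_wpM2r// (le_trans (fC y wy))// ler_norm.
Qed.

(** Used twice with exchanged roles: in [moll] the weight is the function to be mollified, in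
    [smooth] it is the mollifier. *)
Definition cv (f : E -> R) : R := (\int[mu]_y (W y * f y))%R.
Definition mass : R := (\int[mu]_y W y)%R.

Lemma mass_ge0 : 0 <= mass.
Proof. by apply: Rintegral_ge0. Qed.

Lemma cv_bound (f : E -> R) (C : R) : mfunE f ->
  (forall y, W y != 0 -> `|f y| <= C) -> 0 <= C ->
  `|cv f| <= C * mass.
Proof.
move=> mf fC C0; have iWf := cv_int mf fC.
apply: le_trans (le_normr_Rintegral _ iWf) _ => //.
rewrite /mass -RintegralZl//; last exact: weight_int.
apply: le_Rintegral => //.
- rewrite (_ : EFin \o _ = abse \o (EFin \o (fun y => W y * f y)))//.
  exact: integrable_abse.
- rewrite (_ : EFin \o _ = fun y => (C%:E * (EFin \o W) y)%E)//.
  by apply: integrableZl => //; exact: weight_int.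
move=> y _; rewrite normrM ger0_norm//.
have [->|wy] := eqVneq (W y) 0; first by rewrite mul0r mulr0.
by rewrite mulrC ler_wpM2r// fC.
Qed.

Lemma cvB (f g : E -> R) (C : R) : mfunE f -> mfunE g ->
  (forall y, W y != 0 -> `|f y| <= C) -> (forall y, W y != 0 -> `|g y| <= C) ->
  cv (fun y => f y - g y) = cv f - cv g.
Proof.
move=> mf mg fC gC; rewrite /cv -RintegralB//.
- by apply: eq_Rintegral => y _; rewrite mulrBr.
- exact: cv_int mf fC.
- exact: cv_int mg gC.
Qed.

Lemma cvD (f g : E -> R) (C : R) : mfunE f -> mfunE g ->
  (forall y, W y != 0 -> `|f y| <= C) -> (forall y, W y != 0 -> `|g y| <= C) ->
  cv (fun y => f y + g y) = cv f + cv g.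
Proof.
move=> mf mg fC gC; rewrite /cv -RintegralD//.
- by apply: eq_Rintegral => y _; rewrite mulrDr.
- exact: cv_int mf fC.
- exact: cv_int mg gC.
Qed.

Lemma cvZ (f : E -> R) (a C : R) : mfunE f ->
  (forall y, W y != 0 -> `|f y| <= C) ->
  cv (fun y => a * f y) = a * cv f.
Proof.
move=> mf fC; rewrite /cv -RintegralZl//.
- by apply: eq_Rintegral => y _; rewrite mulrCA.
- exact: cv_int mf fC.
Qed.

Lemma cvE (f : E -> R) (C : R) : mfunE f ->
  (forall y, 0 <= f y) -> (forall y, W y != 0 -> f y <= C) ->
  ((cv f)%:E = \int[mu]_y (W y * f y)%:E)%E.
Proof.
move=> mf f0 fC; rewrite /cv /Rintegral fineK//.
apply: integrable_fin_num => //; apply: (cv_int mf (C := C)) => y wy.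
by rewrite ger0_norm// fC.
Qed.

End compactly_supported_weight.

Section row_tuples.
Variables (R : realType) (n : nat).
Local Notation E := (n.-tuple R).
Local Notation rt := (@tuple_of_row R n).

Lemma rtD u v : rt (u + v) = rt u + rt v.
Proof. by apply: eq_from_tnth => i; rewrite tnthD !tnth_mktuple mxE. Qed.
Lemma rtZ c u : rt (c *: u) = c *: rt u.
Proof. by apply: eq_from_tnth => i; rewrite tnthZ !tnth_mktuple mxE. Qed.
Lemma coord_le_norm (h : 'rV[R]_n) i : `|h ord0 i| <= `|h|.
Proof.
rewrite [leRHS](_ : _ = mx_norm h)// mx_normrE.
by apply: (@bigmax_sup _ _ _ _ (ord0, i)).
Qed.

(** The norm on rows is the sup norm; the crude factor n avoids a square root. *)
Lemma vnorm_rt (h : 'rV[R]_n) : vnorm (rt h) <= n%:R * `|h|.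
Proof.
rewrite -ler_sqr ?nnegrE ?vnorm_ge0 ?mulr_ge0// sqr_vnorm exprMn.
apply: (@le_trans _ _ (\sum_(i < n) `|h| ^+ 2)).
  apply: ler_sum => i _; rewrite tnth_mktuple -expr2 -[leLHS]real_normK ?num_real//.
  by rewrite ler_sqr ?nnegrE// coord_le_norm.
rewrite sumr_const card_ord -[leLHS]mulr_natl; apply: ler_wpM2r; first exact: sqr_ge0.
case: n => [|k]; first by rewrite expr0n.
by rewrite expr2 ler_peMr ?ler0n// ler1n.
Qed.

Lemma norm_le_vnorm_rt (h : 'rV[R]_n) : `|h| <= vnorm (rt h).
Proof.
rewrite [leLHS](_ : _ = mx_norm h)// mx_normrE.
apply/bigmax_leP; split=> [|[i j] _]; first exact: vnorm_ge0.
by rewrite /= (ord1 i); have := tnth_le_vnorm (rt h) j; rewrite tnth_mktuple.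
Qed.

Lemma continuous_vnorm_rt b : continuous (fun v : 'rV[R]_n => vnorm (rt v - b) : R^o).
Proof.
apply: continuous_local_lipschitz => v; exists n%:R => // k _.
apply: le_trans (vnorm_rt k); rewrite rtD ler_norml.
have h1 := vnormD (rt v - b) (rt k); have h2 := vnormD (rt v + rt k - b) (- rt k).
rewrite addrAC in h1; rewrite vnormN addrAC addrK in h2.
by apply/andP; split; lra.
Qed.

End row_tuples.

Section mollifier.
Variables (R : realType) (n : nat).
Local Notation E := (n.-tuple R).
Local Notation mu := (mun R n).
Local Notation rt := (@tuple_of_row R n).
Local Notation mfunE u := (measurable_fun [set: E] u).
Variable eps : R.
Hypothesis eps0 : 0 < eps.

Definition pos (z : E) : R := Num.max 0 (eps ^+ 2 - vnorm z ^+ 2).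
(** An unnormalised mollifier of class $C^1$, as much regularity as [C1c_half] asks for; piecewise
    polynomial, so that Taylor bounds are elementary. Its differential is [dbump]. *)
Definition bump (z : E) : R := pos z ^+ 2.
Definition dbump (z h : E) : R := - (4 * pos z * vdot z h).

Lemma pos_ge0 z : 0 <= pos z.
Proof. by rewrite le_max lexx. Qed.

Lemma pos_le z : pos z <= eps ^+ 2.
Proof. by rewrite ge_max sqr_ge0/= lerBlDr lerDl sqr_ge0. Qed.

Lemma measurable_pos : mfunE pos.
Proof. by rewrite /pos; meas. Qed.

Lemma bump_ge0 z : 0 <= bump z.
Proof. exact: sqr_ge0. Qed.

Lemma bump_le z : bump z <= eps ^+ 4.
Proof.
by rewrite (_ : 4 = 2 * 2)%N// exprM ler_sqr ?nnegrE ?pos_ge0 ?sqr_ge0 ?pos_le.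
Qed.

Lemma bump_supp z : bump z != 0 -> vnorm z < eps.
Proof.
rewrite sqrf_eq0 => bz; rewrite ltNge; apply: contra bz => ze.
apply/eqP/max_idPl; rewrite subr_le0 ler_sqr ?nnegrE ?vnorm_ge0//.
exact: ltW.
Qed.

Lemma bump_taylor z h :
  `|bump (z + h) - bump z - dbump z h| <=
  ((2 * vnorm z + vnorm h) ^+ 2 + 2 * eps ^+ 2) * vnorm h ^+ 2.
Proof.
(* The function $\max(0, t)^2$ has derivative $2\max(0, t)$, which is Lipschitz with constant 2;
   hence this first-order remainder. *)
have key (s t : R) : `|Num.max 0 t ^+ 2 - Num.max 0 s ^+ 2
    - 2 * Num.max 0 s * (t - s)| <= (t - s) ^+ 2.
  have q1 := sqr_ge0 (t - s); have q2 := sqr_ge0 t; have q3 := sqr_ge0 s.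
  rewrite ler_norml; case/orP: (le_total s 0) => s0; case/orP: (le_total t 0) => t0.
  - rewrite (max_idPl s0) (max_idPl t0) !expr0n/= mulr0 mul0r subrr subr0.
    by rewrite oppr_le0 q1.
  - rewrite (max_idPl s0) (max_idPr t0) expr0n/= mulr0 mul0r !subr0.
    by apply/andP; split; nra.
  - rewrite (max_idPr s0) (max_idPl t0) expr0n/=.
    by apply/andP; split; nra.
  - rewrite (max_idPr s0) (max_idPr t0).
    have -> : t ^+ 2 - s ^+ 2 - 2 * s * (t - s) = (t - s) ^+ 2 by ring.
    by rewrite lexx andbT; lra.
have := key (eps ^+ 2 - vnorm z ^+ 2) (eps ^+ 2 - vnorm (z + h) ^+ 2).
rewrite -/(pos z) -/(pos (z + h)).
have -> : eps ^+ 2 - vnorm (z + h) ^+ 2 - (eps ^+ 2 - vnorm z ^+ 2) =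
    - (2 * vdot z h + vnorm h ^+ 2).
  by rewrite !sqr_vnorm vdotDl !vdotDr (vdotC h z); ring.
move=> K1; rewrite /bump /dbump.
have -> : pos (z + h) ^+ 2 - pos z ^+ 2 - - (4 * pos z * vdot z h) =
  (pos (z + h) ^+ 2 - pos z ^+ 2 -
     2 * pos z * - (2 * vdot z h + vnorm h ^+ 2)) - 2 * pos z * vnorm h ^+ 2.
  by ring.
apply: (le_trans (ler_normB _ _)); rewrite [leRHS]mulrDl; apply: lerD.
  apply: (le_trans K1); rewrite sqrrN -exprMn.
  rewrite -[leLHS]real_normK ?num_real// ler_sqr ?nnegrE//; last first.
    by rewrite mulr_ge0 ?addr_ge0 ?mulr_ge0 ?vnorm_ge0.
  have d1 := vdot_le z h; have d2 := vdot_le (- z) h.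
  rewrite vdotNl vnormN in d2.
  have n1 := vnorm_ge0 z; have n2 := vnorm_ge0 h.
  rewrite ler_norml; apply/andP; split; nra.
rewrite ger0_norm; last first.
  by apply: mulr_ge0; [apply: mulr_ge0 => //; exact: pos_ge0|exact: sqr_ge0].
by apply: ler_wpM2r; rewrite ?sqr_ge0// ler_pM2l// pos_le.
Qed.

Lemma dbump_bound z h : `|dbump z h| <= 4 * eps ^+ 2 * vnorm z * vnorm h.
Proof.
rewrite /dbump normrN !normrM (ger0_norm (pos_ge0 z)) (ger0_norm (ler0n _ 4)).
have -> : 4 * pos z * `|vdot z h| = 4 * (pos z * `|vdot z h|) by ring.
have -> : 4 * eps ^+ 2 * vnorm z * vnorm h = 4 * (eps ^+ 2 * (vnorm z * vnorm h)).
  by ring.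
apply: ler_wpM2l => //.
apply: ler_pM; [exact: pos_ge0|by []|exact: pos_le|].
have d1 := vdot_le z h; have d2 := vdot_le (- z) h.
by rewrite vdotNl vnormN in d2; rewrite ler_norml; apply/andP; split; lra.
Qed.

Lemma dbump_lip z k h : `|dbump (z + k) h - dbump z h| <=
  4 * vnorm h * ((2 * vnorm z + vnorm k) * (vnorm z + vnorm k) + eps ^+ 2) * vnorm k.
Proof.
have plip : `|pos (z + k) - pos z| <= (2 * vnorm z + vnorm k) * vnorm k.
  have key (s t : R) : `|Num.max 0 t - Num.max 0 s| <= `|t - s|.
    case/orP: (le_total s 0) => s0; case/orP: (le_total t 0) => t0.
    - by rewrite (max_idPl s0) (max_idPl t0) subrr normr0.
    - rewrite (max_idPl s0) (max_idPr t0) subr0 !ger0_norm; lra.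
    - rewrite (max_idPr s0) (max_idPl t0) sub0r normrN ger0_norm// distrC ger0_norm; lra.
    - by rewrite (max_idPr s0) (max_idPr t0).
  apply: le_trans (key _ _) _.
  have -> : eps ^+ 2 - vnorm (z + k) ^+ 2 - (eps ^+ 2 - vnorm z ^+ 2) =
      - (2 * vdot z k + vnorm k ^+ 2).
    by rewrite !sqr_vnorm vdotDl !vdotDr (vdotC k z); ring.
  have d1 := vdot_le z k; have d2 := vdot_le (- z) k.
  rewrite vdotNl vnormN in d2.
  have n1 := vnorm_ge0 z; have n2 := vnorm_ge0 k.
  rewrite normrN ler_norml; apply/andP; split; nra.
rewrite /dbump.
have -> : - (4 * pos (z + k) * vdot (z + k) h) - - (4 * pos z * vdot z h) =
  - (4 * ((pos (z + k) - pos z) * vdot (z + k) h + pos z * vdot k h)).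
  by rewrite vdotDl; ring.
have cs (a c : E) : `|vdot a c| <= vnorm a * vnorm c.
  have d1 := vdot_le a c; have d2 := vdot_le (- a) c.
  by rewrite vdotNl vnormN in d2; rewrite ler_norml; apply/andP; split; lra.
rewrite normrN normrM ger0_norm//.
set D := vnorm z + vnorm k.
have -> : 4 * vnorm h * ((2 * vnorm z + vnorm k) * D + eps ^+ 2) * vnorm k =
  4 * (vnorm h * ((2 * vnorm z + vnorm k) * D + eps ^+ 2) * vnorm k) by ring.
apply: ler_wpM2l => //; rewrite {}/D.
apply: (le_trans (ler_normD _ _)).
have n1 := vnorm_ge0 z; have n2 := vnorm_ge0 k; have n3 := vnorm_ge0 h.
have e1 : `|(pos (z + k) - pos z) * vdot (z + k) h| <=
    ((2 * vnorm z + vnorm k) * vnorm k) * ((vnorm z + vnorm k) * vnorm h).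
  rewrite normrM; apply: ler_pM => //.
  apply: le_trans (cs _ _) _; apply: ler_wpM2r => //; exact: vnormD.
have e2 : `|pos z * vdot k h| <= eps ^+ 2 * (vnorm k * vnorm h).
  rewrite normrM (ger0_norm (pos_ge0 z)).
  by apply: ler_pM; [exact: pos_ge0|by []|exact: pos_le|exact: cs].
apply: (le_trans (lerD e1 e2)); rewrite le_eqVlt; apply/orP; left; apply/eqP.
ring.
Qed.

Variables (W : E -> R) (M : R) (b : E) (rho : R).
Hypothesis mW : mfunE W.
Hypothesis W0 : forall x, 0 <= W x.
Hypothesis WM : forall x, W x <= M.
Hypothesis Ws : forall x, W x != 0 -> vnorm (x - b) <= rho.
Local Notation cv := (@cv R n W).

Definition moll (x : E) : R := cv (fun y => bump (x - y)).
Definition dmoll (x h : E) : R := cv (fun y => dbump (x - y) h).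

Let mb x : mfunE (fun y => bump (x - y)).
Proof. by apply: (@mfun_sub R n bump); have := measurable_pos; rewrite /bump => ?; meas. Qed.

Let mdb x h : mfunE (fun y => dbump (x - y) h).
Proof.
apply: (@mfun_sub R n (fun z => dbump z h)); have := measurable_pos.
by rewrite /dbump => ?; meas.
Qed.

Let bb x y : W y != 0 -> `|bump (x - y)| <= eps ^+ 4.
Proof. by move=> _; rewrite ger0_norm ?bump_ge0// bump_le. Qed.

Let rad x := vnorm (x - b) + rho.

Let radP x y : W y != 0 -> vnorm (x - y) <= rad x.
Proof.
by move=> /Ws yb; rewrite (le_trans (vnorm_tri x b y))// lerD2l vnormB.
Qed.

Let dbb x h y : W y != 0 ->
  `|dbump (x - y) h| <= 4 * eps ^+ 2 * rad x * vnorm h.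
Proof.
move=> wy; apply: le_trans (dbump_bound _ _) _.
apply: ler_wpM2r; first exact: vnorm_ge0.
by apply: ler_wpM2l; [rewrite mulr_ge0 ?sqr_ge0|exact: radP].
Qed.

Definition dmoll_row (v h : 'rV[R]_n) : R^o := dmoll (rt v) (rt h).

Let dbumpZD z a h k : dbump z (a *: h + k) = a * dbump z h + dbump z k.
Proof. by rewrite /dbump vdotDr vdotZr; ring. Qed.

Lemma dmoll_row_linear v : linear (dmoll_row v).
Proof.
move=> a h k; rewrite /dmoll_row /dmoll rtD rtZ.
set C := 4 * eps ^+ 2 * rad (rt v).
have h1 := @dbb (rt v) (rt h); have k1 := @dbb (rt v) (rt k).
rewrite (_ : (fun y => _) = fun y => a * dbump (rt v - y) (rt h) + dbump (rt v - y) (rt k)).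
  rewrite (@cvD _ _ W M b rho mW W0 WM Ws _ _
    (`|a| * (C * vnorm (rt h)) + C * vnorm (rt k))).
  - by rewrite (@cvZ _ _ W M b rho mW W0 WM Ws _ _ (C * vnorm (rt h)) (mdb _ _) h1).
  - by have := mdb (rt v) (rt h) => ?; apply: rmM => //; exact: rm_cst.
  - exact: mdb.
  - move=> y wy; rewrite normrM; apply: (@le_trans _ _ (`|a| * (C * vnorm (rt h)))).
      by apply: ler_wpM2l => //; exact: h1.
    by rewrite lerDl (le_trans _ (k1 y wy)).
  - move=> y wy; apply: (le_trans (k1 y wy)); rewrite lerDr mulr_ge0//.
    by rewrite (le_trans _ (h1 y wy)).
by apply/funext => y; rewrite dbumpZD.
Qed.


Lemma moll_diff v : differentiable (moll \o rt : _ -> R^o) v /\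
  'd (moll \o rt : _ -> R^o) v = dmoll_row v :> (_ -> _).
Proof.
pose L : {linear 'rV[R]_n -> R^o} :=
  HB.pack (dmoll_row v) (GRing.isLinear.Build R 'rV[R]_n R^o _ (dmoll_row v)
    (dmoll_row_linear v)).
set r := rad (rt v); have m0 := mass_ge0 W0.
(* The coefficient of [bump_taylor] when $|x - y| \le r$ and the increment has length at most n.
   Absolute values are taken because r may be negative when W vanishes identically. *)
pose D := (2 * `|r| + n%:R) ^+ 2 + 2 * eps ^+ 2.
pose C1 := 4 * eps ^+ 2 * `|r| * n%:R * mass W.
pose C2 := D * n%:R ^+ 2 * mass W.
have e20 : 0 <= eps ^+ 2 by exact: sqr_ge0.
have D0 : 0 <= D by apply: addr_ge0; [exact: sqr_ge0|exact: mulr_ge0].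
have C10 : 0 <= C1 by do 4?[apply: mulr_ge0 => //].
have C20 : 0 <= C2.
  by apply: mulr_ge0 => //; apply: mulr_ge0 => //; exact: sqr_ge0.
have rr : r <= `|r| by exact: ler_norm.
apply: (@diff_quadratic _ _ _ v L (C1 + C2)).
- exact: addr_ge0.
- move=> h; rewrite [L h]/(dmoll (rt v) (rt h)).
  have e0 : 0 <= 4 * eps ^+ 2 by exact: mulr_ge0.
  have vh : 4 * eps ^+ 2 * `|r| * (n%:R * `|h|) * mass W <= (C1 + C2) * `|h|.
    have -> : 4 * eps ^+ 2 * `|r| * (n%:R * `|h|) * mass W = C1 * `|h|.
      by rewrite /C1; ring.
    by apply: ler_wpM2r => //; rewrite lerDl.
  apply: le_trans vh.
  apply: (@cv_bound _ _ W M b rho mW W0 WM Ws) => //.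
    move=> y wy; apply: le_trans (dbb _ _ wy) _.
    apply: ler_pM; rewrite ?vnorm_ge0 ?vnorm_rt//.
      by rewrite mulr_ge0// (le_trans (vnorm_ge0 _) (radP (rt v) wy)).
    by apply: ler_wpM2l.
  by apply: mulr_ge0; apply: mulr_ge0.
move=> h h1; rewrite /= /dmoll_row rtD.
set x := rt v; set k := rt h.
have kn : vnorm k <= n%:R * `|h| by exact: vnorm_rt.
have kn1 : vnorm k <= n%:R by rewrite (le_trans kn)// ler_piMr.
have B1 y : W y != 0 -> `|bump (x + k - y) - bump (x - y)| <= 2 * eps ^+ 4.
  move=> wy; apply: (le_trans (ler_normB _ _)).
  by have := bb (x + k) wy; have := bb x wy; lra.
pose C3 := 2 * eps ^+ 4 + 4 * eps ^+ 2 * r * vnorm k.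
have Cge y : W y != 0 -> 0 <= 4 * eps ^+ 2 * r * vnorm k.
  by move=> wy; rewrite (le_trans _ (@dbb x k y wy)).
have -> : moll (x + k) - moll x - dmoll x k =
    cv (fun y => bump (x + k - y) - bump (x - y) - dbump (x - y) k).
  rewrite (@cvB _ _ W M b rho mW W0 WM Ws _ _ C3); last 4 first.
  - by apply: rmD; [exact: mb|apply: rmN; exact: mb].
  - exact: mdb.
  - by move=> y wy; rewrite (le_trans (B1 y wy))// lerDl (Cge y).
  - move=> y wy; rewrite (le_trans (dbb _ _ wy))// lerDr mulr_ge0//.
    by rewrite exprn_ge0// ltW.
  congr (_ - _); rewrite (@cvB _ _ W M b rho mW W0 WM Ws _ _ (eps ^+ 4))//.
  - by move=> y; exact: bb.
  - by move=> y; exact: bb.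
have vh : D * (n%:R * `|h|) ^+ 2 * mass W <= (C1 + C2) * `|h| ^+ 2.
  have -> : D * (n%:R * `|h|) ^+ 2 * mass W = C2 * `|h| ^+ 2.
    by rewrite /C2; ring.
  by apply: ler_wpM2r; [exact: sqr_ge0|rewrite lerDr].
apply: le_trans vh; apply: (@cv_bound _ _ W M b rho mW W0 WM Ws).
- apply: rmD; last by apply: rmN; exact: mdb.
  by apply: rmD; [exact: mb|apply: rmN; exact: mb].
- move=> y wy; rewrite (_ : x + k - y = x - y + k); last by rewrite addrAC.
  apply: le_trans (bump_taylor _ _) _.
  have q1 := radP x wy; have q2 := vnorm_ge0 (x - y); have q3 := vnorm_ge0 k.
  apply: ler_pM.
  + by apply: addr_ge0; [exact: sqr_ge0|exact: mulr_ge0].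
  + exact: sqr_ge0.
  + rewrite /D lerD2r ler_sqr ?nnegrE ?addr_ge0 ?mulr_ge0//.
    by rewrite -/r in q1; lra.
  + by rewrite ler_sqr ?nnegrE ?mulr_ge0.
- by apply: mulr_ge0 => //; exact: sqr_ge0.
Qed.

Lemma dmoll_continuous h : continuous (fun v => dmoll_row v h).
Proof.
apply: continuous_local_lipschitz => v; have m0 := mass_ge0 W0.
set r := rad (rt v).
pose C := 4 * vnorm (rt h) * ((2 * `|r| + n%:R) * (`|r| + n%:R) + eps ^+ 2) * n%:R.
have C0 : 0 <= C.
  apply: mulr_ge0 => //; apply: mulr_ge0.
    by apply: mulr_ge0 => //; exact: vnorm_ge0.
  apply: addr_ge0; last exact: sqr_ge0.
  by apply: mulr_ge0; apply: addr_ge0 => //; exact: mulr_ge0.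
exists (C * mass W); first exact: mulr_ge0.
move=> k k1; rewrite /dmoll_row rtD.
have kn : vnorm (rt k) <= n%:R * `|k| by exact: vnorm_rt.
have kn1 : vnorm (rt k) <= n%:R by rewrite (le_trans kn)// ler_piMr.
set x := rt v; set d := rt k in kn kn1 *; set e := rt h.
have -> : dmoll (x + d) e - dmoll x e = cv (fun y => dbump (x + d - y) e - dbump (x - y) e).
  pose C3 := 4 * eps ^+ 2 * rad (x + d) * vnorm e + 4 * eps ^+ 2 * rad x * vnorm e.
  rewrite (@cvB _ _ W M b rho mW W0 WM Ws _ _ C3)//.
  - move=> y wy; rewrite (le_trans (dbb _ _ wy))// lerDl.
    by rewrite (le_trans _ (@dbb x e y wy)).
  - move=> y wy; rewrite (le_trans (dbb _ _ wy))// lerDr.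
    by rewrite (le_trans _ (@dbb (x + d) e y wy)).
rewrite mulrAC; apply: (@cv_bound _ _ W M b rho mW W0 WM Ws).
- by apply: rmD; [exact: mdb|apply: rmN; exact: mdb].
- move=> y wy; rewrite (_ : x + d - y = x - y + d); last by rewrite addrAC.
  apply: le_trans (dbump_lip _ _ _) _.
  have q1 := radP x wy; have q2 := vnorm_ge0 (x - y); have q3 := vnorm_ge0 d.
  have q4 := ler_norm r; rewrite -/r in q1.
  rewrite /C -[leRHS]mulrA; apply: ler_pM.
  + apply: mulr_ge0.
      by apply: mulr_ge0 => //; exact: vnorm_ge0.
    apply: addr_ge0; last exact: sqr_ge0.
    by apply: mulr_ge0; apply: addr_ge0 => //; exact: mulr_ge0.
  + by [].
  + apply: ler_wpM2l; first by apply: mulr_ge0 => //; exact: vnorm_ge0.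
    rewrite lerD2r; apply: ler_pM; try lra.
  + by [].
- by rewrite mulr_ge0.
Qed.

Lemma mollE x : ((moll x)%:E = \int[mu]_y (W y * bump (x - y))%:E)%E.
Proof.
apply: (cvE mW W0 WM Ws (C := eps ^+ 4)) => // y; first exact: bump_ge0.
by move=> _; exact: bump_le.
Qed.

Lemma moll_supp x : moll x != 0 -> vnorm (x - b) <= rho + eps.
Proof.
rewrite leNgt; apply: contraNN => xb.
rewrite /moll /cv /Rintegral integral0_eq// => y _; congr EFin.
have [->|wy] := eqVneq (W y) 0; first by rewrite mul0r.
have [->|/bump_supp by_] := eqVneq (bump (x - y)) 0; first by rewrite mulr0.
by have := vnorm_tri x y b; have := Ws wy; lra.
Qed.

Lemma moll_C1c (n0 : (0 < n)%N) : rho + eps < lastc n0 b -> C1c_half moll.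
Proof.
move=> bl; have dm v : forall h, 'd (moll \o rt : _ -> R^o) v h = dmoll_row v h.
  by move=> h; rewrite (moll_diff v).2.
pose B := [set v : 'rV[R]_n | vnorm (rt v - b) <= rho + eps].
have cB : closed B.
  apply: (@closed_comp _ _ _ [set t : R | t <= rho + eps]).
    by move=> v _; exact: (@continuous_vnorm_rt R n b v).
  exact: closed_le.
have sB : closure [set v | moll (rt v) != 0] `<=` B.
  rewrite [X in _ `<=` X](closure_id _).1//; apply: closure_subset => v /=.
  exact: moll_supp.
split; first by move=> v; exact: (moll_diff v).1.
split.
  move=> h; have := @dmoll_continuous h.
  by rewrite (_ : (fun v => _) = fun v => 'd (moll \o rt : _ -> R^o) v h);
    last by apply/funext => v; rewrite dm.
split.
  apply: bounded_closed_compact; last exact: closed_closure.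
  exists (rho + eps + vnorm b); split; first exact: num_real.
  move=> t tl v /sB Bv; apply: le_trans (norm_le_vnorm_rt v) _.
  have := vnormD (rt v - b) b; rewrite subrK.
  by move: Bv; rewrite /B/=; lra.
move=> v /sB Bv; change (0 < nth 0 (tval (rt v)) n.-1).
rewrite (lastcE n0).
have := le_trans (lastc_norm n0 (rt v - b)) Bv.
by rewrite lastcB ler_norml => /andP[]; lra.
Qed.

End mollifier.

Section jensen.
Variables (R : realType) (n : nat).
Local Notation E := (n.-tuple R).
Local Notation mfunE u := (measurable_fun [set: E] u).
Variables (W : E -> R) (M : R) (b : E) (rho : R).
Hypothesis mW : mfunE W.
Hypothesis W0 : forall x, 0 <= W x.
Hypothesis WM : forall x, W x <= M.
Hypothesis Ws : forall x, W x != 0 -> vnorm (x - b) <= rho.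
Hypothesis W1 : mass W = 1.

Lemma cv_cst c : cv W (fun _ => c) = c.
Proof.
rewrite (_ : (fun _ => c) = fun y : E => c * 1); last by apply/funext => y; rewrite mulr1.
have b1 (y : E) : W y != 0 -> `|1 : R| <= 1 by rewrite normr1.
rewrite (cvZ mW W0 WM Ws c (rm_cst 1) b1).
have -> : cv W (fun _ => 1) = mass W.
  by rewrite /cv /mass; apply: eq_Rintegral => y _; rewrite mulr1.
by rewrite W1 mulr1.
Qed.

(** The variance $\int W (f - m)^2$ is nonnegative, and W has mass one; the bounds in the proof
    serve integrability. *)
Lemma jensen_cv (f : E -> R) (C : R) : mfunE f ->
  (forall y, W y != 0 -> `|f y| <= C) ->
  cv W f ^+ 2 <= cv W (fun y => f y ^+ 2).
Proof.
move=> mf fC; set m := cv W f.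
pose K := C ^+ 2 + `|2 * m| * `|C|.
have m2 : mfunE (fun y => f y ^+ 2) by meas.
have ml : mfunE (fun y => 2 * m * f y) by meas.
have f2C y : W y != 0 -> `|f y ^+ 2| <= C ^+ 2.
  move=> /fC fy; rewrite normrX ler_sqr ?nnegrE//; exact: le_trans fy.
have flC y : W y != 0 -> `|2 * m * f y| <= `|2 * m| * `|C|.
  by move=> /fC fy; rewrite normrM ler_wpM2l// (le_trans fy)// ler_norm.
have K1 y : W y != 0 -> `|f y ^+ 2| <= K.
  by move=> wy; rewrite (le_trans (f2C y wy))// lerDl mulr_ge0.
have K2 y : W y != 0 -> `|2 * m * f y| <= K.
  by move=> wy; rewrite (le_trans (flC y wy))// lerDr sqr_ge0.
have mB : mfunE (fun y => f y ^+ 2 - 2 * m * f y) by meas.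
have BC y : W y != 0 -> `|f y ^+ 2 - 2 * m * f y| <= K + m ^+ 2.
  move=> wy; apply: (le_trans (ler_normB _ _)).
  by rewrite (le_trans (lerD (f2C y wy) (flC y wy)))// lerDl sqr_ge0.
have mC y : W y != 0 -> `|m ^+ 2| <= K + m ^+ 2.
  by move=> wy; rewrite ger0_norm ?sqr_ge0// lerDr (le_trans _ (K1 y wy)).
have : 0 <= cv W (fun y => f y ^+ 2 - 2 * m * f y + m ^+ 2).
  apply: Rintegral_ge0 => y _; apply: mulr_ge0 => //.
  by have := sqr_ge0 (f y - m); lra.
rewrite (cvD mW W0 WM Ws mB (rm_cst _) BC mC) (cvB mW W0 WM Ws m2 ml K1 K2).
rewrite cv_cst (cvZ mW W0 WM Ws _ mf fC) -/m; lra.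
Qed.
End jensen.

(** * Energy and error of a mollification *)

Section smoothing.
Variables (R : realType) (n : nat).
Hypothesis n0 : (0 < n)%N.
Variable sg : R.
Hypotheses (sg0 : 0 < sg) (sg1 : sg < 1) (sgn : 2 * sg < n%:R).
Local Notation E := (n.-tuple R).
Local Notation mu := (mun R n).
Local Notation Ker := (@rker R n sg).
Local Notation Q := (@quad R n sg).
Local Notation En := (@energy R n sg).
Local Notation EnH := (@energyH R n n0 sg).
Local Notation half := (@half R n n0).
Local Notation mfunE u := (measurable_fun [set: E] u).
Variable eps : R.
Hypothesis eps0 : 0 < eps.
Local Notation beps := (@bump R n eps).

Definition cbump : R := mass beps.

Lemma measurable_bump : mfunE beps.
Proof. by have := @measurable_pos R n eps => ?; apply: rmX. Qed.

Let bs (x : E) : beps x != 0 -> vnorm (x - 0) <= eps.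
Proof. by move=> /(bump_supp eps0)/ltW; rewrite subr0. Qed.

Lemma cbumpE : (cbump%:E = \int[mu]_z (beps z)%:E)%E.
Proof.
rewrite /cbump /mass /Rintegral fineK//; apply: integrable_fin_num => //.
exact: (weight_int measurable_bump (bump_ge0 eps) (bump_le eps) bs).
Qed.

(** On the ball of radius $\epsilon/2$ the bump is at least $(3\epsilon^2/4)^2$, and that ball has
    volume $(\epsilon/2)^n$ times that of the unit ball. *)
Definition bump_cst : R := 9 / 16 / 2 ^+ n * bvol R n.

Lemma bump_cst_gt0 : 0 < bump_cst.
Proof. by rewrite mulr_gt0 ?bvol_gt0// divr_gt0 ?exprn_gt0//; lra. Qed.

Lemma cbump_ge : bump_cst * eps ^+ 4 * eps ^+ n <= cbump.
Proof.
rewrite -lee_fin cbumpE.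
have e2 : 0 < eps / 2 by rewrite divr_gt0.
have k0 : 0 <= 9 / 16 * eps ^+ 4 by rewrite mulr_ge0 ?exprn_ge0 ?(ltW eps0)//; lra.
have -> : bump_cst * eps ^+ 4 * eps ^+ n = 9 / 16 * eps ^+ 4 * ((eps / 2) ^+ n * bvol R n).
  by rewrite expr_div_n /bump_cst; ring.
rewrite EFinM -(mu_ball 0 e2) -(igZ mu k0 (measurable_ball 0 _) (fun x => chi_ge0 _ _)).
apply: ig_le.
- by have := @measurable_ball R n 0 (eps / 2) => ?; apply: rmM => //; exact: rm_cst.
- exact: measurable_bump.
move=> z; rewrite mulr_ge0 ?chi_ge0//=.
have [zb|_] := boolP (vnorm (z - 0) < eps / 2); last first.
  by rewrite /chi mulr0; exact: bump_ge0.
rewrite /chi mulr1; rewrite subr0 in zb.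
have z2 : vnorm z ^+ 2 <= (eps / 2) ^+ 2.
  by rewrite ler_sqr ?nnegrE ?vnorm_ge0 ?(ltW zb) ?(ltW e2).
have p : 3 / 4 * eps ^+ 2 <= pos eps z.
  by rewrite /pos le_max; apply/orP; right; rewrite expr_div_n in z2; lra.
have -> : 9 / 16 * eps ^+ 4 = (3 / 4 * eps ^+ 2) ^+ 2 by field.
have e20 := sqr_ge0 eps.
by rewrite /bump ler_sqr ?nnegrE ?pos_ge0//; lra.
Qed.

Lemma cbump_gt0 : 0 < cbump.
Proof.
apply: lt_le_trans cbump_ge.
apply: mulr_gt0; last exact: exprn_gt0.
by apply: mulr_gt0; [exact: bump_cst_gt0|exact: exprn_gt0].
Qed.

Definition eta (z : E) : R := beps z / cbump.

Lemma measurable_eta : mfunE eta.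
Proof. by apply: rmM; [exact: measurable_bump|exact: rm_cst]. Qed.

Lemma eta_ge0 z : 0 <= eta z.
Proof. by rewrite divr_ge0 ?bump_ge0// ltW// cbump_gt0. Qed.

Lemma eta_le z : eta z <= eps ^+ 4 / cbump.
Proof. by rewrite ler_wpM2r ?bump_le// invr_ge0 ltW// cbump_gt0. Qed.

Lemma eta_supp z : eta z != 0 -> vnorm z < eps.
Proof.
move=> ez; apply: (bump_supp eps0); apply: contraNN ez => /eqP ez.
by rewrite /eta ez mul0r.
Qed.

Let es z : eta z != 0 -> vnorm (z - 0) <= eps.
Proof. by move=> /eta_supp/ltW; rewrite subr0. Qed.

Lemma mass_etaE : (\int[mu]_z (eta z)%:E = 1)%E.
Proof.
rewrite (eq_integral (fun z => (cbump^-1 * beps z)%:E)); last first.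
  by move=> z _; rewrite /eta mulrC.
rewrite (igZ mu _ measurable_bump (bump_ge0 eps)) ?invr_ge0 ?(ltW cbump_gt0)//.
by rewrite -cbumpE -EFinM mulVf// gt_eqF// cbump_gt0.
Qed.

Lemma mass_eta : mass eta = 1.
Proof. by rewrite /mass /Rintegral mass_etaE. Qed.

Variables (w : E -> R) (M : R).
Hypothesis mw : mfunE w.
Hypothesis w0 : forall x, 0 <= w x.
Hypothesis wM : forall x, w x <= M.

Definition smooth (x : E) : R := cv eta (fun z => w (x - z)).

Let mwx x : mfunE (fun z => w (x - z)). Proof. exact: mfun_sub. Qed.

Let wb x : `|w x| <= M. Proof. by rewrite ger0_norm. Qed.

Let M0 : 0 <= M. Proof. exact: le_trans (w0 0) (wM 0). Qed.

Lemma smooth_ge0 x : 0 <= smooth x.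
Proof. by apply: Rintegral_ge0 => y _; rewrite mulr_ge0 ?eta_ge0. Qed.

Lemma smooth_le x : smooth x <= M.
Proof.
apply: le_trans (ler_norm _) _; rewrite -[M]mulr1 -mass_eta.
by apply: (cv_bound measurable_eta eta_ge0 eta_le es).
Qed.

Lemma smoothE x : ((smooth x)%:E = \int[mu]_z (eta z * w (x - z))%:E)%E.
Proof. exact: (cvE measurable_eta eta_ge0 eta_le es (C := M)). Qed.

Lemma smooth_jensen x y : (((smooth x - smooth y) ^+ 2)%:E <=
  \int[mu]_z (eta z * (w (x - z) - w (y - z)) ^+ 2)%:E)%E.
Proof.
have md : mfunE (fun z => w (x - z) - w (y - z)).
  by apply: rmD => //; exact: rmN.
have bd z : eta z != 0 -> `|w (x - z) - w (y - z)| <= M.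
  by move=> _; rewrite ler_norml; have := w0 (x - z); have := w0 (y - z);
     have := wM (x - z); have := wM (y - z); move=> *; apply/andP; split; lra.
rewrite -(cvE measurable_eta eta_ge0 eta_le es (C := M ^+ 2)).
- rewrite lee_fin /smooth -(cvB measurable_eta eta_ge0 eta_le es (mwx x) (mwx y)
    (fun _ _ => wb _) (fun _ _ => wb _)).
  exact: (jensen_cv measurable_eta eta_ge0 eta_le es mass_eta md bd).
- exact: rmX.
- by move=> z; exact: sqr_ge0.
- move=> z ez; rewrite -real_normK ?num_real// ler_sqr ?nnegrE//; exact: bd.
Qed.

Lemma smooth_jensen1 x : (((smooth x - w x) ^+ 2)%:E <=
  \int[mu]_z (eta (x - z) * (w z - w x) ^+ 2)%:E)%E.
Proof.
have md : mfunE (fun z => w (x - z) - w x).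
  by apply: rmD => //; exact: rm_cst.
have bd z : eta z != 0 -> `|w (x - z) - w x| <= M.
  by move=> _; rewrite ler_norml; have := w0 (x - z); have := w0 x;
     have := wM (x - z); have := wM x; move=> *; apply/andP; split; lra.
pose f z := eta z * (w (x - z) - w x) ^+ 2.
have -> : (\int[mu]_z (eta (x - z) * (w z - w x) ^+ 2)%:E = \int[mu]_z (f z)%:E)%E.
  rewrite -(mun_sub (f := f) x).
  - by apply: eq_integral => z _; rewrite /f subKr.
  - by apply: rmM; [exact: measurable_eta|exact: rmX].
  - by move=> z; rewrite mulr_ge0 ?eta_ge0 ?sqr_ge0.
rewrite -(cvE measurable_eta eta_ge0 eta_le es (C := M ^+ 2)).
- rewrite lee_fin /smooth -{1}[w x](cv_cst measurable_eta eta_ge0 eta_le es mass_eta).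
  rewrite -(cvB measurable_eta eta_ge0 eta_le es (mwx x) (rm_cst _)
    (fun _ _ => wb _) (fun _ _ => wb _)).
  exact: (jensen_cv measurable_eta eta_ge0 eta_le es mass_eta md bd).
- exact: rmX.
- by move=> z; exact: sqr_ge0.
- move=> z ez; rewrite -real_normK ?num_real// ler_sqr ?nnegrE//; exact: bd.
Qed.


Lemma measurable_smooth : mfunE smooth.
Proof.
pose F (x z : E) := eta z * w (x - z).
have mF : mfun2 F.
  apply: mfun2M; first exact: mfun2_swap (mfun2_1 measurable_eta).
  by apply: (mcomp mw (f := fun p : E * E => p.1 - p.2)); meas.
have F0 x y : 0 <= F x y by rewrite mulr_ge0 ?eta_ge0.
rewrite (_ : smooth = fine \o (fun x => \int[mu]_z (F x z)%:E)%E); last first.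
  by apply/funext => x; rewrite /= -smoothE.
apply: measurableT_comp; first exact: fine_measurable.
exact: (measurable_inner mu mF F0).
Qed.

(* A translation by |z| < eps maps the half-space into the larger one. *)
Lemma energyH_smooth rho : eps <= rho -> (EnH 0 smooth <= EnH (- rho) w)%E.
Proof.
move=> er.
pose h : E -> R := half 0.
have mh : mfunE h by exact: measurable_half.
pose G (x y z : E) := h x * h y * Ker (x - y) *
   (eta z * (w (x - z) - w (y - z)) ^+ 2).
have mK := @measurable_Ker R n sg.
have mee := measurable_eta.
have mG : measurable_fun [set: (E * E) * E] (fun p => G p.1.1 p.1.2 p.2).
  by rewrite /G; meas.
have mG' : measurable_fun [set: (E * E) * E] (fun p => G p.1.1 p.2 p.1.2).
  by rewrite /G; meas.
have G0 x y z : 0 <= G x y z.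
  by apply: mulr_ge0; [apply: mulr_ge0; [exact: half2_ge0|exact: Ker_ge0]|
    apply: mulr_ge0; [exact: eta_ge0|exact: sqr_ge0]].
have mGx x : measurable_fun [set: E * E] (fun p => G x p.1 p.2).
  by apply: (mcomp mG (f := fun p : E * E => ((x, p.1), p.2))); meas.
have mGz z : measurable_fun [set: E * E] (fun p => G p.1 p.2 z).
  by apply: (mcomp mG (f := fun p : E * E => (p, z))); meas.
have mms := measurable_smooth.
apply: (@le_trans _ _ (\int[mu]_x \int[mu]_y \int[mu]_z (G x y z)%:E)%E).
  apply: eg_le.
  - by apply: (measurable_inner mu (mHQ n0 sg 0 mms)) => x y; exact: HQ_ge0.
  - apply: (measurable_fun_fubini_tonelli_F (m2 := mu)
      (fun p : E * E => (\int[mu]_z (G p.1 p.2 z)%:E)%E)).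
      exact: (measurable_inner mu (F := fun (p : E * E) z => G p.1 p.2 z) mG).
    by move=> p; exact: ig_ge0.
  - by move=> x; apply: ig_ge0 => y; exact: HQ_ge0.
  move=> x; apply: eg_le.
  - by apply: em_EFin; exact: (mfun2_r x (mHQ n0 sg 0 mms)).
  - exact: (measurable_inner mu (mGx x) (fun _ _ => G0 _ _ _)).
  - by move=> y; rewrite lee_fin; exact: HQ_ge0.
  move=> y; have k0 : 0 <= h x * h y * Ker (x - y).
    by apply: mulr_ge0; [exact: half2_ge0|exact: Ker_ge0].
  rewrite (igZ mu k0) /quad.
  - rewrite [X in X%:E](_ : _ = h x * h y * Ker (x - y) * (smooth x - smooth y) ^+ 2);
      last by rewrite /h; ring.
    rewrite EFinM.
    by apply: lee_wpmul2l; [rewrite lee_fin|exact: smooth_jensen].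
  - by meas.
  - by move=> z; rewrite mulr_ge0 ?eta_ge0 ?sqr_ge0.
rewrite (_ : (\int[mu]_x \int[mu]_y \int[mu]_z (G x y z)%:E =
              \int[mu]_z \int[mu]_x \int[mu]_y (G x y z)%:E)%E); last first.
  transitivity (\int[mu]_x \int[mu]_z \int[mu]_y (G x y z)%:E)%E.
    by apply: eq_integral => x _; exact: (tonelli mu mu (mGx x) (fun _ _ => G0 _ _ _)).
  pose f (p : E * E) := (\int[mu]_y (G p.1 y p.2)%:E)%E.
  have mf : measurable_fun [set: E * E] f.
    exact: (measurable_inner mu (F := fun (p : E * E) y => G p.1 y p.2) mG').
  by apply: (fubini_tonelli f mf) => p; exact: ig_ge0.
rewrite -[leRHS]mul1e -mass_etaE.
have me : measurable_fun [set: E] (fun z => (eta z)%:E) by apply: em_EFin.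
rewrite -(ge0_integralZr mu measurableT me); last 2 first.
- by move=> z _; rewrite lee_fin eta_ge0.
- by apply: dint_ge0 => x y; exact: HQ_ge0.
apply: eg_le.
- apply: (measurable_fun_fubini_tonelli_F (m2 := mu)
      (fun p : E * E => (\int[mu]_y (G p.2 y p.1)%:E)%E)).
    have mG3 : measurable_fun [set: (E * E) * E] (fun p => G p.1.2 p.2 p.1.1).
      by rewrite /G; meas.
    exact: (measurable_inner mu (F := fun (p : E * E) y => G p.2 y p.1) mG3).
  by move=> p; exact: ig_ge0.
- by apply: emeasurable_funM => //; exact: measurable_cst.
- by move=> z; apply: integral_ge0 => x _; exact: ig_ge0.
move=> z; have mHw := mHQ n0 sg.
pose F (x y : E) := h (x + z) * h (y + z) * Q w x y.
have mF : mfun2 F.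
  have mQw := mQ sg mw; have mhz : mfunE (fun x => h (x + z)) by meas.
  by apply: mfun2M; [apply: mfun2M; [exact: mfun2_1|exact: mfun2_swap (mfun2_1 mhz)]|].
have F0 x y : 0 <= F x y.
  by apply: mulr_ge0; [exact: half2_ge0|exact: Q_ge0].
have -> : (\int[mu]_x \int[mu]_y (G x y z)%:E = (eta z)%:E * dint mu F)%E.
  pose F' x y := F (x - z) (y - z).
  have mF' : mfun2 F'.
    apply: (mcomp mF (f := fun p : E * E => (p.1 - z, p.2 - z))).
    by apply: measurable_fun_pair; meas.
  rewrite -(dint_shift (- z) mF F0) -(dintZ mu (eta_ge0 z) mF' (fun _ _ => F0 _ _)).
  apply: eq_dint => x y; rewrite /F' /F /G /quad !subrK.
  have -> : x - z - (y - z) = x - y by rewrite opprD addrACA subrr addr0.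
  ring.
have [ez|ez] := eqVneq (eta z) 0.
  by rewrite ez; move: (dint mu F) (EnH (- rho) w) => I J; rewrite !mul0e.
apply: lee_wpmul2l; first by rewrite lee_fin eta_ge0.
apply: dint_le => //; first exact: mHQ.
move=> x y; rewrite F0/=.
apply: ler_wpM2r; first exact: Q_ge0.
have hh (t : E) : h (t + z) <= half (- rho) t.
  apply: chi_le => /=; rewrite lastcD.
  have := lastc_norm n0 z; have := eta_supp ez; rewrite ler_norml => ? /andP[_ ?] ?.
  by lra.
by apply: ler_pM => //; exact: half_ge0.
Qed.

Definition smooth_rate : R := (bump_cst^-1 * eps `^ (2 * sg))%R.

(** On the support $|z| < \epsilon$ one has $\epsilon^{-n} = \epsilon^{2\sigma}
    \epsilon^{-n-2\sigma} \le \epsilon^{2\sigma} |z|^{-n-2\sigma}$. The point 0 is excluded because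
    the kernel takes the value 0 there. *)
Lemma eta_Ker z : z != 0 -> eta z <= smooth_rate * Ker z.
Proof.
move=> z0; have [->|ez] := eqVneq (eta z) 0.
  apply: mulr_ge0; last exact: Ker_ge0.
  by rewrite mulr_ge0 ?powR_ge0// invr_ge0 ltW// bump_cst_gt0.
have ze := eta_supp ez; have vz : 0 < vnorm z by rewrite vnorm_gt0.
have en : 0 < eps ^+ n by exact: exprn_gt0.
have e4 : 0 < eps ^+ 4 by exact: exprn_gt0.
have bc := bump_cst_gt0.
apply: (le_trans (eta_le z)).
apply: (@le_trans _ _ (bump_cst^-1 / eps ^+ n)).
  rewrite ler_pdivrMr ?cbump_gt0//.
  apply: le_trans (ler_wpM2l _ cbump_ge); last first.
    by rewrite mulr_ge0// invr_ge0 ltW.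
  rewrite le_eqVlt; apply/orP; left; apply/eqP; field.
  by rewrite !gt_eqF.
rewrite /smooth_rate -mulrA; apply: ler_wpM2l; first by rewrite invr_ge0 ltW.
have e2 : 0 < eps `^ (2 * sg) by exact: powR_gt0.
apply: (@le_trans _ _ (eps `^ (2 * sg) * (eps `^ (n%:R + 2 * sg))^-1)).
  rewrite (powR_nD n sg eps0) le_eqVlt; apply/orP; left; apply/eqP; field.
  by rewrite !gt_eqF.
apply: ler_wpM2l; first exact: ltW.
rewrite /rker lef_pV2 ?posrE ?powR_gt0//.
apply: ge0_ler_powR; rewrite ?nnegrE ?(ltW vz) ?(ltW eps0) ?(ltW ze)//.
by rewrite addr_ge0// mulr_ge0// ltW.
Qed.

(** By Jensen the error is at most $\iint \eta(x-z)(w(z)-w(x))^2$, and [eta_Ker] compares this with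
    the energy: finite energy alone gives a rate of convergence. *)
Lemma smooth_L2 : (\int[mu]_x ((smooth x - w x) ^+ 2)%:E <= smooth_rate%:E * En w)%E.
Proof.
have mQw := mQ sg mw; have ms := measurable_smooth; have mee := measurable_eta.
have c0 : 0 <= smooth_rate.
  by rewrite mulr_ge0 ?powR_ge0// invr_ge0 ltW// bump_cst_gt0.
rewrite /energy -dintZ//; last by move=> x y; exact: Q_ge0.
pose F (x z : E) := eta (x - z) * (w z - w x) ^+ 2.
have mF : mfun2 F by rewrite /mfun2 /F; meas.
have F0 x y : 0 <= F x y by apply: mulr_ge0; [exact: eta_ge0|exact: sqr_ge0].
apply: (@le_trans _ _ (dint mu F)).
  apply: eg_le.
  - by apply: em_EFin; meas.
  - exact: (measurable_inner mu mF F0).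
  - by move=> x; rewrite lee_fin sqr_ge0.
  - exact: smooth_jensen1.
apply: dint_le => //.
  by apply: mfun2M => //; rewrite /mfun2; exact: rm_cst.
move=> x y; rewrite F0/= /F /quad.
have [->|xy] := eqVneq x y; first by rewrite !subrr expr0n !(mulr0, mul0r).
rewrite -[w y - w x]opprB sqrrN [leLHS]mulrC [leRHS]mulrCA; apply: ler_wpM2l; first exact: sqr_ge0.
by apply: eta_Ker; rewrite subr_eq0.
Qed.

End smoothing.

(** Either $b \le ta$ or $a < b/t$. It stands in for the triangle inequality in $L^p$, with the
    coefficient of the main term as close to one as desired. *)
Lemma powR_split (R : realType) (a b t p : R) : 0 <= a -> 0 <= b -> 0 < t -> 0 < p ->
  (a + b) `^ p <= (1 + t) `^ p * a `^ p + (1 + t^-1) `^ p * b `^ p.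
Proof.
move=> a0 b0 t0 p0; have ti : 0 < t^-1 by rewrite invr_gt0.
have h1 := powR_ge0 ((1 + t) * a) p; have h2 := powR_ge0 ((1 + t^-1) * b) p.
have t1 : 0 <= 1 + t by lra.
have t2 : 0 <= 1 + t^-1 by lra.
rewrite -(powRM p t1 a0) -(powRM p t2 b0).
have ab0 : 0 <= a + b by exact: addr_ge0.
have [ba|ba] := leP b (t * a).
  apply: (@le_trans _ _ (((1 + t) * a) `^ p)); last by rewrite lerDl.
  by apply: ge0_ler_powR; rewrite ?nnegrE ?(ltW p0) ?(mulr_ge0 t1)//; lra.
apply: (@le_trans _ _ (((1 + t^-1) * b) `^ p)); last by rewrite lerDr.
apply: ge0_ler_powR; rewrite ?nnegrE ?(ltW p0) ?(mulr_ge0 t2)//.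
rewrite mulrDl mul1r addrC lerD2l.
by rewrite ler_pdivlMl// ltW.
Qed.

(** * The half-space inequality for functions that are not smooth *)

Section half_space_test.
Variables (R : realType) (n : nat).
Hypothesis n0 : (0 < n)%N.
Variable sg : R.
Hypotheses (sg0 : 0 < sg) (sg1 : sg < 1) (sgn : 2 * sg < n%:R).
Local Notation E := (n.-tuple R).
Local Notation mu := (mun R n).
Local Notation En := (@energy R n sg).
Local Notation EnH := (@energyH R n n0 sg).
Local Notation half := (@half R n n0).
Local Notation mfunE u := (measurable_fun [set: E] u).
Local Notation p := (@pexp R n sg).
Local Notation theta := ((n%:R - 2 * sg) / n%:R).

Lemma theta_gt0 : 0 < theta.
Proof. by rewrite divr_gt0 ?subr_gt0// ltr0n. Qed.

Lemma pexp_theta : p * theta = 2.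
Proof.
have h1 : n%:R != 0 :> R by rewrite pnatr_eq0 -lt0n.
have h2 : n%:R - 2 * sg != 0 by rewrite subr_eq0 gt_eqF.
by rewrite /pexp; field; rewrite h1 h2.
Qed.

Variable s : R.
Hypotheses (s0 : 0 <= s) (sS : (s%:E <= S_half n sg)%E).

(** f is approximated by the constant sequence f, so it is admissible for [S_half]. It is not null
    unless its p-th power integral P is 0, in which case the claim is trivial. *)
Lemma C1c_test (f : E -> R) (M P : R) : mfunE f -> C1c_half f ->
  (forall x, 0 <= f x) -> (forall x, f x <= M) -> (forall x, f x != 0 -> 0 < lastc n0 x) ->
  (EnH 0 f < +oo)%E -> (\int[mu]_x (f x `^ p)%:E = P%:E)%E ->
  ((s * P `^ theta)%:E <= EnH 0 f)%E.
Proof.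
move=> mf cf f0 fM fs ef fP.
have th := theta_gt0; have p0 := pexp_gt0 sg0 sgn.
have E0 : (0 <= EnH 0 f)%E by apply: dint_ge0 => x y; exact: HQ_ge0.
have P0 : 0 <= P by rewrite -lee_fin -fP; apply: ig_ge0 => x; exact: powR_ge0.
have [P1|P1] := eqVneq P 0; first by rewrite P1 powR0 ?gt_eqF// mulr0.
have {}P0 : 0 < P by rewrite lt0r P1.
have LP : Lpint sg (@halfsp R n) f = P%:E.
  rewrite (Lpint_halfE n0)// -fP; apply: eq_integral => x _; congr EFin.
  have [->|fx] := eqVneq (f x) 0.
    by rewrite normr0 powR0 ?mulr0// gt_eqF.
  by rewrite /half (fs x fx) /chi mul1r ger0_norm.
have Hf : Hhalf sg f.
  split=> //; split; first by rewrite LP ltry.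
  exists (fun _ => f); split=> //.
  have mff : mfunE (f \- f) by rewrite (_ : _ \- _ = fun x => f x - f x)//; meas.
  have -> : Iform sg (@halfsp R n) (f \- f) = 0%E.
    rewrite (Iform_halfE n0)// /energyH /dint integral0_eq// => x _.
    rewrite integral0_eq// => y _.
    by rewrite /quad /= !subrr expr0n mul0r mulr0.
  have -> : Lpint sg (@halfsp R n) (f \- f) = 0%E.
    rewrite (Lpint_halfE n0)// integral0_eq// => x _.
    by rewrite /= subrr normr0 powR0 ?mulr0// gt_eqF.
  by split; exact: cvg_cst.
have nz : nonzero_on (@halfsp R n) f.
  rewrite /nonzero_on.
  have -> : @halfsp R n `&` [set x | f x != 0] = [set x | (0 < lastc n0 x) && (0 < f x)].
    apply/seteqP; split=> x; rewrite /halfsp/= (lastcE n0) [0 < f x]lt0r f0 andbT.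
      by case=> -> ->.
    by case/andP.
  have mb : measurable_fun [set: E] (fun x => (0 < lastc n0 x) && (0 < f x)).
    apply: bm_and; apply: bm_lt => //; try exact: rm_cst.
    exact: measurable_lastc.
  rewrite lebnE//; apply/eqP => H.
  suff : (\int[mu]_x (f x `^ p)%:E <= 0)%E by rewrite fP lee_fin leNgt P0.
  have M0 : 0 <= M `^ p by exact: powR_ge0.
  rewrite -[leRHS](mule0 (M `^ p)%:E) -H.
  have mc : mfunE (fun x => chi R ((0 < lastc n0 x) && (0 < f x))) by exact: rm_bool.
  rewrite -(igZ mu M0 mc (fun x => chi_ge0 _ _)); apply: ig_le.
  - by meas.
  - by apply: rmM => //; exact: rm_cst.
  move=> x; rewrite powR_ge0/=; have [->|fx] := eqVneq (f x) 0.
    by rewrite powR0 ?gt_eqF// mulr_ge0 ?chi_ge0.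
  rewrite (fs x fx) [0 < f x]lt0r fx f0 /chi mulr1.
  by apply: ge0_ler_powR; rewrite ?nnegrE ?(ltW p0) ?(le_trans (f0 x)).
have : (S_half n sg <= quot sg (@halfsp R n) f)%E.
  by apply: ereal_inf_lbound; exists f.
move=> /(le_trans sS); rewrite /quot LP (Iform_halfE n0)// poweR_EFin inver.
have Pt : 0 < P `^ theta by exact: powR_gt0.
rewrite (gt_eqF Pt) -(fineK (x := EnH 0 f)) ?ge0_fin_numE//.
by rewrite -EFinM !lee_fin -ler_pdivlMr ?invr_gt0// invrK.
Qed.

(* Mollify [w] at scale eps: Jensen bounds the energy on the smaller half-space, and
   the L^2 error O(eps^(2 sg)) controls the L^p error because [w] is bounded. *)
Lemma half_test (w : E -> R) (M rho P : R) : 0 < rho -> mfunE w ->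
  (forall x, 0 <= w x) -> (forall x, w x <= M) ->
  (forall x, w x != 0 -> vnorm (x - (2 * rho) *: evec R n0) <= rho) ->
  (En w < +oo)%E -> (\int[mu]_x (w x `^ p)%:E = P%:E)%E ->
  ((s * P `^ theta)%:E <= EnH (- rho) w)%E.
Proof.
move=> rho0 mw w0 wM ws ew wP.
have th := theta_gt0; have p0 := pexp_gt0 sg0 sgn; have p2 := pexp_gt2 sg0 sgn.
have E0 : (0 <= EnH (- rho) w)%E by apply: dint_ge0 => x y; exact: HQ_ge0.
have P0 : 0 <= P by rewrite -lee_fin -wP; apply: ig_ge0 => x; exact: powR_ge0.
have M0 : 0 <= M by exact: le_trans (w0 0) (wM 0).
have [s1|s1] := eqVneq s 0; first by rewrite s1 mul0r.
have {}s1 : 0 < s by rewrite lt0r s1.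
have Ele : (EnH (- rho) w <= En w)%E.
  apply: dint_le; [exact: mHQ|exact: mQ|move=> x y; rewrite HQ_ge0/=].
  apply: ler_piMl; first exact: Q_ge0.
  have h1 z : half (- rho) z <= 1.
    by rewrite /half /chi; case: (_ < _); rewrite ?lexx ?ler01.
  by apply: mulr_ile1; rewrite ?half_ge0 ?h1.
have Af : EnH (- rho) w \is a fin_num.
  by rewrite (ge0_fin_numE E0) (le_lt_trans Ele ew).
have ef : En w \is a fin_num by rewrite (ge0_fin_numE (En_ge0 sg w)).
rewrite -(fineK Af) lee_fin; set A := fine _.
have AE : EnH (- rho) w = A%:E by rewrite /A (fineK Af).
have A0 : 0 <= A by rewrite -lee_fin -AE.
pose e0 := fine (En w).
have e0E : En w = e0%:E by rewrite fineK.
have e00 : 0 <= e0 by rewrite -lee_fin -e0E En_ge0.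
have c0 : 0 < bump_cst R n by exact: bump_cst_gt0.
(* The largest p-th power integral that the half-space inequality allows for a mollification of w,
   whose energy is at most A. *)
pose L := (A / s) `^ theta^-1.
have As : 0 <= A / s by rewrite divr_ge0// ltW.
have L0 : 0 <= L by exact: powR_ge0.
(* From $|f-w|^p \le M^{p-2}|f-w|^2$ and [smooth_L2]: the error of mollification at scale $\epsilon$
   is at most $D \epsilon^{2\sigma}$. *)
pose D := M `^ (p - 2) * ((bump_cst R n)^-1 * e0).
have D0 : 0 <= D.
  apply: mulr_ge0; first exact: powR_ge0.
  by apply: mulr_ge0 => //; rewrite invr_ge0 ltW.
(* $\epsilon \le \rho/2$ keeps the support of the mollification, a ball of radius $\rho + \epsilon$
   centred at height $2\rho$, inside the open half-space. *)
have mollify eps t : 0 < eps -> eps <= rho / 2 -> 0 < t ->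
    P <= (1 + t) `^ p * L + (1 + t^-1) `^ p * (D * eps `^ (2 * sg)).
  move=> eps0 er t0; have er' : eps <= rho by lra.
  set f := smooth eps w.
  have mf : mfunE f by exact: (measurable_smooth n0 eps0 mw w0 wM).
  have f0 : forall x, 0 <= f x by exact: smooth_ge0.
  have fM : forall x, f x <= M by exact: (smooth_le n0 eps0 mw w0 wM).
  have cb := @cbump_gt0 R n n0 eps eps0.
  pose w' y := w y / cbump n eps.
  have mw' : mfunE w' by apply: rmM => //; exact: rm_cst.
  have w'0 x : 0 <= w' x by rewrite divr_ge0// ltW.
  have w'M x : w' x <= M / cbump n eps by rewrite ler_wpM2r// invr_ge0 ltW.
  have w's x : w' x != 0 -> vnorm (x - (2 * rho) *: evec R n0) <= rho.
    by move=> wx; apply: ws; apply: contraNN wx => /eqP wx; rewrite /w' wx mul0r.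
  (* [smooth] averages translates of w and is suited to Jensen; [moll] puts the variable x into the
     bump and can be differentiated. The normalisation goes into w'. *)
  have fmoll : f = moll eps w'.
    apply/funext => x; apply: EFin_inj.
    rewrite (mollE eps mw' w'0 w'M w's) (smoothE n0 eps0 mw w0 wM).
    pose h z := eta eps z * w (x - z).
    have mh : mfunE h.
      by apply: rmM; [exact: measurable_eta|exact: mfun_sub].
    rewrite -(mun_sub (f := h) x mh) => [|z]; last by rewrite mulr_ge0 ?eta_ge0.
    by apply: eq_integral => z _; rewrite /h subKr /eta /w'; congr EFin; ring.
  have bl : rho + eps < lastc n0 ((2 * rho) *: evec R n0).
    by rewrite lastc_evec; lra.
  have cf : C1c_half f.
    by rewrite fmoll; exact: (moll_C1c eps0 mw' w'0 w'M w's bl).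
  have fs x : f x != 0 -> 0 < lastc n0 x.
    rewrite fmoll => /(moll_supp eps0 w's) /(le_trans (lastc_norm n0 _)).
    by rewrite lastcB lastc_evec ler_norml => /andP[]; lra.
  have EnHf : (EnH 0 f <= A%:E)%E.
    by rewrite -AE; exact: (energyH_smooth n0 sg eps0 mw w0 wM er').
  have d2 : (\int[mu]_x ((f x - w x) ^+ 2)%:E <=
      ((bump_cst R n)^-1 * e0 * eps `^ (2 * sg))%:E)%E.
    apply: le_trans (smooth_L2 n0 sg0 eps0 mw w0 wM) _.
    by rewrite e0E -EFinM lee_fin /smooth_rate; lra.
  have md : mfunE (fun x => (f x - w x) ^+ 2) by meas.
  have ab x : `|f x - w x| <= M.
    rewrite ler_norml; have := f0 x; have := fM x; have := w0 x; have := wM x.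
    by move=> *; apply/andP; split; lra.
  have dp : (\int[mu]_x (`|f x - w x| `^ p)%:E <= (D * eps `^ (2 * sg))%:E)%E.
    apply: (@le_trans _ _ (\int[mu]_x (M `^ (p - 2) * (f x - w x) ^+ 2)%:E)%E).
      apply: ig_le; [by meas|by apply: rmM => //; exact: rm_cst|move=> x].
      rewrite powR_ge0/= -[(f x - w x) ^+ 2]real_normK ?num_real//.
      have [->|z0] := eqVneq `|f x - w x| 0.
        by rewrite powR0 ?gt_eqF// expr0n mulr0.
      have -> : `|f x - w x| `^ p = `|f x - w x| `^ (p - 2) * `|f x - w x| ^+ 2.
        rewrite -(powR_mulrn 2) ?normr_ge0// -powRD ?subrK//.
        by rewrite z0 implybT.
      apply: ler_wpM2r; first exact: sqr_ge0.
      by apply: ge0_ler_powR; rewrite ?nnegrE ?ab// subr_ge0 ltW.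
    rewrite (igZ mu (powR_ge0 _ _) md (fun x => sqr_ge0 _)).
    apply: le_trans (lee_wpmul2l _ d2) _; first by rewrite lee_fin powR_ge0.
    by rewrite -EFinM lee_fin /D; lra.
  have wfd x : w x `^ p <= (1 + t) `^ p * f x `^ p + (1 + t^-1) `^ p * `|f x - w x| `^ p.
    apply: le_trans (powR_split (f0 x) (normr_ge0 _) t0 p0).
    apply: ge0_ler_powR; rewrite ?nnegrE ?addr_ge0 ?(ltW p0)//.
    by rewrite addrC -lerBlDr distrC ler_norm.
  have fPf : (\int[mu]_x (f x `^ p)%:E < +oo)%E.
    have m1 : mfunE (fun x => w x `^ p) by meas.
    have m2 : mfunE (fun x => `|f x - w x| `^ p) by meas.
    have t1 : 0 <= (1 + t) `^ p by exact: powR_ge0.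
    have t2 : 0 <= (1 + t^-1) `^ p by exact: powR_ge0.
    apply: (@le_lt_trans _ _ (\int[mu]_x ((1 + t) `^ p * w x `^ p +
      (1 + t^-1) `^ p * `|f x - w x| `^ p)%:E)%E).
      apply: ig_le.
      - by meas.
      - by apply: rmD; apply: rmM => //; exact: rm_cst.
      move=> x; rewrite powR_ge0/=.
      apply: le_trans (powR_split (w0 x) (normr_ge0 (f x - w x)) t0 p0).
      apply: ge0_ler_powR; rewrite ?nnegrE ?addr_ge0 ?(ltW p0)//.
      by rewrite addrC -lerBlDr ler_norm.
    rewrite igD; last 4 first.
    - by apply: rmM => //; exact: rm_cst.
    - by apply: rmM => //; exact: rm_cst.
    - by move=> x; rewrite mulr_ge0 ?powR_ge0.
    - by move=> x; rewrite mulr_ge0 ?powR_ge0.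
    rewrite (igZ mu t1 m1 (fun x => powR_ge0 _ _)) (igZ mu t2 m2 (fun x => powR_ge0 _ _)).
    apply: lte_add_pinfty; first by rewrite wP -EFinM ltry.
    apply: le_lt_trans (lee_wpmul2l _ dp) _; first by rewrite lee_fin.
    by rewrite -EFinM ltry.
  have f00 : (0 <= \int[mu]_x (f x `^ p)%:E)%E by apply: ig_ge0 => x; exact: powR_ge0.
  pose Pf := fine (\int[mu]_x (f x `^ p)%:E).
  have PfE : (\int[mu]_x (f x `^ p)%:E = Pf%:E)%E by rewrite fineK// ge0_fin_numE.
  have Pf0 : 0 <= Pf by rewrite -lee_fin -PfE.
  have PfL : Pf <= L.
    have := C1c_test mf cf f0 fM fs (le_lt_trans EnHf (ltry _)) PfE.
    move=> /le_trans/(_ EnHf); rewrite lee_fin mulrC -ler_pdivlMr// => H.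
    have thn : theta != 0 by rewrite gt_eqF.
    rewrite -[Pf]powRr1// -(mulfV thn) powRrM.
    by apply: ge0_ler_powR; rewrite ?nnegrE ?powR_ge0// invr_ge0 ltW.
  have m1 : mfunE (fun x => f x `^ p) by meas.
  have m2 : mfunE (fun x => `|f x - w x| `^ p) by meas.
  have t1 : 0 <= (1 + t) `^ p by exact: powR_ge0.
  have t2 : 0 <= (1 + t^-1) `^ p by exact: powR_ge0.
  rewrite -lee_fin -wP.
  apply: (@le_trans _ _ (\int[mu]_x ((1 + t) `^ p * f x `^ p +
      (1 + t^-1) `^ p * `|f x - w x| `^ p)%:E)%E).
    apply: ig_le.
    - by meas.
    - by apply: rmD; apply: rmM => //; exact: rm_cst.
    by move=> x; rewrite powR_ge0/=.
  rewrite igD; last 4 first.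
  - by apply: rmM => //; exact: rm_cst.
  - by apply: rmM => //; exact: rm_cst.
  - by move=> x; rewrite mulr_ge0 ?powR_ge0.
  - by move=> x; rewrite mulr_ge0 ?powR_ge0.
  rewrite (igZ mu t1 m1 (fun x => powR_ge0 _ _)) (igZ mu t2 m2 (fun x => powR_ge0 _ _)).
  rewrite PfE -EFinM EFinD; apply: leeD.
    by rewrite lee_fin; apply: ler_wpM2l.
  by rewrite EFinM; apply: lee_wpmul2l.
have limit_eps t : 0 < t -> P <= (1 + t) `^ p * L.
  move=> t0; apply/ler_addgt0Pr => d d0.
  pose k := (1 + t^-1) `^ p * D.
  have k0 : 0 <= k by apply: mulr_ge0 => //; exact: powR_ge0.
  (* The second entry makes $k\epsilon^{2\sigma} \le kd/(k+1) \le d$. *)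
  pose eps := Num.min (rho / 2) ((d / (k + 1)) `^ (2 * sg)^-1).
  have sg2 : 0 < 2 * sg by exact: mulr_gt0.
  have q0 : 0 < d / (k + 1) by rewrite divr_gt0// ltr_wpDl.
  have eps0 : 0 < eps by rewrite lt_min divr_gt0//= powR_gt0.
  have er : eps <= rho / 2 by rewrite ge_min lexx.
  apply: le_trans (mollify eps t eps0 er t0) _.
  rewrite lerD2l mulrA -/k.
  have : eps `^ (2 * sg) <= d / (k + 1).
    apply: (@le_trans _ _ (((d / (k + 1)) `^ (2 * sg)^-1) `^ (2 * sg))).
      apply: ge0_ler_powR; rewrite ?nnegrE ?(ltW sg2) ?(ltW eps0) ?powR_ge0//.
      by rewrite ge_min lexx orbT.
    by rewrite -powRrM mulVf ?gt_eqF// powRr1// ltW.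
  move=> /(ler_wpM2l k0)/le_trans; apply.
  by rewrite mulrCA ler_piMr ?(ltW d0)// ler_pdivrMr ?ltr_wpDl// mul1r lerDl.
apply/ler_addgt0Pr => d d0.
(* For $t \le 1$ one has $(1+t)^2 \le 1 + 3t$, and then $3tA \le d$. *)
pose t := Num.min 1 (d / (3 * (A + 1))).
have A1 : 0 < 3 * (A + 1) by lra.
have t0 : 0 < t by rewrite lt_min ltr01/= divr_gt0.
have t1 : t <= 1 by rewrite ge_min lexx.
have t2 : 3 * (A + 1) * t <= d.
  by rewrite mulrC -ler_pdivlMr// ge_min lexx orbT.
have {limit_eps} H := limit_eps t t0.
have : P `^ theta <= (1 + t) ^+ 2 * (A / s).
  apply: (@le_trans _ _ (((1 + t) `^ p * L) `^ theta)).
    by apply: ge0_ler_powR; rewrite ?nnegrE ?(ltW th) ?mulr_ge0 ?powR_ge0.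
  rewrite powRM ?powR_ge0// -!powRrM pexp_theta (powR_mulrn 2) ?mulVf ?powRr1 ?gt_eqF//.
  by rewrite addr_ge0// ltW.
move=> /(ler_wpM2l s0)/le_trans; apply.
rewrite mulrCA [s * _]mulrC divfK ?gt_eqF//.
have : t ^+ 2 <= t by rewrite expr2 ler_piMl// ltW.
move=> tt; have : (1 + t) ^+ 2 <= 1 + 3 * t by lra.
move=> /(ler_wpM2r A0)/le_trans; apply.
lra.
Qed.
End half_space_test.

(** * The inequality for functions vanishing near a point *)

Section punctured_test.
Variables (R : realType) (n : nat).
Hypothesis n0 : (0 < n)%N.
Variable sg : R.
Hypotheses (sg0 : 0 < sg) (sg1 : sg < 1) (sgn : 2 * sg < n%:R).
Local Notation E := (n.-tuple R).
Local Notation mu := (mun R n).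
Local Notation Q := (@quad R n sg).
Local Notation En := (@energy R n sg).
Local Notation EnH := (@energyH R n n0 sg).
Local Notation mfunE u := (measurable_fun [set: E] u).
Local Notation p := (@pexp R n sg).
Local Notation theta := ((n%:R - 2 * sg) / n%:R).

Lemma quad_contract (f g : E -> R) x y :
  `|g x - g y| <= `|f x - f y| -> Q g x y <= Q f x y.
Proof.
move=> gf; apply: ler_wpM2r; first exact: Ker_ge0.
by rewrite -[leLHS]real_normK ?num_real// -[leRHS]real_normK ?num_real// ler_sqr ?nnegrE.
Qed.

Lemma energy_contract (f g : E -> R) : mfunE f -> mfunE g ->
  (forall x y, `|g x - g y| <= `|f x - f y|) -> (En g <= En f)%E.
Proof.
move=> mf mg gf; apply: dint_le; [exact: mQ|exact: mQ|move=> x y].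
by rewrite Q_ge0 quad_contract.
Qed.

Lemma energyH_contract t (f g : E -> R) : mfunE f -> mfunE g ->
  (forall x y, `|g x - g y| <= `|f x - f y|) -> (EnH t g <= EnH t f)%E.
Proof.
move=> mf mg gf; apply: dint_le; [exact: mHQ|exact: mHQ|move=> x y].
by rewrite HQ_ge0/= ler_wpM2l ?half2_ge0// quad_contract.
Qed.

Lemma energyH_le t (w : E -> R) : mfunE w -> (EnH t w <= En w)%E.
Proof.
move=> mw; apply: dint_le; [exact: mHQ|exact: mQ|move=> x y; rewrite HQ_ge0/=].
apply: ler_piMl; first exact: Q_ge0.
have h1 z : half n0 t z <= 1.
  by rewrite /half /chi; case: (_ < _); rewrite ?lexx ?ler01.
by apply: mulr_ile1; rewrite ?half_ge0 ?h1.
Qed.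

Variable s : R.
Hypotheses (s0 : 0 <= s) (sS : (s%:E <= S_half n sg)%E).

(** Truncation at height k is a contraction, so the energies do not grow and the bound L on the p-th
    power integrals is uniform in k; it passes to the monotone limit. *)
Lemma half_test_unbounded (w : E -> R) (rho P : R) : 0 < rho -> mfunE w ->
  (forall x, 0 <= w x) ->
  (forall x, w x != 0 -> vnorm (x - (2 * rho) *: evec R n0) <= rho) ->
  (En w < +oo)%E -> (\int[mu]_x (w x `^ p)%:E = P%:E)%E ->
  ((s * P `^ theta)%:E <= EnH (- rho) w)%E.
Proof.
move=> rho0 mw w0 ws ew wP.
have th := theta_gt0 n0 sgn; have p0 := pexp_gt0 sg0 sgn.
have E0 : (0 <= EnH (- rho) w)%E by apply: dint_ge0 => x y; exact: HQ_ge0.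
have P0 : 0 <= P by rewrite -lee_fin -wP; apply: ig_ge0 => x; exact: powR_ge0.
have [s1|s1] := eqVneq s 0; first by rewrite s1 mul0r.
have {}s1 : 0 < s by rewrite lt0r s1.
have Af : EnH (- rho) w \is a fin_num.
  by rewrite (ge0_fin_numE E0) (le_lt_trans (energyH_le _ mw) ew).
rewrite -(fineK Af) lee_fin; set A := fine _.
have AE : EnH (- rho) w = A%:E by rewrite /A (fineK Af).
have A0 : 0 <= A by rewrite -lee_fin -AE.
have As : 0 <= A / s by rewrite divr_ge0// ltW.
pose L := (A / s) `^ theta^-1.
have thn : theta != 0 by rewrite gt_eqF.
pose g (k : nat) x := Num.min (w x) k%:R.
have mg k : mfunE (g k) by apply: rm_min => //; exact: rm_cst.
have g0 k x : 0 <= g k x by rewrite le_min w0/=.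
have gM k x : g k x <= k%:R by rewrite ge_min lexx orbT.
have gw k x : g k x <= w x by rewrite ge_min lexx.
have gc k x y : `|g k x - g k y| <= `|w x - w y|.
  rewrite /g; case: (leP (w x) k%:R) => h1; case: (leP (w y) k%:R) => h2 //.
  - by rewrite [leLHS]distrC [leRHS]distrC !ger0_norm; lra.
  - by rewrite !ger0_norm; lra.
  - by rewrite subrr normr0.
have gp k x : 0 <= g k x `^ p <= w x `^ p.
  rewrite powR_ge0/=; apply: ge0_ler_powR; rewrite ?nnegrE ?(ltW p0)//.
have Pk k : (\int[mu]_x (g k x `^ p)%:E <= L%:E)%E.
  have mgp : mfunE (fun x => g k x `^ p) by have := mg k => ?; meas.
  have wp : mfunE (fun x => w x `^ p) by meas.
  have fin : (\int[mu]_x (g k x `^ p)%:E)%E \is a fin_num.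
    rewrite ge0_fin_numE; last by apply: ig_ge0 => x; exact: powR_ge0.
    by rewrite (le_lt_trans (ig_le mu mgp wp (gp k)))// wP ltry.
  have gs x : g k x != 0 -> vnorm (x - (2 * rho) *: evec R n0) <= rho.
    move=> gx; apply: ws; apply: contraNN gx => /eqP wx.
    by rewrite /g wx; apply/eqP/min_idPl.
  have := half_test sg0 sgn s0 sS rho0 (mg k) (g0 k) (gM k) gs
    (le_lt_trans (energy_contract mw (mg k) (gc k)) ew) (esym (fineK fin)).
  move=> /le_trans/(_ (energyH_contract (- rho) mw (mg k) (gc k))).
  rewrite AE lee_fin mulrC -ler_pdivlMr// => H.
  rewrite -(fineK fin) lee_fin -[leLHS]powRr1; last first.
    by rewrite -lee_fin fineK//; apply: ig_ge0 => x; exact: powR_ge0.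
  rewrite -(mulfV thn) powRrM.
  by apply: ge0_ler_powR; rewrite ?nnegrE ?powR_ge0// invr_ge0 ltW.
have PL : P <= L.
  rewrite -lee_fin -wP; apply: (@ig_limit _ _ _ mu _ (fun k x => g k x `^ p)) => //.
  - by move=> k; have := mg k => ?; meas.
  - by move=> k x; exact: powR_ge0.
  - move=> x k l kl; apply: ge0_ler_powR; rewrite ?nnegrE ?(ltW p0)//.
    by rewrite le_min ge_min lexx/= ge_min ler_nat kl orbT.
  - move=> x; exists (Num.truncn (w x)).+1 => l xl; congr (_ `^ p).
    apply/min_idPl; apply: (@le_trans _ _ (Num.truncn (w x)).+1%:R).
      by rewrite ltW// truncnS_gt.
    by rewrite ler_nat.
rewrite mulrC -ler_pdivlMr//.
apply: (@le_trans _ _ (L `^ theta)).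
  by apply: ge0_ler_powR; rewrite ?nnegrE ?powR_ge0// ltW.
by rewrite -powRrM mulVf// powRr1.
Qed.

(* Kelvin transform about [a], followed by a translation that moves the support
   into the half-space at depth 1/r. *)
Lemma punctured_test (u : E -> R) (a : E) (r P : R) : 0 < r -> mfunE u ->
  (forall x, 0 <= u x) -> (forall x, vnorm (x - a) < r -> u x = 0) ->
  (\int[mu]_x (u x ^+ 2)%:E < +oo)%E -> (En u < +oo)%E ->
  (\int[mu]_x (u x `^ p)%:E = P%:E)%E ->
  ((s * P `^ theta)%:E + (cpot n sg * r `^ (2 * sg))%:E *
     \int[mu]_x (u x ^+ 2 / (vnorm (x - a) `^ (2 * sg)) ^+ 2)%:E <= En u)%E.
Proof.
move=> r0 mu_ u0 ur u2 eu uP.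
have p0 := pexp_gt0 sg0 sgn.
pose U x := u (x + a).
have mU : mfunE U by exact: mfun_shift.
have U0 x : vnorm x < r -> U x = 0 by move=> xr; apply: ur; rewrite addrK.
have U2 : (\int[mu]_x (U x ^+ 2)%:E < +oo)%E.
  by rewrite (mun_shiftR (f := fun x => u x ^+ 2) _ _ a)//; [meas|move=> x; exact: sqr_ge0].
have EU : En U = En u by exact: energy_shift.
pose k := kelvin sg U; have mk : mfunE k by exact: measurable_kelvin.
have Ek : (En k <= En u)%E by rewrite -EU; exact: (kelvin_energy n0 sg0 sg1 sgn mU r0 U0 U2).
have k0 x : 0 <= k x by apply: mulr_ge0; [exact: riesz_ge0|exact: u0].
pose rho := 1 / r; have rho0 : 0 < rho by rewrite divr_gt0.
pose b := (2 * rho) *: evec R n0.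
pose W x := k (x + - b).
have mW : mfunE W by exact: mfun_shift.
have EW : En W = En k by exact: energy_shift.
have Ws x : W x != 0 -> vnorm (x - b) <= rho by exact: (kelvin_supp sgn r0 U0).
have WP : (\int[mu]_x (W x `^ p)%:E = P%:E)%E.
  rewrite (mun_shiftR (f := fun x => k x `^ p) _ _ (- b)); last 2 first.
  - by meas.
  - by move=> x; exact: powR_ge0.
  transitivity (\int[mu]_x (`|k x| `^ p)%:E)%E.
    by apply: eq_integral => x _; rewrite (ger0_norm (k0 x)).
  apply: etrans (kelvin_intp n0 sg0 sgn mU) _; rewrite -uP.
  rewrite -(mun_shiftR (f := fun x => u x `^ p) _ _ a); last 2 first.
  - by meas.
  - by move=> x; exact: powR_ge0.
  by apply: eq_integral => x _; rewrite (ger0_norm (u0 _)).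
have W2 : (\int[mu]_x (W x ^+ 2)%:E =
    \int[mu]_x (u x ^+ 2 / (vnorm (x - a) `^ (2 * sg)) ^+ 2)%:E)%E.
  rewrite (mun_shiftR (f := fun x => k x ^+ 2) _ _ (- b)); last 2 first.
  - by meas.
  - by move=> x; exact: sqr_ge0.
  apply: etrans (kelvin_int2 n0 sgn mU) _.
  have mf : mfunE (fun x => u x ^+ 2 / (vnorm (x - a) `^ (2 * sg)) ^+ 2) by meas.
  have f0 x : 0 <= u x ^+ 2 / (vnorm (x - a) `^ (2 * sg)) ^+ 2.
    by rewrite divr_ge0 ?sqr_ge0.
  apply: etrans _ (mun_shiftR mf f0 a).
  by apply: eq_integral => x _; rewrite addrK.
have G := potential_gain sg0 rho0 mW Ws.
have eW : (En W < +oo)%E by rewrite EW (le_lt_trans Ek).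
have H := half_test_unbounded rho0 mW (fun x => k0 _) Ws eW WP.
have {}G := le_trans G (eq_ind_r (fun z => (z <= En u)%E) Ek EW).
apply: le_trans G; rewrite W2; apply: leeD; first exact: H.
apply: lee_wpmul2r; first by apply: ig_ge0 => x; rewrite divr_ge0 ?sqr_ge0.
rewrite lee_fin /rho mul1r -(powR_inv1 (ltW r0)) -powRrM mulN1r.
by rewrite powRN invrK.
Qed.
End punctured_test.

(** * Averaging over the puncture *)

Section averaging.
Variables (R : realType) (n : nat).
Hypothesis n0 : (0 < n)%N.
Variable sg : R.
Hypotheses (sg0 : 0 < sg) (sg1 : sg < 1) (sgn : 2 * sg < n%:R) (sg4 : 4 * sg <= n%:R).
Local Notation E := (n.-tuple R).
Local Notation mu := (mun R n).
Local Notation Q := (@quad R n sg).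
Local Notation En := (@energy R n sg).
Local Notation mfunE u := (measurable_fun [set: E] u).
Local Notation p := (@pexp R n sg).
Local Notation theta := ((n%:R - 2 * sg) / n%:R).

Lemma measurable_ball_diff (c : R) : mfun2 (fun a x : E => chi R (vnorm (x - a) < c)).
Proof. by rewrite /mfun2; meas. Qed.

Lemma measurable_ball_avg (q : E -> \bar R) (c : R) : measurable_fun [set: E] q ->
  (forall x, 0 <= q x)%E ->
  measurable_fun [set: E * E] (fun z => (chi R (vnorm (z.2 - z.1) < c))%:E * q z.2)%E.
Proof.
move=> mq q0; apply: emeasurable_funM.
  by apply: em_EFin; exact: measurable_ball_diff.
by apply: measurableT_comp.
Qed.

Lemma ball_avg (q : E -> \bar R) (c : R) : 0 < c -> measurable_fun [set: E] q ->
  (forall x, 0 <= q x)%E ->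
  (\int[mu]_a \int[mu]_x ((chi R (vnorm (x - a) < c)%R)%:E * q x) =
   (c ^+ n * bvol R n)%:E * \int[mu]_x q x)%E.
Proof.
move=> c0 mq q0.
pose f (z : E * E) := ((chi R (vnorm (z.2 - z.1) < c))%:E * q z.2)%E.
have mf : measurable_fun [set: E * E] f by exact: measurable_ball_avg.
have f0 z : (0 <= f z)%E by rewrite mule_ge0// lee_fin chi_ge0.
transitivity (\int[mu]_x \int[mu]_a f (a, x))%E.
  exact: (fubini_tonelli f mf f0).
have c1 : 0 <= c ^+ n * bvol R n.
  by rewrite mulr_ge0 ?exprn_ge0 ?(ltW c0)// ltW// bvol_gt0.
rewrite -ge0_integralZl_EFin//; apply: eq_integral => x _.
rewrite /f/= ge0_integralZr//.
- have -> : (\int[mu]_a (chi R (vnorm (x - a) < c)%R)%:E = (c ^+ n * bvol R n)%:E)%E.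
    by rewrite -(mu_ball x c0); apply: eq_integral => a _; rewrite vnormB.
  by [].
- by apply: em_EFin; meas.
- by move=> a _; rewrite lee_fin chi_ge0.
Qed.

Variable v : E -> R.
Hypothesis mv : mfunE v.
Hypothesis v0 : forall x, 0 <= v x.
Hypothesis v2 : (\int[mu]_x (v x ^+ 2)%:E < +oo)%E.
Hypothesis vp : (\int[mu]_x (v x `^ p)%:E = 1)%E.
Variables (s e : R).
Hypotheses (s0 : 0 <= s) (sS : (s%:E <= S_half n sg)%E).
Hypothesis ve : En v = e%:E.
Variable r : R.
Hypotheses (r0 : 0 < r) (r1 : 2 * r <= 1).

Let nb (a x : E) := chi R (vnorm (x - a) < 2 * r).

(** T, D and B are the shares of $B_{2r}(a)$ in the p-th power integral, the energy and the squared
    $L^2$ norm of v: together they are the price of the cut-off. *)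
Let T (a : E) := (\int[mu]_x ((nb a x)%:E * (v x `^ p)%:E))%E.
Let D (a : E) := (\int[mu]_x ((nb a x)%:E * \int[mu]_y (Q v x y)%:E))%E.
Let B (a : E) := (\int[mu]_x ((nb a x)%:E * (v x ^+ 2)%:E))%E.
Let c := 4 * Cm n sg / r `^ (2 * sg).
Let kap := cpot n sg * r `^ (2 * sg).

Let p0 : 0 < p. Proof. exact: pexp_gt0. Qed.

Let mnb a : mfunE (nb a). Proof. by rewrite /nb; meas. Qed.

(** Compare [punctured_test] for the cut-off function with [cutoff_energy]. The result is linear in
    the losses at a, so that it can be integrated over a. *)
Lemma cutoff_test a :
  (s%:E + kap%:E * \int[mu]_x ((v x * hat a r x) ^+ 2 /
      (vnorm (x - a) `^ (2 * sg)) ^+ 2)%:E <=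
   e%:E + (s%:E * T a + (2%:E * D a + c%:E * B a)))%E.
Proof.
pose u x := v x * hat a r x.
have mh := measurable_hat a r; have mna := mnb a.
have mu_ : mfunE u by rewrite /u; meas.
have mvp : mfunE (fun x => v x `^ p) by meas.
have mup : mfunE (fun x => u x `^ p) by meas.
have u0 x : 0 <= u x by apply: mulr_ge0 => //; exact: hat_ge0.
have uv x : u x <= v x by apply: ler_piMr => //; exact: hat_le1.
have ur x : vnorm (x - a) < r -> u x = 0.
  by move=> xr; rewrite /u hat0 ?mulr0// ltW.
have u2 : (\int[mu]_x (u x ^+ 2)%:E < +oo)%E.
  apply: le_lt_trans v2; apply: ig_le; [by meas|by meas|move=> x].
  by rewrite sqr_ge0/= ler_sqr ?nnegrE.
have uvp x : 0 <= u x `^ p <= v x `^ p.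
  by rewrite powR_ge0/=; apply: ge0_ler_powR; rewrite ?nnegrE ?(ltW p0).
have nb01 x : 0 <= nb a x <= 1.
  by rewrite /nb /chi; case: (_ < _); rewrite ?ler01 ?lexx.
have D_dint : dint mu (fun x y => nb a x * Q v x y) = D a.
  apply: eq_integral => x _.
  exact: (igZ mu (chi_ge0 R _) (mfun2_r x (mQ sg mv)) (fun y => Q_ge0 _ _ _ _)).
have B_int : (\int[mu]_x (nb a x * v x ^+ 2)%:E = B a)%E.
  by apply: eq_integral => x _; rewrite EFinM.
have T_int : (\int[mu]_x (nb a x * v x `^ p)%:E = T a)%E.
  by apply: eq_integral => x _; rewrite EFinM.
have T1 : (T a <= 1)%E.
  rewrite -T_int -vp; apply: ig_le => //; first by meas.
  move=> x; have /andP[h1 h2] := nb01 x; rewrite mulr_ge0 ?powR_ge0//=.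
  by apply: ler_piMl => //; exact: powR_ge0.
have T0 : (0 <= T a)%E.
  by rewrite -T_int; apply: ig_ge0 => x; rewrite mulr_ge0 ?powR_ge0 ?chi_ge0.
have Tf : T a \is a fin_num by rewrite ge0_fin_numE// (le_lt_trans T1)// ltry.
have Df : (D a < +oo)%E.
  rewrite -D_dint; apply: (@le_lt_trans _ _ (En v)); last by rewrite ve ltry.
  apply: dint_le; [|exact: mQ|].
    by apply: mfun2M; [exact: mfun2_1|exact: mQ].
  move=> x y; have /andP[h1 h2] := nb01 x; rewrite mulr_ge0 ?Q_ge0//=.
  by apply: ler_piMl => //; exact: Q_ge0.
have Bf : (B a < +oo)%E.
  rewrite -B_int; apply: le_lt_trans v2; apply: ig_le; [by meas|by meas|].
  move=> x; have /andP[h1 h2] := nb01 x; rewrite mulr_ge0 ?sqr_ge0//=.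
  by apply: ler_piMl => //; exact: sqr_ge0.
have cut := cutoff_energy n0 sg0 sg1 a mv r0.
rewrite -/(nb a) D_dint B_int ve -/c -/u -addeA in cut.
have c0 : 0 <= c.
  by rewrite divr_ge0 ?powR_ge0// mulr_ge0// Cm_ge0.
have eu : (En u < +oo)%E.
  apply: (le_lt_trans cut); apply: lte_add_pinfty; first exact: ltry.
  by apply: lte_add_pinfty; apply: lte_mul_pinfty => //; rewrite lee_fin.
have Pf : (\int[mu]_x (u x `^ p)%:E)%E \is a fin_num.
  rewrite ge0_fin_numE; last by apply: ig_ge0 => x; exact: powR_ge0.
  by rewrite (le_lt_trans (ig_le mu mup mvp uvp))// vp ltry.
set P := fine (\int[mu]_x (u x `^ p)%:E).
have PE : (\int[mu]_x (u x `^ p)%:E = P%:E)%E by rewrite fineK.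
have P1 : P <= 1 by rewrite -lee_fin -PE -vp; exact: ig_le.
have P0 : 0 <= P by rewrite -lee_fin -PE; apply: ig_ge0 => x; exact: powR_ge0.
set t := fine (T a); have TE : T a = t%:E by rewrite fineK.
have Pt : 1 <= P + t.
  rewrite -lee_fin EFinD -PE -TE -vp -T_int -igD//; last 3 first.
  - by meas.
  - by move=> x; exact: powR_ge0.
  - by move=> x; rewrite mulr_ge0 ?powR_ge0 ?chi_ge0.
  apply: ig_le => //; first by apply: rmD => //; meas.
  move=> x; rewrite powR_ge0/= /nb.
  have [xa|xa] := ltP (vnorm (x - a)) (2 * r).
    by rewrite /chi mul1r lerDr powR_ge0.
  by rewrite /chi mul0r addr0 /u hat1// mulr1.
(* Both P and theta are at most one. With $P \ge 1 - T(a)$ the nonlinear term $sP^\theta$ is bounded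
   below by $s - sT(a)$. *)
have PP : P <= P `^ theta.
  have [->|Pn] := eqVneq P 0; first by rewrite powR_ge0.
  rewrite -[leLHS]powRr1//; apply: ger_powR; first by rewrite lt0r Pn P0 P1.
  rewrite ler_pdivrMr ?ltr0n// mul1r gerBl.
  by rewrite mulr_ge0// ltW.
have H := punctured_test n0 sg0 sg1 sgn s0 sS r0 mu_ u0 ur u2 eu PE.
have {}H := le_trans H cut.
rewrite addeCA TE; rewrite -/kap in H.
apply: (@le_trans _ _ ((s * t)%:E + ((s * P `^ theta)%:E +
    kap%:E * \int[mu]_x (u x ^+ 2 / (vnorm (x - a) `^ (2 * sg)) ^+ 2)%:E))%E).
  rewrite addeA; apply: leeD => //; rewrite -EFinD lee_fin -mulrDr.
  by apply: ler_peMr => //; lra.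
by rewrite -EFinM; apply: leeD.
Qed.


(** From here on [shell] is the weight of the gain on an annulus. Beyond the inner radius 2r the
    cut-off equals one; the outer radius 1, together with $|x| < 1$, forces $|a| < 2$. *)
Let shell (z : E) := chi R ((2 * r < vnorm z) && (vnorm z < 1)) / (vnorm z `^ (2 * sg)) ^+ 2.

Let mshell : mfunE shell. Proof. by rewrite /shell; meas. Qed.

Let shell_ge0 z : 0 <= shell z.
Proof. by apply: divr_ge0; [exact: chi_ge0|exact: sqr_ge0]. Qed.

(** On the annulus $|z|^{-4\sigma} = |z|^{n-4\sigma}|z|^{-n} \ge (2r)^{n-4\sigma}|z|^{-n}$, where
    the assumption $n \ge 4\sigma$ enters; [log_shell] integrates the rest. *)
Lemma shell_weight : (((2 * r) `^ (n%:R - 4 * sg) * (om R n * - ln (2 * r)))%:E <=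
  \int[mu]_z (shell z)%:E)%E.
Proof.
have r2 : 0 < 2 * r by exact: mulr_gt0.
have := log_shell n0 r2 r1; rewrite ln1 sub0r => L.
rewrite EFinM -L -(igZ mu (powR_ge0 _ _)); last 2 first.
- by meas.
- by move=> z; rewrite divr_ge0 ?chi_ge0// exprn_ge0// vnorm_ge0.
apply: ig_le => //; first by meas.
move=> z; apply/andP; split.
  apply: mulr_ge0; first exact: powR_ge0.
  by rewrite divr_ge0 ?chi_ge0// exprn_ge0// vnorm_ge0.
rewrite /shell; have [/andP[z1 z2]|_] := boolP ((2 * r < vnorm z) && (vnorm z < 1)).
  have z0 : 0 < vnorm z by exact: lt_trans z1.
  rewrite /chi /= !mul1r.
  have -> : (vnorm z `^ (2 * sg)) ^+ 2 = vnorm z `^ (4 * sg).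
    by rewrite -(powR_mulrn 2) ?powR_ge0// -powRrM; congr (_ `^ _); ring.
  have q : 0 < vnorm z `^ (4 * sg) by exact: powR_gt0.
  have q' : 0 < vnorm z ^+ n by exact: exprn_gt0.
  rewrite -[leRHS]mul1r ler_pdivlMr// mulrAC ler_pdivrMr// mul1r.
  have -> : vnorm z ^+ n = vnorm z `^ (n%:R - 4 * sg) * vnorm z `^ (4 * sg).
    rewrite -powRD ?subrK ?powR_mulrn ?vnorm_ge0//.
    by apply/implyP => _; rewrite gt_eqF.
  apply: ler_wpM2r; first exact: ltW.
  apply: ge0_ler_powR; rewrite ?nnegrE ?(ltW r2) ?(ltW z0) ?(ltW z1)//.
  by rewrite subr_ge0.
by rewrite /chi !mul0r mulr0.
Qed.

(** $v^2 \le 1 + v^p$ pointwise. The $L^2$ norm of v is finite but not controlled, whereas this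
    local bound depends on n only. The radius 3 is enough because $|a| < 2$ and $|x - a| < 2r \le
    1$. *)
Lemma ball_mass_bound :
  (\int[mu]_x (chi R (vnorm x < 3)%R * v x ^+ 2)%:E <= (3 ^+ n * bvol R n + 1)%:E)%E.
Proof.
have mvp : mfunE (fun x => v x `^ p) by meas.
have mb3 : mfunE (fun x => chi R (vnorm x < 3)) by meas.
have h3 : (0 : R) < 3 by [].
rewrite EFinD -vp -(mu_ball0 n h3).
rewrite -(igD mu mb3 mvp (fun x => chi_ge0 _ _) (fun x => powR_ge0 _ _)).
apply: ig_le; [by meas|by apply: rmD|move=> x].
rewrite mulr_ge0 ?chi_ge0 ?sqr_ge0//=.
have [x3|_] := boolP (vnorm x < 3); last by rewrite /chi mul0r add0r powR_ge0.
rewrite /chi mul1r; have [vx|vx] := leP (v x) 1.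
  have : v x ^+ 2 <= 1 by rewrite expr_le1.
  by move=> h; rewrite (le_trans h)// lerDl powR_ge0.
apply: (@le_trans _ _ (v x `^ p)); last by rewrite lerDr.
rewrite -(powR_mulrn 2)//; apply: ler_powR; first exact: ltW.
by apply: ltW; exact: pexp_gt2.
Qed.

Let chi2 (a : E) := chi R (vnorm a < 2).
Let F (a x : E) := chi R (vnorm x < 1) * v x ^+ 2 * shell (x - a).
Let H (a : E) := (\int[mu]_x (F a x)%:E)%E.
Let q3 (x : E) := ((chi R (vnorm x < 3) * v x ^+ 2)%:E)%E.
Let B3 (a : E) := (\int[mu]_x ((nb a x)%:E * q3 x))%E.

Let F_ge0 a x : 0 <= F a x.
Proof.
apply: mulr_ge0; last exact: shell_ge0.
by apply: mulr_ge0; [exact: chi_ge0|exact: sqr_ge0].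
Qed.

Let mF : mfun2 F.
Proof. by have := mshell; rewrite /mfun2 /F => ?; meas. Qed.

Let e0 : 0 <= e.
Proof. by rewrite -lee_fin -ve En_ge0. Qed.

Let c_ge0 : 0 <= c.
Proof. by rewrite divr_ge0 ?powR_ge0// mulr_ge0// Cm_ge0. Qed.

Let kap_ge0 : 0 <= kap.
Proof. by apply: mulr_ge0; [exact/ltW/cpot_gt0|exact: powR_ge0]. Qed.

Let nbE_ge0 (q : E -> \bar R) a : (forall x, 0 <= q x)%E ->
  (0 <= \int[mu]_x ((nb a x)%:E * q x))%E.
Proof. by move=> q0; apply: integral_ge0 => x _; rewrite mule_ge0// lee_fin chi_ge0. Qed.

Let qT_ge0 x : (0 <= (v x `^ p)%:E)%E. Proof. by rewrite lee_fin powR_ge0. Qed.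
Let qD_ge0 x : (0 <= \int[mu]_y (Q v x y)%:E)%E. Proof. by apply: ig_ge0 => y; exact: Q_ge0. Qed.
Let q3_ge0 x : (0 <= q3 x)%E. Proof. by rewrite lee_fin mulr_ge0 ?chi_ge0 ?sqr_ge0. Qed.

(** For $|a| \ge 2$ the left side is zero, so the inequality holds for every a and can be integrated
    over the whole space. *)
Lemma averaged_pointwise a :
  ((s * chi2 a)%:E + kap%:E * H a <=
   (e * chi2 a)%:E + (s%:E * T a + (2%:E * D a + c%:E * B3 a)))%E.
Proof.
have T0 : (0 <= T a)%E by exact: nbE_ge0.
have D0 : (0 <= D a)%E by exact: nbE_ge0.
have B0 : (0 <= B3 a)%E by exact: nbE_ge0.
have mna := mnb a; have mh := measurable_hat a r.
have [a2|a2] := ltP (vnorm a) 2; last first.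
  have -> : H a = 0%E.
    apply: integral0_eq => x _; congr EFin; rewrite /F /shell /chi.
    case: (ltP (vnorm x) 1) => x1; last by rewrite !mul0r.
    case: (ltP (vnorm (x - a)) 1) => xa; last by rewrite andbF mul0r mulr0.
    by have := vnorm_tri a x 0; rewrite !subr0 vnormB; lra.
  have -> : chi2 a = 0 by rewrite /chi2 /chi ltNge a2.
  rewrite !mulr0 mule0 adde0 add0e; apply: adde_ge0; first by rewrite mule_ge0// lee_fin.
  by apply: adde_ge0; rewrite mule_ge0// lee_fin.
have -> : chi2 a = 1 by rewrite /chi2 /chi a2.
rewrite !mulr1.
apply: le_trans (le_trans (cutoff_test a) _).
  apply: leeD => //; apply: lee_wpmul2l; first by rewrite lee_fin.
  apply: ig_le; [exact: (mfun2_r a mF)|by meas|move=> x].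
  rewrite F_ge0/= /F /shell.
  case: (ltP (vnorm x) 1) => x1; last first.
    by rewrite /chi !mul0r divr_ge0 ?sqr_ge0.
  case: (ltP (2 * r) (vnorm (x - a))) => xa; last first.
    by rewrite /chi/= mul0r mulr0 divr_ge0 ?sqr_ge0.
  case: (ltP (vnorm (x - a)) 1) => x2; last first.
    by rewrite /chi/= mul0r mulr0 divr_ge0 ?sqr_ge0.
  by rewrite /chi/= mul1r div1r (hat1 r0 (ltW xa)) mulr1.
apply: leeD => //; apply: leeD => //; apply: leeD => //.
apply: lee_wpmul2l; first by rewrite lee_fin.
apply: eg_le.
- by apply: emeasurable_funM; apply: em_EFin => //; meas.
- by apply: emeasurable_funM; apply: em_EFin => //; meas.
- by move=> x; rewrite mule_ge0// lee_fin ?chi_ge0 ?sqr_ge0.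
move=> x; rewrite /q3 -!EFinM lee_fin /nb.
have [xa|_] := boolP (vnorm (x - a) < 2 * r); last by rewrite /chi !mul0r.
have -> : vnorm x < 3.
  have := vnorm_tri x a 0; rewrite !subr0 => /le_lt_trans; apply.
  apply: (lt_le_trans (ltrD xa a2)).
  by rewrite -lerBrDr (le_trans r1)// lerBrDr -natr1.
by rewrite /chi !mul1r.
Qed.

(** By [ball_avg] each loss integrates over a to $(2r)^n$ times the unit ball volume times a global
    quantity, while the defect $e - s$ is multiplied by the volume of $B_2$. *)
Lemma averaged_test (c0 : R) : 0 <= c0 ->
  (c0%:E <= \int[mu]_x (chi R (vnorm x < 1)%R * v x ^+ 2)%:E)%E ->
  kap * (c0 * ((2 * r) `^ (n%:R - 4 * sg) * (om R n * - ln (2 * r)))) <=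
  (e - s) * (2 ^+ n * bvol R n) + (2 * r) ^+ n * bvol R n * (s + 2 * e) +
  c * ((2 * r) ^+ n * bvol R n * (3 ^+ n * bvol R n + 1)).
Proof.
move=> c00 cv1.
have r2 : 0 < 2 * r by exact: mulr_gt0.
have mvp : mfunE (fun x => v x `^ p) by meas.
have mb3 : mfunE (fun x => chi R (vnorm x < 3) * v x ^+ 2) by meas.
have mch : mfunE chi2 by rewrite /chi2; meas.
have V2 : (\int[mu]_a (chi2 a)%:E = (2 ^+ n * bvol R n)%:E)%E by exact: mu_ball0.
have bv := bvol_gt0 R n0.
have V0 : 0 <= (2 * r) ^+ n * bvol R n.
  by rewrite mulr_ge0 ?exprn_ge0 ?(ltW r2)// ltW.
have mavg (q : E -> \bar R) : measurable_fun [set: E] q -> (forall x, 0 <= q x)%E ->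
    measurable_fun [set: E] (fun a => \int[mu]_x ((nb a x)%:E * q x))%E.
  move=> mq q0; apply: (measurable_fun_fubini_tonelli_F (m2 := mu)
    (fun z : E * E => ((nb z.1 z.2)%:E * q z.2)%E)).
    exact: measurable_ball_avg.
  by move=> z; rewrite mule_ge0// lee_fin chi_ge0.
have mqT : measurable_fun [set: E] (fun x => (v x `^ p)%:E) by exact: em_EFin.
have mqD : measurable_fun [set: E] (fun x => \int[mu]_y (Q v x y)%:E)%E.
  by apply: (measurable_inner mu (mQ sg mv)) => x y; exact: Q_ge0.
have mq3 : measurable_fun [set: E] q3 by exact: em_EFin.
have mT : measurable_fun [set: E] T by exact: mavg.
have mD : measurable_fun [set: E] D by exact: mavg.
have mB : measurable_fun [set: E] B3 by exact: mavg.
have mH : measurable_fun [set: E] H by exact: (measurable_inner mu mF F_ge0).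
have T0 a : (0 <= T a)%E by exact: nbE_ge0.
have D0 a : (0 <= D a)%E by exact: nbE_ge0.
have B0 a : (0 <= B3 a)%E by exact: nbE_ge0.
have H0 a : (0 <= H a)%E by exact: ig_ge0.
have IT : (\int[mu]_a T a = ((2 * r) ^+ n * bvol R n)%:E)%E.
  by rewrite (ball_avg r2 mqT qT_ge0) vp mule1.
have ID : (\int[mu]_a D a = ((2 * r) ^+ n * bvol R n)%:E * e%:E)%E.
  by rewrite (ball_avg r2 mqD qD_ge0) -ve.
have IB : (\int[mu]_a B3 a <=
    ((2 * r) ^+ n * bvol R n * (3 ^+ n * bvol R n + 1))%:E)%E.
  rewrite (ball_avg r2 mq3 q3_ge0) [leRHS]EFinM; apply: lee_wpmul2l; first by rewrite lee_fin.
  exact: ball_mass_bound.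
(* By Tonelli the integrated gain is the product of the integral of $v^2$ over $B_1$ and of the
   annular weight; the hypothesis bounds the first factor, [shell_weight] the second. *)
have IH : ((c0 * ((2 * r) `^ (n%:R - 4 * sg) * (om R n * - ln (2 * r))))%:E <=
    \int[mu]_a H a)%E.
  have -> : (\int[mu]_a H a = \int[mu]_x (chi R (vnorm x < 1)%R * v x ^+ 2)%:E *
      \int[mu]_z (shell z)%:E)%E.
    rewrite (tonelli mu mu mF F_ge0) -ge0_integralZr//; last 3 first.
    - by apply: em_EFin; meas.
    - by move=> x _; rewrite lee_fin mulr_ge0 ?chi_ge0 ?sqr_ge0.
    - exact: ig_ge0.
    apply: eq_integral => x _; rewrite /F -(mun_sub x mshell shell_ge0).
    apply: igZ.
    - by rewrite mulr_ge0 ?chi_ge0 ?sqr_ge0.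
    - exact: mfun_sub.
    - by move=> a; exact: shell_ge0.
  rewrite EFinM; apply: lee_pmul; rewrite ?lee_fin//; last exact: shell_weight.
  apply: mulr_ge0; first exact: powR_ge0.
  apply: mulr_ge0; first by rewrite ltW// om_gt0.
  by rewrite oppr_ge0 ln_le0.
have I : (\int[mu]_a ((s * chi2 a)%:E + kap%:E * H a) <= \int[mu]_a
    ((e * chi2 a)%:E + (s%:E * T a + (2%:E * D a + c%:E * B3 a))))%E.
  apply: eg_le.
  - by apply: emeasurable_funD; [apply: em_EFin; meas|exact: measurable_funeM].
  - apply: emeasurable_funD; first by apply: em_EFin; meas.
    by do 2?[apply: emeasurable_funD]; exact: measurable_funeM.
  - move=> a; apply: adde_ge0; first by rewrite lee_fin mulr_ge0 ?chi_ge0.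
    by rewrite mule_ge0// lee_fin.
  - exact: averaged_pointwise.
have kE (k : R) (f : E -> \bar R) : 0 <= k -> measurable_fun [set: E] f ->
    (forall x, 0 <= f x)%E -> (\int[mu]_a (k%:E * f a) = k%:E * \int[mu]_a f a)%E.
  by move=> k0 mf f0; rewrite ge0_integralZl_EFin.
have dE (f g : E -> \bar R) : measurable_fun [set: E] f -> measurable_fun [set: E] g ->
    (forall x, 0 <= f x)%E -> (forall x, 0 <= g x)%E ->
    (\int[mu]_a (f a + g a) = \int[mu]_a f a + \int[mu]_a g a)%E.
  by move=> mf mg f0 g0; rewrite ge0_integralD.
have mk (k : R) (f : E -> \bar R) : measurable_fun [set: E] f ->
   measurable_fun [set: E] (fun a => k%:E * f a)%E by exact: measurable_funeM.
have k0 (k : R) (f : E -> \bar R) : 0 <= k -> (forall x, 0 <= f x)%E ->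
   forall x, (0 <= k%:E * f x)%E by move=> h1 h2 x; rewrite mule_ge0// lee_fin.
have d0 (f g : E -> \bar R) : (forall x, 0 <= f x)%E -> (forall x, 0 <= g x)%E ->
   forall x, (0 <= f x + g x)%E by move=> h1 h2 x; exact: adde_ge0.
have c2 (k : R) : 0 <= k -> forall a, (0 <= (k * chi2 a)%:E)%E.
  by move=> k1 a; rewrite lee_fin mulr_ge0 ?chi_ge0.
have mc2 (k : R) : measurable_fun [set: E] (fun a => (k * chi2 a)%:E).
  by apply: em_EFin; meas.
have two : (0 : R) <= 2 by [].
have m3 : measurable_fun [set: E] (fun a => 2%:E * D a + c%:E * B3 a)%E.
  by apply: emeasurable_funD; exact: mk.
have m4 : measurable_fun [set: E] (fun a => s%:E * T a + (2%:E * D a + c%:E * B3 a))%E.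
  by apply: emeasurable_funD => //; exact: mk.
have n3 := d0 _ _ (k0 2 _ two D0) (k0 c _ c_ge0 B0).
have n4 := d0 _ _ (k0 s _ s0 T0) n3.
move: I; rewrite (dE _ _ (mc2 s) (mk kap _ mH) (c2 s s0) (k0 kap _ kap_ge0 H0)).
rewrite (dE _ _ (mc2 e) m4 (c2 e e0) n4) (dE _ _ (mk s _ mT) m3 (k0 s _ s0 T0) n3).
rewrite (dE _ _ (mk 2 _ mD) (mk c _ mB) (k0 2 _ two D0) (k0 c _ c_ge0 B0)).
rewrite !kE// (igZ mu s0 mch (fun a => chi_ge0 _ _)) (igZ mu e0 mch (fun a => chi_ge0 _ _)).
rewrite V2 IT ID => I.
have kap0' : (0 <= kap%:E)%E by rewrite lee_fin.
have c0' : (0 <= c%:E)%E by rewrite lee_fin.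
have J := le_trans (leeD (lexx _) (lee_wpmul2l kap0' IH)) I.
have := le_trans J (leeD (lexx _) (leeD (lexx _) (leeD (lexx _) (lee_wpmul2l c0' IB)))).
rewrite -!EFinM -!EFinD lee_fin.
lra.
Qed.

End averaging.

(** * Near-minimizers *)

Section near_minimizers.
Variables (R : realType) (n : nat).
Hypothesis n0 : (0 < n)%N.
Variable sg : R.
Hypotheses (sg0 : 0 < sg) (sg1 : sg < 1) (sgn : 2 * sg < n%:R).
Local Notation E := (n.-tuple R).
Local Notation mu := (mun R n).
Local Notation Q := (@quad R n sg).
Local Notation En := (@energy R n sg).
Local Notation mfunE u := (measurable_fun [set: E] u).
Local Notation p := (@pexp R n sg).

Let p0 : 0 < p. Proof. exact: pexp_gt0. Qed.

(** [cutoff_energy] for the constant function 1, whose own energy is zero. *)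
Lemma energy_hat : (En (hat (0%R : E) 1) < +oo)%E.
Proof.
have := cutoff_energy n0 sg0 sg1 0 (rm_cst (1 : R)) (ltr01 : (0 : R) < 1).
rewrite (_ : (fun x : E => 1 * hat 0 1 x) = hat 0 1); last first.
  by apply/funext => x; rewrite mul1r.
have Q1 x y : Q (fun _ => 1) x y = 0 by rewrite /quad subrr expr0n mul0r.
have -> : En (fun _ => 1) = 0%E.
  by apply: integral0_eq => x _; apply: integral0_eq => y _; rewrite Q1.
have -> : dint mu (fun x y : E => chi R (vnorm (x - 0) < 2 * 1)%R * Q (fun _ => 1) x y) = 0%E.
  by apply: integral0_eq => x _; apply: integral0_eq => y _; rewrite Q1 mulr0.
rewrite mule0 !add0e => /le_lt_trans; apply.
apply: lte_mul_pinfty.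
- by rewrite lee_fin divr_ge0 ?powR_ge0// mulr_ge0// Cm_ge0.
- by [].
rewrite (eq_integral (fun x : E => (chi R (vnorm (x - 0) < 2 * 1))%:E)); last first.
  by move=> x _; rewrite expr1n mulr1.
by rewrite mu_ball ?mulr1// ltry.
Qed.

Lemma quot_ge0 (u : E -> R) : mfunE u -> (0 <= quot sg (@fullsp R n) u)%E.
Proof.
move=> mu_; rewrite /quot (Iform_fullE sg mu_); apply: mule_ge0; first exact: En_ge0.
by rewrite inve_ge0 poweR_ge0.
Qed.

Lemma S_full_ge0 : (0 <= S_full n sg)%E.
Proof. by apply: le_ereal_inf_tmp => _ [u [[mu_ _] _] <-]; exact: quot_ge0. Qed.

(** The test function [1 - hat] has compact support and the same energy as [hat]. *)
Lemma S_full_fin : (S_full n sg < +oo)%E.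
Proof.
pose f (x : E) := 1 - hat 0 1 x.
have mh := @measurable_hat R n 0 1.
have mf : mfunE f by rewrite /f; meas.
have f0 x : 0 <= f x by rewrite subr_ge0 hat_le1.
have f1 x : f x <= 1 by rewrite lerBlDr lerDl hat_ge0.
have fs x : f x != 0 -> vnorm (x - 0) < 2.
  rewrite ltNge; apply: contraNN => x2; rewrite /f hat1 ?subrr//.
  by rewrite mulr1.
have fE : (En f < +oo)%E.
  apply: le_lt_trans energy_hat; apply: energy_contract => // x y.
  by rewrite /f (_ : 1 - _ - _ = - (hat 0 1 x - hat 0 1 y)) ?normrN//; ring.
have b2 : (\int[mu]_x (chi R (vnorm (x - 0) < 2)%R)%:E < +oo)%E.
  by rewrite mu_ball// ltry.
have fb x : vnorm (x - 0) < 1 -> f x = 1.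
  by move=> /ltW x1; rewrite /f (hat0 ltr01 x1) subr0.
have mb2 := @measurable_ball R n 0 2; have mb1 := @measurable_ball R n 0 1.
have bv := bvol_gt0 R n0.
have Hf : Hfull sg f.
  split=> //; split; first by rewrite (Iform_fullE sg mf).
  move=> tau tau0; rewrite lebnE; last first.
    by apply: bm_lt; [exact: rm_cst|meas].
  apply: le_lt_trans b2; apply: ig_le => //.
    by apply: rm_bool; apply: bm_lt; [exact: rm_cst|meas].
  move=> x; rewrite chi_ge0/=; apply: chi_le => tx; apply: fs.
  by apply: contraTneq tx => ->; rewrite normr0 ltNge ltW.
have nz : nonzero_on (@fullsp R n) f.
  rewrite /nonzero_on.
  have -> : @fullsp R n `&` [set x | f x != 0] = [set x | 0 < f x].
    by apply/seteqP; split=> x; rewrite /fullsp/= lt0r f0 andbT; [case|].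
  have mp : measurable_fun [set: E] (fun x => 0 < f x) by apply: bm_lt => //; exact: rm_cst.
  rewrite (lebnE mp) gt_eqF//.
  apply: (@lt_le_trans _ _ (\int[mu]_x (chi R (vnorm (x - 0) < 1)%R)%:E)%E).
    by rewrite mu_ball// lte_fin expr1n mul1r.
  apply: ig_le => //; first exact: rm_bool.
  by move=> x; rewrite chi_ge0/=; apply: chi_le => /fb ->.
have : (S_full n sg <= quot sg (@fullsp R n) f)%E by apply: ereal_inf_lbound; exists f.
move=> /le_lt_trans; apply.
rewrite /quot (Iform_fullE sg mf) (Lpint_fullE sg mf).
have mfp : mfunE (fun x => `|f x| `^ p) by meas.
set X := (\int[mu]_x _)%E.
have X1 : (0 < X)%E.
  apply: (@lt_le_trans _ _ (\int[mu]_x (chi R (vnorm (x - 0) < 1)%R)%:E)%E).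
    by rewrite mu_ball// lte_fin expr1n mul1r.
  apply: ig_le => // x; rewrite chi_ge0/=.
  have [/fb ->|_] := boolP (vnorm (x - 0) < 1); last by rewrite /chi powR_ge0.
  by rewrite normr1 powR1 /chi.
have X2 : (X < +oo)%E.
  apply: le_lt_trans b2; apply: ig_le => // x; rewrite powR_ge0/=.
  have [->|/fs xs] := eqVneq (f x) 0; first by rewrite normr0 powR0 ?gt_eqF ?chi_ge0.
  rewrite xs /chi ger0_norm//.
  have <- : 1 `^ p = 1 :> R by rewrite powR1.
  by apply: ge0_ler_powR; rewrite ?nnegrE ?(ltW p0).
have Xf : X \is a fin_num by rewrite ge0_fin_numE// ltW.
rewrite -(fineK Xf) poweR_EFin inver gt_eqF; last first.
  by apply: powR_gt0; rewrite -lte_fin fineK.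
apply: lte_mul_pinfty; first exact: En_ge0.
  by rewrite ge0_fin_numE ?En_ge0.
exact: ltry.
Qed.

(** The functions $\min(1, k|u|^p)$ increase to the indicator of $u \ne 0$; were the integral of
    $|u|^p$ zero, all of theirs would be zero as well. *)
Lemma nonzero_Lp (u : E -> R) : mfunE u -> nonzero_on (@fullsp R n) u ->
  (0 < \int[mu]_x (`|u x| `^ p)%:E)%E.
Proof.
move=> mu_ nz.
have mup : mfunE (fun x => `|u x| `^ p) by meas.
have X0 : (0 <= \int[mu]_x (`|u x| `^ p)%:E)%E by apply: ig_ge0 => x; exact: powR_ge0.
rewrite lt_neqAle X0 andbT eq_sym; apply: contraNN nz => /eqP X1.
have -> : @fullsp R n `&` [set x | u x != 0] = [set x | 0 < `|u x|].
  by apply/seteqP; split=> x; rewrite /fullsp/= normr_gt0; [case|].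
have mb : measurable_fun [set: E] (fun x => 0 < `|u x|).
  by apply: bm_lt; [exact: rm_cst|meas].
rewrite (lebnE mb) eq_le ig_ge0 ?andbT; last by move=> x; exact: chi_ge0.
apply: (@ig_limit _ _ _ mu _ (fun k x => Num.min 1 (k%:R * `|u x| `^ p))).
- by move=> k; apply: rm_min; [exact: rm_cst|apply: rmM => //; exact: rm_cst].
- by move=> k x; rewrite le_min ler01 mulr_ge0 ?powR_ge0.
- move=> x k l kl; rewrite le_min ge_min lexx/= ge_min; apply/orP; right.
  by apply: ler_wpM2r; [exact: powR_ge0|rewrite ler_nat].
- move=> x; have [->|ux] := eqVneq (u x) 0.
    exists 0%N => l _; rewrite normr0 powR0 ?gt_eqF// mulr0 /chi ltxx.
    by apply/min_idPr.
  have u0 : 0 < `|u x| by rewrite normr_gt0.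
  have up : 0 < `|u x| `^ p by exact: powR_gt0.
  exists (Num.truncn (`|u x| `^ p)^-1).+1 => l kl; rewrite u0 /chi; apply/min_idPl.
  rewrite -ler_pdivrMr// div1r; apply: (@le_trans _ _ (Num.truncn (`|u x| `^ p)^-1).+1%:R).
    by rewrite ltW// truncnS_gt.
  by rewrite ler_nat.
move=> k; apply: (@le_trans _ _ (\int[mu]_x (k%:R * `|u x| `^ p)%:E)%E).
  apply: ig_le.
  - by apply: rm_min; [exact: rm_cst|apply: rmM => //; exact: rm_cst].
  - by apply: rmM => //; exact: rm_cst.
  - by move=> x; rewrite le_min ler01 mulr_ge0 ?powR_ge0//= ge_min lexx orbT.
by rewrite (igZ mu (ler0n _ k) mup (fun x => powR_ge0 _ _)) X1 mule0.
Qed.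

(** Membership in [Hfull] gives no integrability directly. Removing the values below $1/(k+1)$
    leaves a set of finite measure and capping at k makes the function bounded, so the truncation
    lies in every $L^q$; being a contraction of u, it does not increase the energy. *)
Definition trunc (u : E -> R) (k : nat) (x : E) : R :=
  Num.min (Num.max 0 (`|u x| - k.+1%:R^-1)) k%:R.

Lemma trunc_ge0 u k x : 0 <= trunc u k x.
Proof. by rewrite le_min le_max lexx/=. Qed.

Lemma trunc_le u k x : trunc u k x <= k%:R.
Proof. by rewrite ge_min lexx orbT. Qed.

Lemma trunc_supp u k x : trunc u k x != 0 -> k.+1%:R^-1 < `|u x|.
Proof.
rewrite ltNge; apply: contraNN => ux; apply/eqP.
rewrite /trunc; have /max_idPl -> : `|u x| - k.+1%:R^-1 <= 0 by rewrite subr_le0.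
exact/min_idPl.
Qed.

Lemma measurable_trunc u k : mfunE u -> mfunE (trunc u k).
Proof. by move=> mu_; rewrite /trunc; meas. Qed.

Lemma trunc_contract u k x y : `|trunc u k x - trunc u k y| <= `|u x - u y|.
Proof.
apply: le_trans (ler_dist_dist (u x) (u y)); rewrite /trunc.
move: (k.+1%:R^-1) (k%:R) (`|u x|) (`|u y|) (ler0n R k) => d m a b m0.
have key (f g : R) : f <= g -> 0 <= Num.min (Num.max 0 (g - d)) m -
    Num.min (Num.max 0 (f - d)) m <= g - f.
  move=> fg; case: (leP 0 (g - d)) => h1; case: (leP 0 (f - d)) => h2.
  - by case: (leP (g - d) m) => h3; case: (leP (f - d) m) => h4; apply/andP; split; lra.
  - by case: (leP (g - d) m) => h3; case: (leP 0 m) => h4; apply/andP; split; lra.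
  - by case: (leP 0 m) => h3; case: (leP (f - d) m) => h4; apply/andP; split; lra.
  - by case: (leP 0 m) => h3; apply/andP; split; lra.
case: (leP a b) => ab.
  have /andP[h1 h2] := key _ _ ab.
  by rewrite [leLHS]distrC [leRHS]distrC !ger0_norm//; lra.
have /andP[h1 h2] := key _ _ (ltW ab).
by rewrite !ger0_norm//; lra.
Qed.

Lemma trunc_Lq u k q : Hfull sg u -> 0 < q ->
  (\int[mu]_x (trunc u k x `^ q)%:E < +oo)%E.
Proof.
move=> [mu_ [_ lv]] q0; have mt := measurable_trunc k mu_.
have d0 : 0 < k.+1%:R^-1 :> R by rewrite invr_gt0 ltr0n.
have mb : measurable_fun [set: E] (fun x => k.+1%:R^-1 < `|u x|).
  by apply: bm_lt; [exact: rm_cst|meas].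
have := lv _ d0; rewrite (lebnE mb) => lvf.
have kq : 0 <= k%:R `^ q :> R by exact: powR_ge0.
apply: (@le_lt_trans _ _ (\int[mu]_x (k%:R `^ q * chi R (k.+1%:R^-1 < `|u x|)%R)%:E)%E).
  apply: ig_le.
  - by meas.
  - by apply: rmM; [exact: rm_cst|exact: rm_bool].
  move=> x; rewrite powR_ge0/=; have [->|tx] := eqVneq (trunc u k x) 0.
    by rewrite powR0 ?gt_eqF// mulr_ge0 ?chi_ge0.
  rewrite (trunc_supp tx) /chi mulr1.
  by apply: ge0_ler_powR; rewrite ?nnegrE ?(ltW q0) ?trunc_ge0 ?trunc_le.
rewrite (igZ mu kq (rm_bool mb) (fun x => chi_ge0 _ _)).
by apply: lte_mul_pinfty => //; rewrite lee_fin.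
Qed.

(** The truncations increase to $|u|$ without reaching it, while [ig_limit] wants sequences that
    become constant. Capping them by $|u|/(1+t)$ achieves this at the price of the factor
    $(1+t)^p$. *)
Lemma trunc_limit (u : E -> R) t (L : R) : mfunE u -> 0 < t ->
  (forall k, (\int[mu]_x (trunc u k x `^ p)%:E <= L%:E)%E) ->
  (\int[mu]_x (`|u x| `^ p)%:E <= ((1 + t) `^ p * L)%:E)%E.
Proof.
move=> mu_ t0 H; have t1 : 0 < 1 + t by exact: addr_gt0.
have mup : mfunE (fun x => (`|u x| / (1 + t)) `^ p) by meas.
have c0 : 0 <= (1 + t) `^ p by exact: powR_ge0.
have -> : (\int[mu]_x (`|u x| `^ p)%:E =
    ((1 + t) `^ p)%:E * \int[mu]_x ((`|u x| / (1 + t)) `^ p)%:E)%E.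
  rewrite -(igZ mu c0 mup (fun x => powR_ge0 _ _)); apply: eq_integral => x _.
  congr EFin; rewrite -powRM ?(ltW t1)//; last by rewrite divr_ge0// ltW.
  by rewrite mulrC divfK// gt_eqF.
rewrite EFinM; apply: lee_wpmul2l; first by rewrite lee_fin.
pose G (k : nat) x := Num.min (trunc u k x) (`|u x| / (1 + t)).
have u1 x : 0 <= `|u x| / (1 + t) by rewrite divr_ge0// ltW.
have mG k : mfunE (G k).
  by apply: rm_min; [exact: measurable_trunc|meas].
have G0 k x : 0 <= G k x by rewrite le_min trunc_ge0 u1.
apply: (@ig_limit _ _ _ mu _ (fun k x => G k x `^ p)).
- by move=> k; have := mG k => ?; meas.
- by move=> k x; exact: powR_ge0.
- move=> x k l kl; apply: ge0_ler_powR; rewrite ?nnegrE ?(ltW p0)//.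
  rewrite le_min [X in _ && X]ge_min lexx orbT andbT ge_min; apply/orP; left.
  rewrite /trunc le_min ge_min; apply/andP; split; last first.
    by rewrite ge_min ler_nat kl orbT.
  apply/orP; left; rewrite ge_max le_max lexx/= le_max; apply/orP; right.
  by rewrite lerD2l lerN2 lef_pV2 ?posrE ?ltr0n// ler_nat.
- move=> x; have [ux|ux] := eqVneq (u x) 0.
    exists 0%N => l _; congr (_ `^ p); rewrite /G ux normr0 mul0r.
    by apply/min_idPr; exact: trunc_ge0.
  have u0 : 0 < `|u x| by rewrite normr_gt0.
  pose d := `|u x| - `|u x| / (1 + t).
  have d0 : 0 < d.
    by rewrite subr_gt0 ltr_pdivrMr// ltr_pMr// ltrDl.
  (* From this index on, $1/(l+1) < d$ makes the lower truncation cost less than d, and l exceeds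
     $|u(x)|$. *)
  exists (Num.truncn (d^-1 + `|u x|)).+1 => l kl; congr (_ `^ p); apply/min_idPr.
  have := truncnS_gt (d^-1 + `|u x|) => h.
  have hl : d^-1 + `|u x| < l%:R by apply: (lt_le_trans h); rewrite ler_nat.
  have di : 0 < d^-1 by rewrite invr_gt0.
  rewrite /trunc le_min le_max; apply/andP; split; last first.
    rewrite (@le_trans _ _ `|u x|)//; last by lra.
    by rewrite ler_pdivrMr// ler_peMr// lerDl ltW.
  apply/orP; right; rewrite lerBrDr -lerBrDl -/d -[leRHS]invrK.
  rewrite lef_pV2 ?posrE ?ltr0n// -natr1; lra.
move=> k; apply: le_trans (H k); apply: ig_le.
- by have := mG k => ?; meas.
- by have := measurable_trunc k mu_ => ?; meas.
move=> x; rewrite powR_ge0/=; apply: ge0_ler_powR; rewrite ?nnegrE ?(ltW p0) ?trunc_ge0//.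
by rewrite ge_min lexx.
Qed.

End near_minimizers.

(** * Normalised near-minimizers, concentration and the contradiction *)

Section concentration.
Variables (R : realType) (n : nat).
Hypothesis n0 : (0 < n)%N.
Variable sg : R.
Hypotheses (sg0 : 0 < sg) (sg1 : sg < 1) (sgn : 2 * sg < n%:R) (sg4 : 4 * sg <= n%:R).
Local Notation E := (n.-tuple R).
Local Notation mu := (mun R n).
Local Notation En := (@energy R n sg).
Local Notation mfunE u := (measurable_fun [set: E] u).
Local Notation p := (@pexp R n sg).
Local Notation theta := ((n%:R - 2 * sg) / n%:R).

Let p0 : 0 < p. Proof. exact: pexp_gt0. Qed.
Let th : 0 < theta. Proof. exact: theta_gt0. Qed.

(** Start from u with quotient below $s + \epsilon$. If some truncation has quotient at most $s +
    2\epsilon$, normalise it. Otherwise the truncations have bounded p-th power integrals, so that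
    of u is finite, and in the limit the quotient of u is at least $s + \epsilon$. Finiteness must
    be proved, because with an infinite denominator [quot] is zero. *)
Lemma near_minimizer (s eps : R) : S_full n sg = s%:E -> 0 <= s -> 0 < eps -> eps <= 1 ->
  exists u : E -> R, [/\ mfunE u, (forall x, 0 <= u x),
    (\int[mu]_x (u x ^+ 2)%:E < +oo)%E, (\int[mu]_x (u x `^ p)%:E = 1)%E &
    (En u <= (s + 2 * eps)%:E)%E].
Proof.
move=> sS s0 e0 e1.
have : (S_full n sg < (s + eps)%:E)%E by rewrite sS lte_fin ltrDl.
move=> /ereal_inf_lt[_ [u [Hu nz] <-]].
have [mu_ [uI lv]] := Hu; rewrite (Iform_fullE sg mu_) in uI.
rewrite /quot (Iform_fullE sg mu_) (Lpint_fullE sg mu_) => qlt.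
have Xp := nonzero_Lp sg0 sgn mu_ nz.
have If : En u \is a fin_num by rewrite ge0_fin_numE ?En_ge0.
pose I := fine (En u); have IE : En u = I%:E by rewrite fineK.
have I0 : 0 <= I by rewrite -lee_fin -IE En_ge0.
have mt k : mfunE (trunc u k) by exact: measurable_trunc.
have tI k : (En (trunc u k) <= I%:E)%E.
  by rewrite -IE; apply: energy_contract => // x y; exact: trunc_contract.
have tpf k : (\int[mu]_x (trunc u k x `^ p)%:E)%E \is a fin_num.
  rewrite ge0_fin_numE; first exact: (trunc_Lq k Hu p0).
  by apply: ig_ge0 => x; exact: powR_ge0.
pose P k := fine (\int[mu]_x (trunc u k x `^ p)%:E).
have PE k : (\int[mu]_x (trunc u k x `^ p)%:E = (P k)%:E)%E by rewrite fineK.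
have P0 k : 0 <= P k by rewrite -lee_fin -PE; apply: ig_ge0 => x; exact: powR_ge0.
have se : 0 < s + 2 * eps by lra.
have [[k [Pk Ek]]|Hk] := pselect (exists k, 0 < P k /\
    (En (trunc u k) <= ((s + 2 * eps) * P k `^ theta)%:E)%E).
  pose m := (P k `^ p^-1)^-1.
  have Pp : 0 < P k `^ p^-1 by exact: powR_gt0.
  have m0 : 0 < m by rewrite invr_gt0.
  have mp : m `^ p = (P k)^-1.
    have Pk' : (P k `^ p^-1) `^ p = P k by rewrite -powRrM mulVf ?gt_eqF// powRr1// ltW.
    have Pn : P k != 0 by rewrite gt_eqF.
    apply: (mulIf Pn); rewrite mulVf ?gt_eqF// -[X in _ * X]Pk'.
    by rewrite -powRM ?(ltW m0) ?(ltW Pp)// mulVf ?gt_eqF// powR1.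
  have m2 : m ^+ 2 * P k `^ theta = 1.
    have -> : theta = p^-1 * 2.
      have pn : p != 0 by rewrite gt_eqF.
      by apply: (mulfI pn); rewrite (pexp_theta n0 sgn) mulVKf.
    by rewrite powRrM (powR_mulrn 2) ?(ltW Pp)// -exprMn mulVf ?gt_eqF// expr1n.
  have mtk := mt k.
  exists (fun x => m * trunc u k x); split.
  - by meas.
  - by move=> x; rewrite mulr_ge0 ?trunc_ge0// ltW.
  - rewrite (eq_integral (fun x : E => (m ^+ 2 * trunc u k x ^+ 2)%:E)); last first.
      by move=> x _; rewrite exprMn.
    rewrite (igZ mu (sqr_ge0 m)); [|by meas|by move=> x; exact: sqr_ge0].
    apply: lte_mul_pinfty => //; first by rewrite lee_fin sqr_ge0.
    rewrite (eq_integral (fun x => (trunc u k x `^ 2)%:E)) ?(trunc_Lq k Hu)//.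
    by move=> x _; rewrite (powR_mulrn 2)// trunc_ge0.
  - rewrite (eq_integral (fun x : E => (m `^ p * trunc u k x `^ p)%:E)); last first.
      by move=> x _; rewrite powRM ?trunc_ge0// ltW.
    rewrite (igZ mu (powR_ge0 _ _)); [|by meas|by move=> x; exact: powR_ge0].
    by rewrite PE mp -EFinM mulVf// gt_eqF.
  - rewrite (energyZ sg m mtk).
    apply: le_trans (lee_wpmul2l _ Ek) _; first by rewrite lee_fin sqr_ge0.
    by rewrite -EFinM lee_fin mulrCA m2 mulr1.
exfalso.
have thn : theta != 0 by rewrite gt_eqF.
have Is : 0 <= I / (s + 2 * eps) by rewrite divr_ge0// ltW.
pose L := (I / (s + 2 * eps)) `^ theta^-1.
have L0 : 0 <= L by exact: powR_ge0.
have PL k : P k <= L.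
  have [->//|Pk] := eqVneq (P k) 0.
  have {}Pk : 0 < P k by rewrite lt0r Pk P0.
  have : ~~ (En (trunc u k) <= ((s + 2 * eps) * P k `^ theta)%:E)%E.
    by apply/negP => Ek; apply: Hk; exists k.
  rewrite -ltNge => /lt_le_trans/(_ (tI k)); rewrite lte_fin mulrC -ltr_pdivlMr// => H.
  rewrite -[leLHS]powRr1// -(mulfV thn) powRrM.
  by apply: ge0_ler_powR; rewrite ?nnegrE ?powR_ge0 ?invr_ge0 ?(ltW th) ?(ltW H).
(* Chosen so that $(s + \epsilon)(1 + t)^2 \le s + 2\epsilon$. *)
pose t := eps / (3 * (s + 1)).
have s3 : 0 < 3 * (s + 1) by lra.
have t0 : 0 < t by rewrite divr_gt0.
have t1 : t <= 1 by rewrite ler_pdivrMr//; lra.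
have t3 : 3 * (s + 1) * t = eps by rewrite mulrC divfK// gt_eqF.
have Xle : (\int[mu]_x (`|u x| `^ p)%:E <= ((1 + t) `^ p * L)%:E)%E.
  by apply: trunc_limit => // k; rewrite PE lee_fin.
have Xf : (\int[mu]_x (`|u x| `^ p)%:E)%E \is a fin_num.
  by rewrite ge0_fin_numE ?(ltW Xp)// (le_lt_trans Xle)// ltry.
move: Xp Xle qlt; rewrite -(fineK Xf); move: (fine _) => X.
rewrite lte_fin lee_fin => X0 XL.
have Xt : 0 < X `^ theta by exact: powR_gt0.
rewrite poweR_EFin inver gt_eqF// IE -EFinM lte_fin ltr_pdivrMr// => H.
have : X `^ theta <= (1 + t) ^+ 2 * (I / (s + 2 * eps)).
  have t11 : 0 <= 1 + t by lra.
  apply: (@le_trans _ _ (((1 + t) `^ p * L) `^ theta)).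
    by apply: ge0_ler_powR; rewrite ?nnegrE ?(ltW th) ?(ltW X0) ?mulr_ge0 ?powR_ge0.
  rewrite powRM ?powR_ge0// -!powRrM (pexp_theta n0 sgn) (powR_mulrn 2)//.
  by rewrite mulVf// powRr1.
have s1 : 0 <= s + eps by lra.
move=> /(ler_wpM2l s1)/(lt_le_trans H); rewrite ltNge => /negP; apply.
rewrite [X in X <= _](_ : _ = (s + eps) * (1 + t) ^+ 2 * I / (s + 2 * eps)); last by ring.
rewrite ler_pdivrMr// [leRHS]mulrC; apply: ler_wpM2r => //.
have tt : t ^+ 2 <= t by rewrite expr2 ler_piMl// ltW.
have t2 : (1 + t) ^+ 2 <= 1 + 3 * t by lra.
apply: (le_trans (ler_wpM2l s1 t2)).
have : eps * t <= t by rewrite ler_piMl// ltW.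
lra.
Qed.

(* Makes Csob * conc_level ^ sobq * (s + 1) < 1, so that the refined Sobolev
   inequality cannot hold with this constant. *)
Definition conc_level (s : R) : R := (2 * (Csob n sg + 1) * (s + 1))^-1 `^ (sobq n sg)^-1.

Lemma conc_level_gt0 s : 0 <= s -> 0 < conc_level s.
Proof.
move=> s0; apply: powR_gt0; rewrite invr_gt0; apply: mulr_gt0; last by lra.
by apply: mulr_gt0 => //; rewrite ltr_wpDl// powR_ge0.
Qed.

(** If no ball $B_t(a)$ carried more than $c_0 t^{2\sigma}$ of $g^2$, [refined_sobolev] would
    contradict the unit norm by the choice of [conc_level]. Such a ball is moved to the unit
    ball. *)
Lemma concentrate (s e : R) (g : E -> R) : 0 <= s -> mfunE g -> (forall x, 0 <= g x) ->
  (\int[mu]_x (g x ^+ 2)%:E < +oo)%E -> (\int[mu]_x (g x `^ p)%:E = 1)%E ->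
  En g = e%:E -> e <= s + 1 ->
  exists v : E -> R, [/\ mfunE v, (forall x, 0 <= v x),
    (\int[mu]_x (v x ^+ 2)%:E < +oo)%E, (\int[mu]_x (v x `^ p)%:E = 1)%E &
    En v = e%:E /\
    ((conc_level s)%:E <= \int[mu]_x (chi R (vnorm x < 1)%R * v x ^+ 2)%:E)%E].
Proof.
move=> s0 mg g0 g2 gp ge es; set c0 := conc_level s.
have c00 : 0 < c0 by exact: conc_level_gt0.
have q0 := sobq_gt0 sg0 sgn.
have C0 : 0 <= Csob n sg by exact: powR_ge0.
have e0 : 0 <= e by rewrite -lee_fin -ge En_ge0.
have [a [t [t0 at_]]] : exists (a : E) (t : R), 0 < t /\
    ((c0 * t `^ (2 * sg))%:E < \int[mu]_y (chi R (vnorm (y - a) < t)%R * g y ^+ 2)%:E)%E.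
  apply: contrapT => H.
  have := refined_sobolev n0 sg0 sgn mg c00.
  have K : forall x (t : R), 0 < t ->
     (\int[mu]_y (chi R (vnorm (y - x) < t)%R * g y ^+ 2)%:E <= (c0 * t `^ (2 * sg))%:E)%E.
    move=> x t t0; rewrite leNgt; apply/negP => h; apply: H.
    by exists x, t.
  move=> /(_ K); rewrite (eq_integral (fun x => (g x `^ p)%:E)); last first.
    by move=> x _; rewrite ger0_norm.
  rewrite gp ge -EFinM lee_fin leNgt => /negP; apply.
  have -> : c0 `^ sobq n sg = (2 * (Csob n sg + 1) * (s + 1))^-1.
    rewrite /c0 /conc_level -powRrM mulVf ?gt_eqF// powRr1// invr_ge0.
    by rewrite !mulr_ge0//; lra.
  have D0 : 0 < 2 * (Csob n sg + 1) * (s + 1).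
    by apply: mulr_gt0; last lra; apply: mulr_gt0 => //; lra.
  rewrite mulrAC ltr_pdivrMr// mul1r.
  apply: (@le_lt_trans _ _ (Csob n sg * (s + 1))); first exact: ler_wpM2l.
  rewrite ltr_pM2r; lra.
have tn : 0 < t ^+ n by exact: exprn_gt0.
have ts : 0 < t `^ (2 * sg) by exact: powR_gt0.
(* The scaling factor for which $m\, g(tx + a)$ has the same energy and the same $L^p$ norm as g. *)
pose m := t `^ ((n%:R - 2 * sg) / 2).
have m0 : 0 <= m by exact: powR_ge0.
have m2 : m ^+ 2 = t ^+ n / t `^ (2 * sg).
  rewrite -(powR_mulrn 2)// -powRrM divfK// powRB.
    by rewrite powR_mulrn// ltW.
  by rewrite (gt_eqF t0) implybT.
have mp : m `^ p = t ^+ n.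
  rewrite -powRrM -powR_mulrn ?(ltW t0)//; congr (_ `^ _).
  rewrite /pexp; field; rewrite subr_eq0 gt_eqF//.
pose h x := g (x + a).
have mh : mfunE h by exact: mfun_shift.
have mhs : mfunE (fun x => h (t *: x)) by exact: mfun_scale.
exists (fun x => m * h (t *: x)); split.
- by meas.
- by move=> x; apply: mulr_ge0 => //; exact: g0.
- rewrite (eq_integral (fun x : E => (m ^+ 2 * h (t *: x) ^+ 2)%:E)); last first.
    by move=> x _; rewrite exprMn.
  rewrite (igZ mu (sqr_ge0 m)); [|by meas|by move=> x; exact: sqr_ge0].
  apply: lte_mul_pinfty => //; first by rewrite lee_fin sqr_ge0.
  rewrite (mun_scaleR (f := fun x => h x ^+ 2) _ _ t0); [|by meas|by move=> x; exact: sqr_ge0].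
  rewrite (mun_shiftR (f := fun x => g x ^+ 2) _ _ a); [|by meas|by move=> x; exact: sqr_ge0].
  by apply: lte_mul_pinfty => //; rewrite lee_fin invr_ge0 ltW.
- rewrite (eq_integral (fun x : E => (m `^ p * h (t *: x) `^ p)%:E)); last first.
    by move=> x _; rewrite powRM// g0.
  rewrite (igZ mu (powR_ge0 _ _)); [|by meas|by move=> x; exact: powR_ge0].
  rewrite (mun_scaleR (f := fun x => h x `^ p) _ _ t0); [|by meas|by move=> x; exact: powR_ge0].
  rewrite (mun_shiftR (f := fun x => g x `^ p) _ _ a); [|by meas|by move=> x; exact: powR_ge0].
  by rewrite gp mule1 -EFinM mp mulfV// gt_eqF.
split.
  rewrite (energyZ sg m mhs) (energy_dil sg t0 mh) (energy_shift sg a mg) ge -!EFinM m2.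
  by congr EFin; field; rewrite !gt_eqF.
rewrite (eq_integral (fun x : E => (m ^+ 2 * (chi R (vnorm (t *: x + a - a) < t) *
    h (t *: x) ^+ 2))%:E)); last first.
  move=> x _; rewrite addrK vnormZ (gtr0_norm t0).
  have -> : (t * vnorm x < t) = (vnorm x < 1) by rewrite -[X in _ < X]mulr1 ltr_pM2l.
  by congr EFin; rewrite exprMn mulrCA.
have mf0 : mfunE (fun x => chi R (vnorm (x - a) < t) * g x ^+ 2) by meas.
have f00 x : 0 <= chi R (vnorm (x - a) < t) * g x ^+ 2.
  by rewrite mulr_ge0 ?chi_ge0 ?sqr_ge0.
pose f x := chi R (vnorm (x + a - a) < t) * h x ^+ 2.
have mf : mfunE f by rewrite /f; meas.
have f0 x : 0 <= f x by rewrite mulr_ge0 ?chi_ge0 ?sqr_ge0.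
have mft : mfunE (fun x => f (t *: x)) by exact: mfun_scale.
rewrite (igZ mu (sqr_ge0 m) mft (fun x => f0 _)) (mun_scaleR mf f0 t0).
rewrite (mun_shiftR mf0 f00 a).
have k0 : 0 <= m ^+ 2 * t ^- n by rewrite mulr_ge0 ?sqr_ge0// invr_ge0 ltW.
rewrite muleA -EFinM.
apply: le_trans (lee_wpmul2l _ (ltW at_)); last by rewrite lee_fin.
rewrite -EFinM lee_fin m2 le_eqVlt; apply/orP; left; apply/eqP.
by field; rewrite !gt_eqF.
Qed.

Lemma S_full_not_le : ~ (S_full n sg <= S_half n sg)%E.
Proof.
move=> Sle.
have Sf : S_full n sg \is a fin_num.
  by rewrite ge0_fin_numE; [exact: S_full_fin|exact: S_full_ge0].
pose s := fine (S_full n sg); have sE : S_full n sg = s%:E by rewrite fineK.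
have s0 : 0 <= s by rewrite -lee_fin -sE; exact: S_full_ge0.
rewrite sE in Sle.
have bv := bvol_gt0 R n0; have om0 := om_gt0 R n0; have cp := cpot_gt0 n0 sg.
have Cm0 := Cm_ge0 n0 sg0 sg1.
set c0 := conc_level s; have c00 : 0 < c0 by exact: conc_level_gt0.
(* Terms are compared with $\rho = r^{n-2\sigma}$: the gain is $\rho K_1 \ln(1/(2r))$ and the
   cut-off costs at most $\rho K_2$. Both constants depend on n, sigma and s only, so r and then the
   defect can be fixed before the near-minimizer is chosen. *)
pose K1 := cpot n sg * c0 * 2 `^ (n%:R - 4 * sg) * om R n.
have K10 : 0 < K1 by rewrite !mulr_gt0// powR_gt0.
pose K2 := 2 ^+ n * bvol R n * (s + 2 * (s + 1)) +
  4 * Cm n sg * (2 ^+ n * bvol R n * (3 ^+ n * bvol R n + 1)).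
have t2 : 0 < 2 ^+ n * bvol R n by rewrite mulr_gt0// exprn_gt0.
have t3 : 0 < 3 ^+ n * bvol R n + 1 by rewrite addr_gt0// mulr_gt0// exprn_gt0.
have K20 : 0 <= K2.
  apply: addr_ge0; first by apply: mulr_ge0; [exact: ltW|lra].
  by rewrite mulr_ge0// mulr_ge0// ltW.
(* The value of $\ln(1/(2r))$ for which the gain exceeds the cost by exactly $\rho$. *)
pose l := (K2 + 1) / K1.
have l0 : 0 < l by rewrite divr_gt0// ltr_wpDl.
pose r := expR (- l) / 2.
have r0 : 0 < r by rewrite divr_gt0// expR_gt0.
have r2 : 2 * r = expR (- l) by rewrite mulrC divfK.
have r1 : 2 * r <= 1 by rewrite r2 expR_le1 oppr_le0 ltW.
have rl : - ln (2 * r) = l by rewrite r2 expRK opprK.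
pose rho := r ^+ n / r `^ (2 * sg).
have rs : 0 < r `^ (2 * sg) by exact: powR_gt0.
have rn : 0 < r ^+ n by exact: exprn_gt0.
have rho0 : 0 < rho by rewrite divr_gt0.
(* The entry 1/2 ensures $e \le s + 1$; the other keeps the contribution of the defect below
   $\rho/2$, less than the surplus $\rho$. *)
pose eps := Num.min (1 / 2) (rho / (2 ^+ n * bvol R n) / 4).
have e0 : 0 < eps by rewrite lt_min !divr_gt0.
have e1 : eps <= 1 / 2 by rewrite ge_min lexx.
have e2 : 4 * eps * (2 ^+ n * bvol R n) <= rho.
  rewrite -ler_pdivlMr// mulrC -ler_pdivlMr//.
  by rewrite ge_min lexx orbT.
have [|g [mg g0 g2 gp ge]] := near_minimizer sE s0 e0; first by lra.
have gf : En g \is a fin_num.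
  by rewrite ge0_fin_numE ?En_ge0// (le_lt_trans ge)// ltry.
move: (fineK gf) ge; move: (fine _) => e eE; rewrite -eE lee_fin => es.
have es1 : e <= s + 1 by lra.
have e00 : 0 <= e by rewrite -lee_fin eE En_ge0.
have [v [mv v0 v2 vp [vE vc]]] := concentrate s0 mg g0 g2 gp (esym eE) es1.
have := averaged_test n0 sg0 sg1 sgn sg4 mv v0 v2 vp s0 Sle vE r0 r1 (ltW c00) vc.
rewrite rl exprMn powRM ?(ltW r0)//.
have -> : r `^ (n%:R - 4 * sg) = r ^+ n / (r `^ (2 * sg)) ^+ 2.
  rewrite powRB ?(gt_eqF r0) ?implybT// powR_mulrn ?(ltW r0)//.
  by rewrite -(powR_mulrn 2) ?powR_ge0// -powRrM; congr (_ / _ `^ _); ring.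
have -> : cpot n sg * r `^ (2 * sg) *
  (c0 * (2 `^ (n%:R - 4 * sg) * (r ^+ n / r `^ (2 * sg) ^+ 2) * (om R n * l))) =
  rho * (K1 * l).
  by rewrite /K1 /rho; field; rewrite gt_eqF.
have -> : K1 * l = K2 + 1 by rewrite mulrC divfK// gt_eqF.
have rs1 : r `^ (2 * sg) <= 1.
  have sg2 : 0 <= 2 * sg by rewrite mulr_ge0// ltW.
  have rle : r <= 1 by lra.
  by have := ge0_ler_powR sg2 (ltW r0) ler01 rle; rewrite powR1.
have rr : r ^+ n <= rho.
  by rewrite ler_pdivlMr// ler_piMr// ltW.
have -> : 4 * Cm n sg / r `^ (2 * sg) *
   (2 ^+ n * r ^+ n * bvol R n * (3 ^+ n * bvol R n + 1)) =
   rho * (4 * Cm n sg * (2 ^+ n * bvol R n * (3 ^+ n * bvol R n + 1))).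
  by rewrite /rho; field; rewrite gt_eqF.
have B1 : (e - s) * (2 ^+ n * bvol R n) <= 2 * eps * (2 ^+ n * bvol R n).
  by apply: ler_wpM2r; [exact: ltW|lra].
have B2 : 2 ^+ n * r ^+ n * bvol R n * (s + 2 * e) <=
    rho * (2 ^+ n * bvol R n * (s + 2 * (s + 1))).
  have -> : 2 ^+ n * r ^+ n * bvol R n * (s + 2 * e) =
    r ^+ n * (2 ^+ n * bvol R n * (s + 2 * e)) by ring.
  apply: ler_pM => //; first exact: ltW.
    by apply: mulr_ge0; [exact: ltW|lra].
  by apply: ler_wpM2l; [exact: ltW|lra].
move=> H; have := le_trans H (lerD (lerD B1 B2) (lexx _)).
have -> : rho * (K2 + 1) = rho * (2 ^+ n * bvol R n * (s + 2 * (s + 1))) +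
    rho * (4 * Cm n sg * (2 ^+ n * bvol R n * (3 ^+ n * bvol R n + 1))) + rho.
  by rewrite /K2; ring.
lra.
Qed.
End concentration.

Theorem theorem1p1 (R : realType) (n : nat) (sigma : R) :
  (1 <= n)%N -> 0 < sigma -> sigma < 1 ->
  (n = 1%N -> sigma < 1 / 2) ->
  4 * sigma <= n%:R ->
  (S_half n sigma < S_full n sigma)%E.
Proof.
move=> n0 sg0 sg1 _ sg4; rewrite ltNge; apply/negP.
by apply: (S_full_not_le n0 sg0 sg1) => //; lra.
Qed.
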